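(* Let $H \in \mathcal{G}$. Then every compositional root of $H$ is a polynomial map; that is, if $n \geq 1$ and $F$ is an automorphism of $\mathbb{C}^2$ with $F^n = H$, then $F$ is a polynomial map. Moreover, $H$ has compositional roots of only finitely many distinct orders; that is, the set of integers $n \geq 1$ for which there exists an automorphism $F$ of $\mathbb{C}^2$ with $F^n = H$ is finite.
   Context: A generalized Hénon map is a map $\mathbb{C}^2 \to \mathbb{C}^2$ of the form $(z,w) \mapsto (w, p(w) - az)$, where $p$ is a monic polynomial of degree at least $2$ and $a \in \mathbb{C} \setminus \{0\}$. $\mathcal{G}$ denotes the set of all finite compositions of one or more such maps. An automorphism of $\mathbb{C}^2$ is a biholomorphic map of $\mathbb{C}^2$ onto itself (not assumed polynomial). $F^n$ denotes the $n$-fold composition of $F$ with itself. *)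

(* Defs.v *)
From HB Require Import structures.
From mathcomp Require Import all_boot all_order all_algebra.
From mathcomp Require Import polyXY complex.
From mathcomp Require Import all_classical all_reals all_analysis.
Import Order.TTheory GRing.Theory Num.Theory.
Import numFieldNormedType.Exports.

Set Implicit Arguments.
Unset Strict Implicit.
Unset Printing Implicit Defensive.

Local Open Scope classical_set_scope.
Local Open Scope ring_scope.

(* Typing R[i] as a numClosedFieldType makes the normed-module structure of a
   numeric field over itself available on it: R[i] has none of its own. *)
Definition Cplx (R : realType) : numClosedFieldType := R[i].

(* As a normed module over Cplx R, with the sup norm of the two coordinates. *)
Notation C2 R := (Cplx R * Cplx R)%type.

(* [differentiable] is Frechet differentiability over the scalar field of the
   normed modules, here Cplx R: the differential is required to be
   complex-linear. *)
Definition holomorphic (R : realType) (F : C2 R -> C2 R) : Prop :=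
  forall x : C2 R, differentiable F x.

Definition automorphism (R : realType) (F : C2 R -> C2 R) : Prop :=
  holomorphic F /\
  exists G : C2 R -> C2 R, [/\ holomorphic G, cancel F G & cancel G F].

Definition polynomial_map (R : realType) (F : C2 R -> C2 R) : Prop :=
  exists P Q : {poly {poly Cplx R}},
    forall z w : Cplx R, F (z, w) = (P.[z, w], Q.[z, w]).

Definition henon (R : realType) (p : {poly Cplx R}) (a : Cplx R)
    (x : C2 R) : C2 R :=
  (x.2, p.[x.2] - a * x.1).

(* [size p] is the degree plus one. *)
Definition generalized_henon (R : realType) (H : C2 R -> C2 R) : Prop :=
  exists (p : {poly Cplx R}) (a : Cplx R),
    [/\ p \is monic, (2 < size p)%N, a != 0 & H = henon p a].

Inductive henon_compositions (R : realType) : (C2 R -> C2 R) -> Prop :=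
| henon_compositions_base (H : C2 R -> C2 R) :
    generalized_henon H -> henon_compositions H
| henon_compositions_comp (H K : C2 R -> C2 R) :
    henon_compositions H -> henon_compositions K ->
    henon_compositions (H \o K).

(* F is a compositional root of H of order n. *)
Definition compositional_root (R : realType) (n : nat)
    (F H : C2 R -> C2 R) : Prop :=
  [/\ (1 <= n)%N, automorphism F & iter n F = H].

(* Main.v *)
Require Import Defs.
From mathcomp Require Import all_boot all_order all_algebra.
From mathcomp Require Import complex all_classical all_reals all_analysis.
From mathcomp Require Import polyXY ring lra zify.
Import Order.TTheory GRing.Theory Num.Theory.
Import numFieldNormedType.Exports.
Local Open Scope classical_set_scope.
Local Open Scope ring_scope.

(** Why the theorem holds.  Let D be the algebraic degree of H and let F be an
    automorphism with F^n = H.  Then F commutes with H and with its inverse.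

    Polynomial growth.  A Hénon map has a filtration: on the cone
    |w| >= max (|z|, R0) its second coordinate grows like the D-th power, and the
    inverse does the same to z on the opposite cone.  On a fixed bidisc B the map
    F is bounded, hence F = H^k F H^-k is bounded by A^(D^k) on H^k(B) and, in the
    same way, on H^-k(B).  These two sets are thin and do not exhaust a large
    ball, but their polynomial hull contains the ball of radius 2^(D^k)
    ([polynomial_hull]): in the coordinates w and q, where q is the first
    coordinate of H^-2k, they are the two bidiscs {|q| <= 4, |w| <= rho^2} and
    {|w| <= 4, |q| <= rho^2}, and a function that is bounded on both is bounded
    on {|q|, |w| <= rho} because of the logarithmic convexity of domains of
    convergence.  Letting k vary gives a polynomial bound for F
    ([commuting_growth]), and Liouville's theorem in each variable makes F
    polynomial ([commuting_polynomial]).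

    The hull estimate is proved for polynomials, by applying Cauchy's estimates
    to the characteristic polynomial of f on the fibres of q; entire functions
    are reduced to it by uniform approximation on bidiscs ([entire_approx2]).
    The Cauchy formula behind this approximation is obtained from Goursat's
    bisection argument, run on midpoint sums, so that no integral has to be
    constructed.

    Finiteness.  F and its inverse are now polynomially bounded, so that for k
    large Phi = H F H^(k+1) maps a far part of the cone |w| >= |z| into itself
    ([cone_invariance]).  Its second coordinate is a polynomial without zeros
    there, hence comparable to |w|^E for an integer E ([zero_free_growth]).
    Since Phi^n = H^((k+2)n+1), comparing the growth rates on both sides gives
    E^n = D^((k+2)n+1), which forces n to divide the exponent of a prime in the
    factorization of D; hence n < D ([root_order_lt]). *)

Set Implicit Arguments.
Unset Strict Implicit.
Unset Printing Implicit Defensive.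

(** * The modulus as a real number, and polynomial coefficients as averages *)

(** The norm of C takes its values in C, whose order is partial; a real-valued
    modulus makes linear arithmetic available. *)
Definition md (R : realType) (z : Cplx R) : R := ComplexField.Normc.normc z.

Section Modulus.
Context {R : realType}.
Local Notation C := (Cplx R).
Implicit Types (z w : C) (r : R).

Lemma normE z : `|z| = real_complex R (md z).
Proof. by case: z => a b. Qed.

Lemma md_ge0 z : 0 <= md z.
Proof. by case: z => a b; exact: sqrtr_ge0. Qed.

Lemma md0 : md 0 = 0 :> R.
Proof. exact: ComplexField.Normc.normc0. Qed.

Lemma md1 : md 1 = 1 :> R.
Proof. exact: ComplexField.Normc.normc1. Qed.

Lemma mdM z w : md (z * w) = md z * md w.
Proof. exact: ComplexField.Normc.normcM. Qed.

Lemma mdV z : md z^-1 = (md z)^-1.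
Proof. exact: ComplexField.Normc.normcV. Qed.

Lemma mdN z : md (- z) = md z.
Proof. exact: normcN. Qed.

Lemma mdD z w : md (z + w) <= md z + md w.
Proof. exact: le_normcD. Qed.

Lemma mdB z w : md (z - w) = md (w - z).
Proof. by rewrite -mdN opprB. Qed.

Lemma md_dist z w : md (z - w) <= md z + md w.
Proof. by rewrite -(mdN w) mdD. Qed.

Lemma md_eq0 z : (md z == 0) = (z == 0).
Proof.
apply/eqP/eqP => [|->]; last exact: md0.
exact: ComplexField.Normc.eq0_normc.
Qed.

Lemma md_gt0 z : (0 < md z) = (z != 0).
Proof. by rewrite lt0r md_ge0 andbT md_eq0. Qed.

Lemma mdX z n : md (z ^+ n) = md z ^+ n.
Proof. by elim: n => [|n IH]; rewrite ?expr0 ?md1// !exprS mdM IH. Qed.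

Lemma md_realr r : md (real_complex R r : C) = `|r|.
Proof. by rewrite /md /= expr0n /= addr0 sqrtr_sqr. Qed.

Lemma md_nat n : md (n%:R : C) = n%:R.
Proof.
have -> : (n%:R : C) = real_complex R n%:R by rewrite rmorph_nat.
by rewrite md_realr normr_nat.
Qed.

Lemma md_lb z w : md z - md w <= md (z + w).
Proof. by have := mdD (z + w) (- w); rewrite addrK mdN; lra. Qed.

Lemma md_sum (I : Type) (s : seq I) (P : pred I) (F : I -> C) :
  md (\sum_(i <- s | P i) F i) <= \sum_(i <- s | P i) md (F i).
Proof.
elim/big_ind2: _ => [|x1 x2 y1 y2 h1 h2|//]; first by rewrite md0.
by apply: le_trans (mdD _ _) _; apply: lerD.
Qed.

Lemma md_Re z : `|complex.Re z| <= md z.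
Proof.
case: z => a b; rewrite /md /= -sqrtr_sqr ler_wsqrtr//.
by rewrite lerDl sqr_ge0.
Qed.

Lemma md_Im z : `|complex.Im z| <= md z.
Proof.
case: z => a b; rewrite /md /= -sqrtr_sqr ler_wsqrtr//.
by rewrite lerDr sqr_ge0.
Qed.

Lemma md_ReIm z : md z <= `|complex.Re z| + `|complex.Im z|.
Proof.
have hz : z = real_complex R (complex.Re z) + 'i%C * real_complex R (complex.Im z).
  exact: complexE.
rewrite {1}hz; apply: le_trans (mdD _ _) _.
rewrite mdM !md_realr; suff -> : md ('i%C : C) = 1 by rewrite mul1r.
by rewrite /md /= expr0n /= add0r expr1n sqrtr1.
Qed.

Lemma md_i : md ('i%C : C) = 1.
Proof. by rewrite /md /= expr0n /= add0r expr1n sqrtr1. Qed.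

Lemma md_prim_root n (w : C) : n.-primitive_root w -> md w = 1.
Proof.
move=> pw; have n0 := prim_order_gt0 pw.
apply/eqP; rewrite -(pexpr_eq1 (n := n))// ?md_ge0//.
by rewrite -mdX (prim_expr_order pw) md1.
Qed.

(** Iterated square roots of -1 have order a power of two. *)
Lemma exists_prim_root k : exists w : C, (2 ^ k).-primitive_root w.
Proof.
case: k => [|k].
  exists 1; have [m pm] := prim_order_exists (ltn0Sn 0) (expr1n C 1).
  by rewrite dvdn1 expn0 => /eqP <-.
suff [w hw] : exists w : C, w ^+ (2 ^ k) = -1.
  exists w.
  have w1 : w ^+ (2 ^ k.+1) = 1 by rewrite expnSr exprM hw sqrrN expr1n.
  have [m pm] := prim_order_exists (expn_gt0 2 k.+1) w1.
  move=> /(dvdn_pfactor _ _ (isT : prime 2)) [j jk mE].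
  have [jk'|kj] := leqP j k.
    have : w ^+ (2 ^ k) = 1.
      by apply/eqP; rewrite -(prim_order_dvd pm) mE; apply: dvdn_exp2l.
    move/eqP; rewrite hw -subr_eq0 -opprD oppr_eq0 -(natrD _ 1 1).
    by rewrite pnatr_eq0.
  by rewrite (_ : k.+1 = j) -?mE//; lia.
elim: k => [|k [w hw]]; first by exists (-1); rewrite expn0 expr1.
exists (sqrtC w); by rewrite expnS exprM sqrtCK.
Qed.

End Modulus.

Section Coefficients.
Context {R : realType}.
Local Notation C := (Cplx R).

(** The discrete Fourier coefficient of g along the powers of w. For a
    primitive n-th root of unity it is the n-point Riemann sum of Cauchy's
    coefficient formula on the unit circle. *)
Definition dft (n : nat) (w : C) (i : nat) (g : C -> C) : C :=
  n%:R^-1 * \sum_(j < n) g (w ^+ j) * (w ^+ (j * i))^-1.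

Lemma prim_root_sum n (w : C) (i l : nat) : n.-primitive_root w ->
  (i < n)%N -> (l < n)%N ->
  \sum_(j < n) w ^+ (j * l) * (w ^+ (j * i))^-1 = if l == i then n%:R else 0.
Proof.
move=> pw ilt llt.
have w0 : w != 0 by rewrite -md_gt0 (md_prim_root pw) ltr01.
have -> : \sum_(j < n) w ^+ (j * l) * (w ^+ (j * i))^-1 =
          \sum_(j < n) (w ^+ l / w ^+ i) ^+ j.
  by apply: eq_bigr => j _; rewrite expr_div_n -!exprM mulnC (mulnC j i).
case: eqP => [->|/eqP li].
  rewrite divff ?expf_neq0//.
  by under eq_bigr do rewrite expr1n; rewrite sumr_const card_ord.
set x := w ^+ l / w ^+ i.
have x1 : x != 1.
  apply: contra li => /eqP xE.
  have : w ^+ l == w ^+ i by rewrite -[w ^+ i]mul1r -xE divfK ?expf_neq0.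
  by rewrite (eq_prim_root_expr pw) !modn_small.
apply: (@mulfI _ (x - 1)); first by rewrite subr_eq0.
rewrite -subrX1 mulr0 expr_div_n -!exprM mulnC (mulnC i) !exprM.
by rewrite (prim_expr_order pw) !expr1n divr1 subrr.
Qed.

Lemma dft_poly n (w : C) i (p : {poly C}) r : n.-primitive_root w ->
  (i < n)%N -> (size p <= n)%N ->
  dft n w i (fun z => p.[r * z]) = p`_i * r ^+ i.
Proof.
move=> pw ilt sp; rewrite /dft.
have n0 : n%:R != 0 :> C by rewrite pnatr_eq0; case: n ilt {pw sp}.
rewrite (eq_bigr (fun j : 'I_n => \sum_(l < n)
    p`_l * r ^+ l * (w ^+ (j * l) * (w ^+ (j * i))^-1))); last first.
  move=> j _; rewrite (horner_coef_wide _ sp) mulr_suml.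
  by apply: eq_bigr => l _; rewrite exprMn -exprM -!mulrA.
rewrite exchange_big /=.
under eq_bigr => l _ do rewrite -mulr_sumr (prim_root_sum pw)//.
rewrite (bigD1 (Ordinal ilt))//= eqxx big1 ?addr0.
  by rewrite mulrC mulfK.
by move=> l /negbTE hl; rewrite ifF ?mulr0.
Qed.

Lemma md_dft n (w : C) i (g : C -> C) M : n.-primitive_root w ->
  (forall j, md (g (w ^+ j)) <= M) -> md (dft n w i g) <= M.
Proof.
move=> pw gM; have n0 := prim_order_gt0 pw.
rewrite /dft mdM mdV md_nat ler_pdivrMl ?ltr0n//.
apply: le_trans (md_sum _ _ _) _.
apply: (@le_trans _ _ (\sum_(j < n) M)).
  apply: ler_sum => j _.
  by rewrite mdM mdV mdX (md_prim_root pw) expr1n invr1 mulr1.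
by rewrite sumr_const card_ord mulr_natl.
Qed.

(** Cauchy's estimate: the average over roots of unity is exact as soon as
    their order exceeds the degree. *)
Lemma poly_cauchy (p : {poly C}) (r M : R) i : 0 <= r ->
  (forall z, md z <= r -> md p.[z] <= M) -> md p`_i * r ^+ i <= M.
Proof.
move=> r0 pM; set k := maxn i (size p).
have [w pw] := @exists_prim_root R k.
have kn : (k < 2 ^ k)%N by exact: ltn_expl.
have := @dft_poly _ w i p (real_complex R r) pw.
move=> /(_ (leq_ltn_trans (leq_maxl _ _) kn)).
move=> /(_ (leq_trans (leq_maxr _ _) (ltnW kn))) e.
have -> : md p`_i * r ^+ i = md (p`_i * (real_complex R r) ^+ i).
  by rewrite mdM mdX md_realr ger0_norm.
rewrite -e; apply: md_dft => // j; apply: pM.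
by rewrite mdM mdX (md_prim_root pw) expr1n mulr1 md_realr ger0_norm.
Qed.

Lemma poly2_cauchy (P : {poly {poly C}}) (r s M : R) i j : 0 <= r -> 0 <= s ->
  (forall z w, md z <= r -> md w <= s -> md P.[z, w] <= M) ->
  md P`_i`_j * s ^+ j * r ^+ i <= M.
Proof.
move=> r0 s0 PM.
have h w : md w <= s -> md (P`_i).[w] * r ^+ i <= M.
  move=> ws; pose p := map_poly (horner_eval w) P.
  have -> : (P`_i).[w] = p`_i by rewrite coef_map.
  apply: poly_cauchy => // z zr.
  suff -> : p.[z] = P.[z, w] by exact: PM.
  rewrite /p -[RHS]/(horner_eval w P.[z%:P]) -horner_map /=.
  by rewrite /horner_eval hornerC.
have [->|ri] := eqVneq (r ^+ i) 0.
  rewrite mulr0; apply: le_trans (PM 0 0 _ _); rewrite ?md0//; exact: md_ge0.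
have ri0 : 0 < r ^+ i by rewrite lt0r ri exprn_ge0.
rewrite -ler_pdivlMr//; apply: poly_cauchy => // w ws.
by rewrite ler_pdivlMr//; apply: h.
Qed.

Lemma md_horner (p : {poly C}) z (B : R) :
  md z <= B -> md p.[z] <= \sum_(i < size p) md p`_i * B ^+ i.
Proof.
move=> zB; rewrite horner_coef; apply: le_trans (md_sum _ _ _) _.
apply: ler_sum => i _; rewrite mdM mdX ler_wpM2l ?md_ge0//.
by apply: lerXn2r => //; rewrite nnegrE ?md_ge0// (le_trans (md_ge0 z)).
Qed.

(** By Cauchy's estimate a coefficient of index larger than N would be bounded
    by a negative power of the radius. *)
Lemma poly_growth_size (p : {poly C}) (K : R) N :
  (forall z, md p.[z] <= K * Num.max 1 (md z) ^+ N) -> (size p <= N.+1)%N.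
Proof.
move=> pK; apply/leq_sizeP => j Nj; apply/eqP; rewrite -md_eq0.
apply: contraT => pj0; have pj : 0 < md p`_j by rewrite lt0r pj0 md_ge0.
have K0 : 0 <= K by have := le_trans (md_ge0 _) (pK 0); rewrite md0 max_l ?expr1n ?mulr1.
pose r := K / md p`_j + 1.
have r1 : 1 <= r by rewrite lerDr divr_ge0// ltW.
have r0 : 0 < r by apply: lt_le_trans r1.
have h : md p`_j * r ^+ j <= K * r ^+ N.
  apply: poly_cauchy; first exact: ltW.
  move=> z zr; apply: le_trans (pK z) _; apply: ler_wpM2l => //.
  apply: lerXn2r; rewrite ?nnegrE ?(ltW r0)//; first by rewrite le_max ler01.
  by rewrite ge_max r1.
have h2 : md p`_j * r <= K.
  rewrite -(ler_pM2r (exprn_gt0 N r0)); apply: le_trans h.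
  rewrite -mulrA -exprS; apply: ler_wpM2l; first exact: ltW.
  by apply: ler_weXn2l.
move: h2; rewrite /r mulrDr mulr1 mulrC divfK//.
by rewrite gerDl leNgt pj.
Qed.
End Coefficients.

(** * A polynomial hull estimate *)

Lemma slice_horner (K : comNzRingType) (P : {poly {poly K}}) (z w : K) :
  (map_poly (horner_eval w) P).[z] = P.[z, w].
Proof.
rewrite -[RHS]/(horner_eval w P.[z%:P]) -horner_map /=.
by rewrite /horner_eval hornerC.
Qed.

(** The companion matrix, with a dimension that is a free variable instead of
    an expression in p. *)
Lemma exists_char_poly (K : comNzRingType) n (p : {poly K}) :
  p \is monic -> size p = n.+1 -> exists A : 'M[K]_n, char_poly A = p.
Proof.
move=> pm sp; have : exists A : 'M[K]_((size p).-1), char_poly A = p.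
  by exists (companionmx p); apply: companionmxK.
by rewrite sp.
Qed.

Section SpectralMapping.
Context {K : closedFieldType} {n : nat} (A : 'M[K]_n.+1).

Lemma horner_mx_eigen (f : {poly K}) (v : 'rV[K]_n.+1) z :
  v *m A = z *: v -> v *m horner_mx A f = f.[z] *: v.
Proof.
move=> vA; elim/poly_ind: f => [|f c IH].
  by rewrite rmorph0 mulmx0 horner0 scale0r.
rewrite rmorphD rmorphM /= horner_mx_X horner_mx_C mulmxDr mulmxA IH.
by rewrite -scalemxAl vA scalerA mul_mx_scalar hornerMXaddC scalerDl.
Qed.

Lemma root_char_poly_horner (f : {poly K}) z :
  root (char_poly A) z -> root (char_poly (horner_mx A f)) f.[z].
Proof.
rewrite -!eigenvalue_root_char => /eigenvalueP[v vA v0].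
by apply/eigenvalueP; exists v => //; apply: horner_mx_eigen.
Qed.

Lemma prod_factors_kernel (rs : seq K) (v : 'rV[K]_n.+1) : v != 0 ->
  v *m horner_mx A (\prod_(z <- rs) ('X - z%:P)) = 0 ->
  exists2 z, z \in rs & root (char_poly A) z.
Proof.
elim: rs v => [|z rs IH] v v0.
  by rewrite big_nil rmorph1 mulmx1 => /eqP; rewrite (negbTE v0).
rewrite big_cons rmorphM /= mulmxA rmorphB /= horner_mx_X horner_mx_C => h.
have [v1|v1] := eqVneq (v *m (A - z%:M)) 0.
  exists z; first exact: mem_head.
  rewrite -eigenvalue_root_char; apply/eigenvalueP; exists v => //.
  by apply/eqP; rewrite -subr_eq0 -mul_mx_scalar -mulmxBr v1.
by have [y yrs ry] := IH _ v1 h; exists y; rewrite // inE yrs orbT.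
Qed.

(** Spectral mapping: f - y splits into linear factors, and one of the
    corresponding factors of f(A) - y is singular. *)
Lemma char_poly_horner_root (f : {poly K}) y :
  root (char_poly (horner_mx A f)) y ->
  exists2 z, root (char_poly A) z & y = f.[z].
Proof.
rewrite -eigenvalue_root_char => /eigenvalueP[v vB v0].
have [fy|fy] := eqVneq (f - y%:P) 0.
  have [z rz] : exists z, root (char_poly A) z.
    by apply/closed_rootP; rewrite size_char_poly.
  by exists z => //; apply/eqP; rewrite eq_sym -subr_eq0 -[y](hornerC _ z) -hornerN -hornerD fy horner0.
have [rs frs] := closed_field_poly_normal (f - y%:P).
have h : v *m horner_mx A (\prod_(z <- rs) ('X - z%:P)) = 0.
  have : v *m horner_mx A (f - y%:P) = 0.
    by rewrite rmorphB /= horner_mx_C mulmxBr mul_mx_scalar vB subrr.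
  rewrite frs linearZ /= -scalemxAr => /eqP.
  by rewrite scaler_eq0 lead_coef_eq0 (negbTE fy) => /eqP.
have [z zrs rz] := prod_factors_kernel v0 h; exists z => //.
apply/eqP; rewrite eq_sym -subr_eq0 -[y](hornerC _ z) -hornerN -hornerD frs.
by rewrite hornerZ [X in _ * X](_ : _ = 0) ?mulr0//; apply/rootP; rewrite root_prod_XsubC.
Qed.

End SpectralMapping.

Section RootBounds.
Context {R : realType}.
Local Notation C := (Cplx R).

Lemma prod_coef_bound (s : seq C) (M : R) j : 0 <= M ->
  (forall y, y \in s -> md y <= M) -> (j <= size s)%N ->
  md (\prod_(y <- s) ('X - y%:P))`_(size s - j) <= ((size s)%:R * M) ^+ j.
Proof.
move=> M0; elim: s j => [|y s IH] j sM jN.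
  by move: jN; rewrite leqn0 big_nil => /eqP ->; rewrite coef1 md1.
have IH' i : (i <= size s)%N ->
    md (\prod_(y <- s) ('X - y%:P))`_(size s - i) <= ((size s)%:R * M) ^+ i.
  by apply: IH => x xs; apply: sM; rewrite inE xs orbT.
have yM : md y <= M by apply: sM; apply: mem_head.
rewrite big_cons mulrBl coefB coefXM coefCM.
set P := \prod_(y <- s) _ in IH' *.
case: j jN => [|j] /= jN.
  rewrite !subn0 /= [P`_(size s).+1]nth_default ?mulr0 ?subr0 ?expr0; last first.
    by rewrite size_prod_XsubC.
  by have := IH' 0 isT; rewrite subn0 expr0.
set N := size s in IH' jN *; rewrite ltnS in jN.
have e1 : md (y * P`_(N - j)) <= M * (N%:R * M) ^+ j.
  by rewrite mdM; apply: ler_pM; rewrite ?md_ge0// IH'.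
have e2 : md (if (N.+1 - j.+1)%N == 0 then 0 else P`_(N.+1 - j.+1).-1)
   <= (N%:R * M) ^+ j.+1.
  have NM : 0 <= N%:R * M by rewrite mulr_ge0.
  case: ifPn => [_|]; first by rewrite md0 exprn_ge0.
  by rewrite subSS -subnS => h; apply: IH'; lia.
rewrite subSS in e2 *.
apply: le_trans (md_dist _ _) _; apply: le_trans (lerD e2 e1) _.
rewrite exprS -mulrDl.
rewrite [leRHS]exprS -[N.+1%:R]natr1 (mulrDl _ _ M) mul1r.
apply: ler_wpM2l; first by rewrite addr_ge0// mulr_ge0.
apply: lerXn2r; rewrite ?nnegrE ?addr_ge0 ?mulr_ge0//.
by rewrite lerDl.
Qed.

(** If y were larger than 8 B, the lower terms of p at y would add up to at
    most 4/7 of the leading one. *)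
Lemma root_bound (p : {poly C}) N (B : R) y : p \is monic -> size p = N.+1 ->
  0 <= B -> (forall j, (j <= N)%N -> md p`_(N - j) <= 4 * B ^+ j) ->
  root p y -> md y <= 8 * B.
Proof.
move=> pm sp B0 pB /rootP py; rewrite leNgt; apply/negP => hy.
set t := md y in hy.
have t0 : 0 < t by apply: le_lt_trans hy; rewrite mulr_ge0.
have key m : 7 * (\sum_(i < m) B ^+ (m - i) * t ^+ i) + B ^+ m <= t ^+ m.
  elim: m => [|m IH]; first by rewrite big_ord0 mulr0 add0r !expr0.
  rewrite big_ord_recl /= subn0 expr0 mulr1.
  rewrite (eq_bigr (fun i : 'I_m => t * (B ^+ (m - i) * t ^+ i))); last first.
    by move=> i _; rewrite subSS exprS mulrCA.
  rewrite -mulr_sumr; set S := \sum_(i < m) _ in IH *.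
  have := ler_wpM2l (ltW t0) IH.
  have : 0 <= B ^+ m * (t - 8 * B).
    by rewrite mulr_ge0 ?exprn_ge0// subr_ge0 ltW.
  rewrite (exprS t) (exprS B); lra.
have h : t ^+ N <= \sum_(i < N) 4 * (B ^+ (N - i) * t ^+ i).
  have yN : y ^+ N = - \sum_(i < N) p`_i * y ^+ i.
    move/monicP: pm; rewrite lead_coefE sp /= => pN.
    apply/eqP; rewrite -addr_eq0; apply/eqP; rewrite -[RHS]py horner_coef sp.
    by rewrite big_ord_recr /= pN mul1r addrC.
  rewrite /t -mdX yN mdN; apply: le_trans (md_sum _ _ _) _.
  apply: ler_sum => i _; rewrite mdM mdX mulrA.
  apply: ler_wpM2r; first by rewrite exprn_ge0 ?md_ge0.
  by have := pB (N - i)%N (leq_subr _ _); rewrite subKn// ltnW.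
have := key N; rewrite -mulr_sumr in h.
have : 0 < t ^+ N by rewrite exprn_gt0.
have : 0 <= B ^+ N by rewrite exprn_ge0.
lra.
Qed.

Lemma geom_half_sum m (K : R) : 0 <= K -> \sum_(i < m) K * 2^-1 ^+ i <= 2 * K.
Proof.
move=> K0; rewrite -mulr_sumr mulrC; apply: ler_wpM2r => //.
suff -> : \sum_(i < m) (2^-1 : R) ^+ i = 2 - 2 * 2^-1 ^+ m.
  by rewrite gerBl mulr_ge0// exprn_ge0// invr_ge0.
elim: m => [|m IH]; first by rewrite big_ord0 expr0; lra.
by rewrite big_ord_recr /= IH exprS; lra.
Qed.

(** Each coefficient s_ij satisfies one Cauchy estimate for each of the two
    thin bidiscs. Multiplying them gives |s_ij| <= K (2 rho)^-(i+j), which is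
    summable on the bidisc of radius rho. The radius 4 is the square of the 2
    in this bound. *)
Lemma bidisc_interpolation (S : {poly {poly C}}) (rho K : R) eta w :
  0 < rho ->
  (forall a b, md a <= 4 -> md b <= rho ^+ 2 -> md S.[a, b] <= K) ->
  (forall a b, md a <= rho ^+ 2 -> md b <= 4 -> md S.[a, b] <= K) ->
  md eta <= rho -> md w <= rho -> md S.[eta, w] <= 4 * K.
Proof.
move=> r0 h1 h2 he hw.
have K0 : 0 <= K.
  by apply: le_trans (h1 0 0 _ _); rewrite ?md_ge0// md0// exprn_ge0// ltW.
have p4 : 0 <= (4 : R) by [].
have coefb i j : md S`_i`_j * rho ^+ (i + j) <= K * 2^-1 ^+ (i + j).
  have c1 := @poly2_cauchy R S 4 (rho ^+ 2) K i j p4 (exprn_ge0 2 (ltW r0)) h1.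
  have c2 := @poly2_cauchy R S (rho ^+ 2) 4 K i j (exprn_ge0 2 (ltW r0)) p4 h2.
  rewrite exprVn -[leRHS]/(K / _) ler_pdivlMr ?exprn_gt0//.
  rewrite -(@ler_pXn2r _ 2)//; last first.
    by rewrite nnegrE !mulr_ge0 ?exprn_ge0 ?md_ge0// ltW.
  have sq (x : R) n : (x ^+ 2) ^+ n = x ^+ n * x ^+ n by rewrite -exprM mul2n -addnn exprD.
  have e4 : (4 : R) = 2 ^+ 2 by ring.
  have := ler_pM _ _ c1 c2; rewrite -[K * K]expr2 => cc; apply: le_trans (cc _ _).
  - by rewrite e4 !sq !exprD le_eqVlt; apply/orP; left; apply/eqP; ring.
  - by rewrite !mulr_ge0 ?exprn_ge0 ?md_ge0// ltW.
  - by rewrite !mulr_ge0 ?exprn_ge0 ?md_ge0// ltW.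
rewrite -slice_horner; apply: le_trans (md_horner _ he) _.
apply: (@le_trans _ _ (\sum_(i < size (map_poly (horner_eval w) S)) 2 * K * 2^-1 ^+ i)).
  apply: ler_sum => i _; rewrite coef_map /= /horner_eval.
  apply: le_trans (ler_wpM2r _ (md_horner _ hw)) _; first by rewrite exprn_ge0// ltW.
  rewrite mulr_suml.
  apply: (@le_trans _ _ (\sum_(j < size S`_i) (K * 2^-1 ^+ i) * 2^-1 ^+ j)).
    apply: ler_sum => j _; rewrite -!mulrA -!exprD [(i + j)%N]addnC.
    by have := coefb i j; rewrite addnC.
  rewrite -(mulrA 2); apply: geom_half_sum.
  by rewrite mulr_ge0// exprn_ge0.
apply: le_trans (geom_half_sum _ _) _; first by rewrite mulr_ge0.
lra.
Qed.
End RootBounds.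

Section Hull.
Context {R : realType}.
Local Notation C := (Cplx R).

(** On the fibre q(., w) = eta the values of f are the eigenvalues of f(A),
    where A is the companion matrix of (q - eta)/l. The coefficients of the
    characteristic polynomial of f(A) are polynomials in eta and w, to which
    bidisc_interpolation applies; the loss in returning from coefficients to
    roots is a factor linear in the number of roots. *)
Lemma polynomial_hull n (q f : {poly {poly C}}) (l : C) (rho M : R) :
  size q = n.+2 -> lead_coef q = l%:P -> l != 0 -> 0 < rho ->
  (forall z w, md w <= rho ^+ 2 -> md q.[z, w] <= 4 -> md f.[z, w] <= M) ->
  (forall z w, md w <= 4 -> md q.[z, w] <= rho ^+ 2 -> md f.[z, w] <= M) ->
  forall z w, md w <= rho -> md q.[z, w] <= rho ->
  md f.[z, w] <= 8 * (n.+1%:R * M).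
Proof.
move=> sq lq l0 r0 h1 h2 z0 w0 hw0 hq0.
pose K : comNzRingType := {poly {poly C}}.
pose q' : {poly K} := map_poly polyC (l^-1%:P *: q).
pose c : K := l^-1%:P *: 'X.
have l0' : (l^-1)%:P != 0 :> {poly C} by rewrite polyC_eq0 invr_eq0.
have sq' : size q' = n.+2.
  rewrite size_map_inj_poly ?polyC0//; last exact: polyC_inj.
  by rewrite size_scale.
pose p := q' - c%:P.
have sc : (size (- c%:P) < size q')%N.
  by rewrite size_polyN sq' (leq_ltn_trans (size_polyC_leq1 _)).
have sp : size p = n.+2 by rewrite size_polyDl.
have pm : p \is monic.
  rewrite monicE lead_coefDl// lead_coef_map_inj ?polyC0//; last exact: polyC_inj.
  by rewrite lead_coefZ lq -polyCM mulVf.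
have [A cA] := exists_char_poly pm sp.
pose f' : {poly K} := map_poly polyC f.
pose chi := char_poly (horner_mx A f').
have evq eta w z : (map_poly (horner_eval w \o horner_eval eta%:P) p).[z] =
    l^-1 * (q.[z, w] - eta).
  rewrite rmorphB /= hornerD hornerN map_polyC hornerC /= /q' -map_poly_comp.
  rewrite (eq_map_poly (g := horner_eval w)); last first.
    by move=> u /=; rewrite /horner_eval hornerC.
  rewrite slice_horner !hornerZ hornerM !hornerC.
  by rewrite /c /horner_eval !hornerZ hornerX hornerM !hornerC mulrBr.
have evf eta w z : (map_poly (horner_eval w \o horner_eval eta%:P) f').[z] =
    f.[z, w].
  rewrite -map_poly_comp -slice_horner; congr (_.[z]); apply: eq_map_poly.
  by move=> u /=; rewrite /horner_eval hornerC.
(* The roots of chi at (eta, w) are the values of f on the fibre q = eta. *)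
pose ev eta w := map_poly (horner_eval w \o horner_eval eta%:P) chi.
have evm eta w : ev eta w \is monic by apply: monic_map; apply: char_poly_monic.
have evs eta w : size (ev eta w) = n.+2.
  by rewrite size_map_poly_id0 ?size_char_poly// (monicP (char_poly_monic _)) rmorph1 oner_neq0.
have evE eta w : ev eta w = char_poly (horner_mx
     (map_mx (horner_eval w \o horner_eval eta%:P) A)
     (map_poly (horner_eval w \o horner_eval eta%:P) f')).
  by rewrite /ev map_char_poly map_horner_mx.
have rootE eta w y : root (ev eta w) y -> exists2 z, q.[z, w] = eta & y = f.[z, w].
  rewrite evE => /char_poly_horner_root[z]; rewrite -map_char_poly cA evf => rz ->.
  exists z => //; move: rz; rewrite /root evq mulf_eq0 invr_eq0 (negbTE l0) /=.
  by rewrite subr_eq0 => /eqP.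
have rootI z w : root (ev q.[z, w] w) f.[z, w].
  rewrite evE -(evf q.[z, w]); apply: root_char_poly_horner.
  by rewrite -map_char_poly cA /root evq subrr mulr0.
have M0 : 0 <= M.
  have [z rz] : exists z, root (map_poly (horner_eval 0) q) z.
    apply/closed_rootP; rewrite size_map_poly_id0 ?sq//.
    by rewrite lq /horner_eval hornerC.
  apply: le_trans (h1 z 0 _ _); rewrite ?md_ge0// ?md0 ?exprn_ge0 ?ltW//.
  by move/rootP: rz; rewrite slice_horner => ->; rewrite md0.
have coefM eta w : (forall z, q.[z, w] = eta -> md f.[z, w] <= M) ->
    forall j, (j <= n.+1)%N ->
    md (chi`_(n.+1 - j)).[eta, w] <= (n.+1%:R * M) ^+ j.
  move=> hM j jn.
  have [rs frs] := closed_field_poly_normal (ev eta w).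
  rewrite (monicP (evm eta w)) scale1r in frs.
  have srs : size rs = n.+1 by have := evs eta w; rewrite frs size_prod_XsubC => -[].
  have -> : (chi`_(n.+1 - j)).[eta, w] = (ev eta w)`_(n.+1 - j) by rewrite coef_map.
  rewrite frs -srs; apply: prod_coef_bound => //; last by rewrite srs.
  move=> y yrs; have /rootE[z qz ->] : root (ev eta w) y.
    by rewrite frs root_prod_XsubC.
  exact: hM.
apply: (@root_bound R (ev q.[z0, w0] w0) n.+1) => //; first by rewrite mulr_ge0.
move=> j jn; rewrite coef_map /=.
apply: (@bidisc_interpolation R chi`_(n.+1 - j) rho) => // a b ha hb; apply: coefM => //.
- by move=> z qz; apply: h1 => //; rewrite qz.
- by move=> z qz; apply: h2 => //; rewrite qz.
Qed.
End Hull.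

(** * Bisection and compactness in C *)

Section Bisection.
Context {R : realType}.
Local Notation C := (Cplx R).

Lemma real_geometric_limit (x : nat -> R) (d : R) : 0 <= d ->
  (forall n, `|x n.+1 - x n| <= d * 2^-1 ^+ n) ->
  exists c, forall n, `|x n - c| <= 2 * (d * 2^-1 ^+ n).
Proof.
move=> d0 hx.
pose e n := 2 * (d * 2^-1 ^+ n).
have e0 n : 0 <= e n by rewrite !mulr_ge0// exprn_ge0.
have eS n : e n = 2 * e n.+1 by rewrite /e exprS; field.
have eSE n : d * 2^-1 ^+ n = e n.+1 by rewrite /e exprS; field.
have ylt n m : (n <= m)%N -> x n - e n <= x m - e m.
  move=> nm; rewrite -(subnK nm); elim: (m - n)%N => [|k IH]; first by rewrite add0n.
  rewrite addSn; apply: le_trans IH _.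
  have := hx (k + n)%N; rewrite eSE ler_norml => /andP[h _].
  have := eS (k + n)%N; lra.
have zlt n m : (n <= m)%N -> x m + e m <= x n + e n.
  move=> nm; rewrite -(subnK nm); elim: (m - n)%N => [|k IH]; first by rewrite add0n.
  rewrite addSn; apply: le_trans _ IH.
  have := hx (k + n)%N; rewrite eSE ler_norml => /andP[_ h].
  have := eS (k + n)%N; lra.
have yz n m : x n - e n <= x m + e m.
  case: (leqP n m) => [nm|/ltnW mn].
    by have := ylt _ _ nm; have := e0 m; lra.
  by have := zlt _ _ mn; have := e0 n; lra.
pose S := [set x n - e n | n in setT]%classic.
have S0 : (S !=set0)%classic by exists (x 0%N - e 0%N), 0%N.
exists (sup S) => n; rewrite -/(e n).
have u1 : x n - e n <= sup S.
  apply: sup_upper_bound; last by exists n.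
  by split => //; exists (x 0%N + e 0%N) => _ [m _ <-].
have u2 : sup S <= x n + e n.
  by apply: ge_sup => // _ [m _ <-].
rewrite ler_norml; apply/andP; split; lra.
Qed.

Lemma geometric_limit (x : nat -> C) (d : R) : 0 <= d ->
  (forall n, md (x n.+1 - x n) <= d * 2^-1 ^+ n) ->
  exists c, forall n, md (x n - c) <= 4 * (d * 2^-1 ^+ n).
Proof.
move=> d0 hx.
have [c1 h1] : exists c, forall n, `|complex.Re (x n) - c| <= 2 * (d * 2^-1 ^+ n).
  apply: real_geometric_limit => // n; apply: le_trans (hx n).
  apply: le_trans (md_Re _); by case: (x n.+1) (x n) => a b [a' b'].
have [c2 h2] : exists c, forall n, `|complex.Im (x n) - c| <= 2 * (d * 2^-1 ^+ n).
  apply: real_geometric_limit => // n; apply: le_trans (hx n).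
  apply: le_trans (md_Im _); by case: (x n.+1) (x n) => a b [a' b'].
exists (Complex c1 c2) => n; apply: le_trans (md_ReIm _) _.
have := h1 n; have := h2 n; set g := d * 2^-1 ^+ n.
by case: (x n) => a b /= u v; lra.
Qed.

(** A bad property that always survives in a part of half the size holds at
    arbitrarily small scales next to some point c. *)
Lemma bisection (T : Type) (pt : T -> C) (B : R -> T -> Prop) :
  (forall (d : R) t, 0 < d -> B d t ->
     exists t', B (d / 2) t' /\ md (pt t' - pt t) <= d) ->
  forall (d : R) t, 0 < d -> B d t ->
  exists c, forall e : R, 0 < e -> exists (d' : R) t',
    [/\ 0 < d', d' < e, B d' t' & md (pt t' - c) <= 4 * d'].
Proof.
move=> step d t d0 Bt.
pose next (p : R * T) : R * T := (p.1 / 2,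
  match pselect (exists t', B (p.1 / 2) t' /\ md (pt t' - pt p.2) <= p.1) with
  | left h => projT1 (cid h) | right _ => p.2 end).
pose u n := iter n next (d, t).
have u1 n : (u n).1 = d * 2^-1 ^+ n.
  by elim: n => [|n IH]; rewrite ?expr0 ?mulr1//= -/(u n) IH exprSr mulrA.
have up n : 0 < (u n).1 by rewrite u1 mulr_gt0// exprn_gt0.
have uB n : B (u n).1 (u n).2.
  elim: n => //= n IH; rewrite -/(u n).
  case: pselect => [h|/(_ (step _ _ (up n) IH))//].
  by case: (cid h) => ? [].
have uS n : md (pt (u n.+1).2 - pt (u n).2) <= d * 2^-1 ^+ n.
  rewrite /= -/(u n) -u1.
  case: pselect => [h|/(_ (step _ _ (up n) (uB n)))//].
  by case: (cid h) => ? [].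
have [c hc] := geometric_limit (ltW d0) uS.
exists c => e e0.
have [n hn] : exists n, d * 2^-1 ^+ n < e.
  have de : 0 <= d / e by rewrite divr_ge0 // ltW.
  exists (Num.bound (d / e)).
  rewrite exprVn ltr_pdivrMr ?exprn_gt0// mulrC -ltr_pdivrMr//.
  apply: lt_trans (archi_boundP de) _.
  by rewrite -natrX ltr_nat ltn_expl.
by exists (u n).1, (u n).2; split => //; rewrite u1.
Qed.

(** Compactness of discs: thresholds n that are sufficient near each point
    have a common upper bound. *)
Lemma disc_compact (Q : nat -> C -> Prop) (r : R) :
  (forall m n z, (m <= n)%N -> Q m z -> Q n z) ->
  (forall a, exists2 e : R, 0 < e & exists n, forall z, md (z - a) < e -> Q n z) ->
  exists n, forall z, md z <= r -> Q n z.
Proof.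
move=> Qmono Qloc.
pose inS (d : R) (c x : C) :=
  `|complex.Re (x - c)| <= d /\ `|complex.Im (x - c)| <= d.
pose B (d : R) (c : C) := ~ exists n, forall x, inS d c x -> Q n x.
suff nB : ~ B (`|r| + 1) 0.
  have [n hn] := contrapT nB; exists n => z zr; apply: hn.
  have rz : md z <= `|r| + 1 by have := ler_norm r; lra.
  rewrite /inS subr0; split.
    by apply: le_trans rz; apply: md_Re.
  by apply: le_trans rz; apply: md_Im.
have d0 : 0 < `|r| + 1 by have := normr_ge0 r; lra.
move=> /(bisection (pt := id)); case/(_ _ d0).
  move=> d c dp Bc.
  pose ch (s1 s2 : R) : C := c + Complex (s1 * (d / 2)) (s2 * (d / 2)).
  have hch s1 s2 : `|s1| = 1 -> `|s2| = 1 -> md (ch s1 s2 - c) <= d.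
    move=> e1 e2; rewrite /ch addrC addKr; apply: le_trans (md_ReIm _) _ => /=.
    rewrite (normrM s1) (normrM s2) e1 e2 !mul1r ger0_norm ?divr_ge0 ?(ltW dp)//; lra.
  apply: contrapT => hn.
  have hg s1 s2 : `|s1| = 1 -> `|s2| = 1 ->
      exists n, forall x, inS (d / 2) (ch s1 s2) x -> Q n x.
    move=> e1 e2; apply: contrapT => hB; apply: hn; exists (ch s1 s2).
    by split => //; apply: hch.
  have n1 : `|1| = 1 :> R by rewrite normr1.
  have nN1 : `|-1| = 1 :> R by rewrite normrN1.
  have [m1 q1] := hg _ _ n1 n1; have [m2 q2] := hg _ _ n1 nN1.
  have [m3 q3] := hg _ _ nN1 n1; have [m4 q4] := hg _ _ nN1 nN1.
  apply: Bc; exists (maxn (maxn m1 m2) (maxn m3 m4)) => x [].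
  case: x c @ch {hch hn hg} q1 q2 q3 q4 => [x y] [a b] /=.
  rewrite /inS /= => q1 q2 q3 q4.
  rewrite !ler_norml => /andP[xl xu] /andP[yl yu].
  have [xs|xs] := lerP 0 (x - a); have [ys|ys] := lerP 0 (y - b).
  - apply: (Qmono m1); first by rewrite !leq_max leqnn.
    by apply: q1; rewrite /= !ler_norml; split; apply/andP; split; lra.
  - apply: (Qmono m2); first by rewrite !leq_max leqnn !orbT.
    by apply: q2; rewrite /= !ler_norml; split; apply/andP; split; lra.
  - apply: (Qmono m3); first by rewrite !leq_max leqnn !orbT.
    by apply: q3; rewrite /= !ler_norml; split; apply/andP; split; lra.
  - apply: (Qmono m4); first by rewrite !leq_max leqnn !orbT.
    by apply: q4; rewrite /= !ler_norml; split; apply/andP; split; lra.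
move=> c hc; have [e e0 [n hn]] := Qloc c.
have e6 : 0 < e / 6 by rewrite divr_gt0.
have [d [t [dp de Bt tc]]] := hc _ e6.
apply: Bt; exists n => x [x1 x2]; apply: hn.
have -> : x - c = (x - t) + (t - c) by rewrite addrA subrK.
apply: le_lt_trans (mdD _ _) _.
by have := md_ReIm (x - t); lra.
Qed.

Lemma bidisc_compact (Q : nat -> C -> C -> Prop) (r : R) :
  (forall m n z w, (m <= n)%N -> Q m z w -> Q n z w) ->
  (forall a b, exists2 e : R, 0 < e & exists n, forall z w,
     md (z - a) < e -> md (w - b) < e -> Q n z w) ->
  exists n, forall z w, md z <= r -> md w <= r -> Q n z w.
Proof.
move=> Qmono Qloc.
have [n hn] : exists n, forall z, md z <= r -> forall w, md w <= r -> Q n z w.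
  apply: disc_compact => [m n z mn h w wr|a]; first exact/(Qmono _ _ _ _ mn)/h.
  have [n hn] : exists n, forall w, md w <= r ->
      forall z, md (z - a) < n.+1%:R^-1 -> Q n z w.
    apply: disc_compact => [m n w mn h z zn|b].
      apply: (Qmono _ _ _ _ mn); apply: h; apply: lt_le_trans zn _.
      by rewrite lef_pV2 ?posrE ?ltr0n// ler_nat.
    have [e e0 [n hn]] := Qloc a b; exists e => //.
    exists (maxn n (Num.bound e^-1)) => w wb z za.
    apply: (Qmono n); first exact: leq_maxl.
    apply: hn => //; apply: lt_trans za _; rewrite -[ltRHS]invrK.
    rewrite ltf_pV2 ?posrE ?invr_gt0// ?ltr0n//.
    apply: lt_le_trans (archi_boundP _) _; first by rewrite invr_ge0 ltW.
    by rewrite ler_nat; apply: leq_trans (leq_maxr _ _) (leqnSn _).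
  exists n.+1%:R^-1; first by rewrite invr_gt0 ltr0n.
  by exists n => z za w wr; apply: hn.
by exists n => z w zr wr; apply: hn.
Qed.

Definition jointly_continuous (f : C -> C -> C) := forall a b (e : R), 0 < e ->
  exists2 dl : R, 0 < dl & forall z w, md (z - a) < dl -> md (w - b) < dl ->
    md (f z w - f a b) <= e.

Lemma jointly_continuous_bounded f (r : R) : jointly_continuous f ->
  exists M, forall z w, md z <= r -> md w <= r -> md (f z w) <= M.
Proof.
move=> fc.
have [n hn] : exists n, forall z w, md z <= r -> md w <= r -> md (f z w) <= n%:R.
  apply: bidisc_compact => [m n z w mn h|a b].
    by apply: le_trans h _; rewrite ler_nat.
  have [e e0 he] := fc a b 1 ltr01; exists e => //.
  exists (Num.bound (1 + md (f a b))) => z w za wb.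
  apply: ltW; apply: le_lt_trans (archi_boundP _); last by rewrite addr_ge0 ?md_ge0.
  rewrite -[f z w](subrK (f a b)); apply: le_trans (mdD _ _) _.
  by rewrite lerD2r; apply: he.
by exists n%:R.
Qed.

Lemma jointly_continuous_uniform f r (e : R) : jointly_continuous f -> 0 < e ->
  exists2 dl : R, 0 < dl & forall z w z' w', md z <= r -> md w <= r ->
    md (z' - z) < dl -> md (w' - w) < dl -> md (f z' w' - f z w) <= e.
Proof.
move=> fc e0.
have [n hn] : exists n, forall z w, md z <= r -> md w <= r ->
  forall z' w', md (z' - z) < n.+1%:R^-1 -> md (w' - w) < n.+1%:R^-1 ->
    md (f z' w' - f z w) <= e.
  apply: bidisc_compact => [m n z w mn h z' w' hz hw|a b].
    have mn' : n.+1%:R^-1 <= m.+1%:R^-1 :> R.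
      by rewrite lef_pV2 ?posrE ?ltr0n// ler_nat.
    by apply: h; [apply: lt_le_trans hz _|apply: lt_le_trans hw _].
  have e2 : 0 < e / 2 by rewrite divr_gt0.
  have [dl dl0 hd] := fc a b _ e2.
  have d2 : 0 < dl / 2 by rewrite divr_gt0.
  exists (dl / 2) => //; exists (Num.bound (dl / 2)^-1) => z w za wb z' w' hz hw.
  have nb : (Num.bound (dl / 2)^-1).+1%:R^-1 < dl / 2.
    rewrite -[ltRHS]invrK ltf_pV2 ?posrE ?invr_gt0 ?ltr0n//.
    apply: lt_le_trans (archi_boundP _) _; first by rewrite invr_ge0 ltW.
    by rewrite ler_nat leqnSn.
  have {}hz := lt_trans hz nb; have {nb}hw := lt_trans hw nb.
  have z1 : md (f z' w' - f a b) <= e / 2.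
    apply: hd.
      have -> : z' - a = (z' - z) + (z - a) by rewrite addrA subrK.
      by apply: le_lt_trans (mdD _ _) _; lra.
    have -> : w' - b = (w' - w) + (w - b) by rewrite addrA subrK.
    by apply: le_lt_trans (mdD _ _) _; lra.
  have z2 : md (f z w - f a b) <= e / 2 by apply: hd; lra.
  have -> : f z' w' - f z w = (f z' w' - f a b) - (f z w - f a b).
    by rewrite opprB addrA subrK.
  by apply: le_trans (md_dist _ _) _; lra.
exists n.+1%:R^-1; first by rewrite invr_gt0 ltr0n.
by move=> z w z' w' zr wr; apply: hn.
Qed.

End Bisection.

(** * Goursat's theorem for midpoint sums *)

Section Goursat.
Context {R : realType}.
Local Notation C := (Cplx R).
Implicit Types (h : C -> C) (P Q S z : C) (D : C -> Prop).

Definition cdiff h c := exists A : C, forall e : R, 0 < e ->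
  exists2 dl : R, 0 < dl & forall z, md (z - c) < dl ->
    md (h z - h c - A * (z - c)) <= e * md (z - c).

Definition mid P Q : C := (P + Q) / 2.

(** The average of h over 2^k midpoints of the segment PQ. The recursion makes
    additivity under bisection hold by definition, and midpoints make the
    average exact on affine functions and invariant under reversal. *)
Fixpoint mean h k P Q : C :=
  if k is k'.+1 then (mean h k' P (mid P Q) + mean h k' (mid P Q) Q) / 2
  else h (mid P Q).

Definition vanish (u : nat -> C) :=
  forall e : R, 0 < e -> exists K, forall k, (K <= k)%N -> md (u k) <= e.

(** Closure under midpoints is the part of convexity that midpoint sums can
    see. *)
Definition midclosed D := forall x y, D x -> D y -> D (mid x y).

Lemma midC P Q : mid P Q = mid Q P. Proof. by rewrite /mid addrC. Qed.

Lemma ball_midclosed c (r : R) : midclosed (fun z => md (z - c) <= r).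
Proof.
move=> x y hx hy; have -> : mid x y - c = 2^-1 * (x - c) + 2^-1 * (y - c).
  by rewrite /mid; field.
apply: le_trans (mdD _ _) _; rewrite !mdM mdV md_nat; lra.
Qed.

Lemma mean_ext D h1 h2 k P Q : midclosed D -> D P -> D Q ->
  (forall z, D z -> h1 z = h2 z) -> mean h1 k P Q = mean h2 k P Q.
Proof.
move=> Dm; elim: k P Q => [|k IH] P Q DP DQ hh /=; first by apply: hh; apply: Dm.
have DM := Dm _ _ DP DQ; by rewrite !IH.
Qed.

Lemma mean_bound D h k P Q (M : R) : midclosed D -> D P -> D Q ->
  (forall z, D z -> md (h z) <= M) -> md (mean h k P Q) <= M.
Proof.
move=> Dm; elim: k P Q => [|k IH] P Q DP DQ hh /=; first by apply: hh; apply: Dm.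
have DM := Dm _ _ DP DQ.
rewrite mdM mdV md_nat; apply: le_trans (_ : (M + M) / 2 <= M); last by lra.
by apply: ler_wpM2r; rewrite ?invr_ge0//; apply: le_trans (mdD _ _) _; apply: lerD; apply: IH.
Qed.

Lemma mean_affine A B k P Q : mean (fun z => A + B * z) k P Q = A + B * mid P Q.
Proof.
by elim: k P Q => [|k IH] P Q //=; rewrite !IH /mid; field.
Qed.

Lemma mean_cst A k P Q : mean (fun _ => A) k P Q = A.
Proof. by elim: k P Q => [|k IH] P Q //=; rewrite !IH; field. Qed.

Lemma mean_add h1 h2 k P Q :
  mean (fun z => h1 z + h2 z) k P Q = mean h1 k P Q + mean h2 k P Q.
Proof.
by elim: k P Q => [|k IH] P Q //=; rewrite !IH; field.
Qed.

Lemma mean_scale A h k P Q : mean (fun z => A * h z) k P Q = A * mean h k P Q.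
Proof.
by elim: k P Q => [|k IH] P Q //=; rewrite !IH; field.
Qed.

Lemma mean_sym h k P Q : mean h k P Q = mean h k Q P.
Proof.
elim: k P Q => [|k IH] P Q /=; first by rewrite midC.
by rewrite (IH P) (IH _ Q) (midC Q P) addrC.
Qed.

Lemma mean_subst h k A B P Q :
  mean h k (A + B * P) (A + B * Q) = mean (fun z => h (A + B * z)) k P Q.
Proof.
have mE x y : mid (A + B * x) (A + B * y) = A + B * mid x y.
  by rewrite /mid; field.
by elim: k P Q => [|k IH] P Q //=; rewrite mE // !IH.
Qed.

(** A Cauchy criterion uniform in h: only the oscillation of h at scale 2^-k
    enters. *)
Lemma mean_rate D h k j P Q (e : R) : midclosed D -> D P -> D Q ->
  (forall z z', D z -> D z' -> md (z' - z) <= md (Q - P) * 2^-1 ^+ k ->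
     md (h z' - h z) <= e) ->
  md (mean h (k + j) P Q - mean h k P Q) <= e.
Proof.
move=> Dm; elim: k P Q => [|k IH] P Q DP DQ hh.
  have DM := Dm _ _ DP DQ; rewrite add0n expr0 mulr1 in hh *.
  have -> : mean h j P Q - mean h 0 P Q =
      mean (fun z => h z + (- h (mid P Q))) j P Q by rewrite mean_add mean_cst.
  have D'm : midclosed (fun z => D z /\ md (z - mid P Q) <= md (Q - P)).
    move=> x y [Dx hx] [Dy hy]; split; first exact: Dm.
    exact: ball_midclosed hx hy.
  apply: (mean_bound _ D'm).
  - split=> //; have -> : P - mid P Q = - (2^-1 * (Q - P)) by rewrite /mid; field.
    by rewrite mdN mdM mdV md_nat; have := md_ge0 (Q - P); lra.
  - split=> //; have -> : Q - mid P Q = 2^-1 * (Q - P) by rewrite /mid; field.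
    by rewrite mdM mdV md_nat; have := md_ge0 (Q - P); lra.
  - by move=> z [Dz hz]; apply: hh.
have DM := Dm _ _ DP DQ; rewrite addSn /=.
set a := mean _ _ _ _; set b := mean _ _ _ _; set c := mean _ _ _ _; set d := mean _ _ _ _.
have -> : (a + b) / 2 - (c + d) / 2 = 2^-1 * (a - c) + 2^-1 * (b - d) by field.
have h1 : md (a - c) <= e.
  apply: IH => // z z' Dz Dz' hz; apply: hh => //; apply: le_trans hz _.
  have -> : mid P Q - P = 2^-1 * (Q - P) by rewrite /mid; field.
  by rewrite mdM mdV md_nat exprS mulrCA mulrA.
have h2 : md (b - d) <= e.
  apply: IH => // z z' Dz Dz' hz; apply: hh => //; apply: le_trans hz _.
  have -> : Q - mid P Q = 2^-1 * (Q - P) by rewrite /mid; field.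
  by rewrite mdM mdV md_nat exprS mulrCA mulrA.
by apply: le_trans (mdD _ _) _; rewrite !mdM mdV md_nat; lra.
Qed.

(** The midpoint approximation of the integral of h along PQ. *)
Definition edge h k P Q := (Q - P) * mean h k P Q.

Lemma edge_split h k P Q :
  edge h k.+1 P Q = edge h k P (mid P Q) + edge h k (mid P Q) Q.
Proof. by rewrite /edge /= /mid; field. Qed.

Lemma edge_opp h k P Q : edge h k Q P = - edge h k P Q.
Proof. by rewrite /edge mean_sym -mulNr opprB. Qed.

Definition tri h k P Q S := edge h k P Q + edge h k Q S + edge h k S P.

Lemma tri_split h k P Q S (A := mid P Q) (B := mid Q S) (E := mid S P) :
  tri h k.+1 P Q S = tri h k P A E + tri h k A Q B + tri h k E B S + tri h k A B E.
Proof.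
rewrite /tri !edge_split -/A -/B -/E (edge_opp _ _ A E) (edge_opp _ _ A B).
by rewrite (edge_opp _ _ B E); ring.
Qed.

Lemma tri_affine A B k P Q S : tri (fun z => A + B * z) k P Q S = 0.
Proof. by rewrite /tri /edge !mean_affine /mid; field. Qed.

Lemma md_edge D h k P Q (d M : R) : midclosed D -> D P -> D Q ->
  md (Q - P) <= d -> (forall z, D z -> md (h z) <= M) -> md (edge h k P Q) <= d * M.
Proof.
by move=> Dm DP DQ hd hM; rewrite mdM; apply: ler_pM; rewrite ?md_ge0//; apply: (mean_bound _ Dm).
Qed.

(** If the sum over a triangle did not become smaller than e d^2, with d its
    size, the same would hold for one of its four quarters, and so on down to
    a point c of D. Near c the function h is affine up to o(|z - c|), and
    triangle sums of affine functions vanish exactly. *)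
Lemma goursat h D P Q S : midclosed D ->
  (forall c, (forall e : R, 0 < e -> exists2 z, D z & md (z - c) < e) -> D c) ->
  (forall c, D c -> cdiff h c) -> D P -> D Q -> D S ->
  vanish (fun k => tri h k P Q S).
Proof.
move=> Dm Dcl hD DP DQ DS e e0; apply: contrapT => hbad.
pose diam (d : R) (t : C * C * C) :=
  [/\ md (t.1.2 - t.1.1) <= d, md (t.2 - t.1.2) <= d & md (t.1.1 - t.2) <= d].
pose inD (t : C * C * C) := [/\ D t.1.1, D t.1.2 & D t.2].
pose d0 := md (Q - P) + md (S - Q) + md (P - S) + 1.
have d0p : 0 < d0 by rewrite /d0; have := md_ge0 (Q - P); have := md_ge0 (S - Q); have := md_ge0 (P - S); lra.
pose e' := e / d0 ^+ 2.
have e'0 : 0 < e' by rewrite divr_gt0// exprn_gt0.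
pose B (d : R) t := [/\ diam d t, inD t & ~ exists K, forall k, (K <= k)%N ->
   md (tri h k t.1.1 t.1.2 t.2) <= e' * d ^+ 2].
have B0 : B d0 (P, Q, S).
  split => //.
    split => /=; rewrite /d0; have := md_ge0 (Q - P); have := md_ge0 (S - Q); have := md_ge0 (P - S); lra.
  by rewrite /e' divfK ?expf_neq0 ?gt_eqF.
have [|c hc] := @bisection R _ (fun t => t.1.1) B _ d0 (P, Q, S) d0p B0.
  move=> d [[p q] s] dp [[/= h1 h2 h3] [/= Dp Dq Ds] hb].
  have half (x y : C) : md (2^-1 * (x - y)) = md (x - y) / 2.
    by rewrite mdM mdV md_nat mulrC.
  have m1 : md (2^-1 * (q - p)) <= d / 2 by rewrite half; lra.
  have m2 : md (2^-1 * (s - q)) <= d / 2 by rewrite half; lra.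
  have m3 : md (2^-1 * (p - s)) <= d / 2 by rewrite half; lra.
  have D1 := Dm _ _ Dp Dq; have D2 := Dm _ _ Dq Ds; have D3 := Dm _ _ Ds Dp.
  have hE (x y u v : C) : x - y = 2^-1 * (u - v) -> md (2^-1 * (u - v)) <= d / 2 -> md (x - y) <= d / 2.
    by move=> ->.
  have hN (x y u v : C) : x - y = - (2^-1 * (u - v)) -> md (2^-1 * (u - v)) <= d / 2 -> md (x - y) <= d / 2.
    by move=> ->; rewrite mdN.
  have g1 : diam (d / 2) (p, mid p q, mid s p).
    by split => /=; [apply: (hE _ _ q p _ m1)|apply: (hE _ _ s q _ m2)|apply: (hE _ _ p s _ m3)]; rewrite /mid; field.
  have g2 : diam (d / 2) (mid p q, q, mid q s).
    by split => /=; [apply: (hE _ _ q p _ m1)|apply: (hE _ _ s q _ m2)|apply: (hE _ _ p s _ m3)]; rewrite /mid; field.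
  have g3 : diam (d / 2) (mid s p, mid q s, s).
    by split => /=; [apply: (hE _ _ q p _ m1)|apply: (hE _ _ s q _ m2)|apply: (hE _ _ p s _ m3)]; rewrite /mid; field.
  have g4 : diam (d / 2) (mid p q, mid q s, mid s p).
    by split => /=; [apply: (hN _ _ p s _ m3)|apply: (hN _ _ q p _ m1)|apply: (hN _ _ s q _ m2)]; rewrite /mid; field.
  apply: contrapT => hn.
  have good t : diam (d / 2) t -> inD t -> md (t.1.1 - p) <= d ->
     exists K, forall k, (K <= k)%N -> md (tri h k t.1.1 t.1.2 t.2) <= e' * (d / 2) ^+ 2.
    by move=> dt it pt; apply: contrapT => ht; apply: hn; exists t.
  have r1 : md (p - p) <= d by rewrite subrr md0; exact: ltW.
  have r2 : md (mid p q - p) <= d.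
    have -> : mid p q - p = 2^-1 * (q - p) by rewrite /mid; field.
    by apply: le_trans m1 _; lra.
  have r3 : md (mid s p - p) <= d.
    have -> : mid s p - p = - (2^-1 * (p - s)) by rewrite /mid; field.
    by rewrite mdN; apply: le_trans m3 _; lra.
  have [K1 k1] := good _ g1 (And3 Dp D1 D3) r1.
  have [K2 k2] := good _ g2 (And3 D1 Dq D2) r2.
  have [K3 k3] := good _ g3 (And3 D3 D2 Ds) r3.
  have [K4 k4] := good _ g4 (And3 D1 D2 D3) r2.
  apply: hb; exists (maxn (maxn K1 K2) (maxn K3 K4)).+1 => -[//|k] /= hk.
  rewrite ltnS !geq_max in hk; move: hk => /andP[/andP[q1 q2] /andP[q3 q4]].
  have := k1 _ q1; have := k2 _ q2; have := k3 _ q3; have := k4 _ q4 => /=.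
  rewrite tri_split => b4 b3 b2 b1.
  have -> : e' * d ^+ 2 = e' * (d / 2) ^+ 2 + e' * (d / 2) ^+ 2 + e' * (d / 2) ^+ 2 + e' * (d / 2) ^+ 2 by field.
  apply: le_trans (mdD _ _) _; apply: lerD => //.
  apply: le_trans (mdD _ _) _; apply: lerD => //.
  by apply: le_trans (mdD _ _) _; apply: lerD.
have Dc : D c.
  apply: Dcl => a a0; have a4 : 0 < a / 4 by lra.
  have [d [[[p q] s] [dp da [_ [/= Dp _ _] _] hp]]] := hc _ a4.
  by exists p => //; apply: le_lt_trans hp _; lra.
have [A hA] := hD _ Dc.
have e15 : 0 < e' / 15 by rewrite divr_gt0.
have [dl dl0 hdl] := hA _ e15.
have dl5 : 0 < dl / 5 by lra.
have [d [[[p q] s] [dp da [[/= h1 h2 h3] [/= Dp Dq Ds] hb] hp]]] := hc _ dl5.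
apply: hb; exists 0%N => k _.
pose err z := h z - h c - A * (z - c).
have tE : tri h k p q s = tri err k p q s.
  have -> : tri err k p q s = tri h k p q s +
      tri (fun z => (- h c + A * c) + (- A) * z) k p q s.
    have eE x y : mean err k x y = mean h k x y + mean (fun z => (- h c + A * c) + (- A) * z) k x y.
      rewrite -mean_add; apply: (@mean_ext (fun _ => True)) => // z _.
      by rewrite /err; ring.
    by rewrite /tri /edge !eE; ring.
  by rewrite tri_affine addr0.
have errb z : md (z - p) <= d -> md (err z) <= e' / 3 * d.
  move=> hz; have zc : md (z - c) <= 5 * d.
    have -> : z - c = (z - p) + (p - c) by rewrite addrA subrK.
    by apply: le_trans (mdD _ _) _; lra.
  apply: le_trans (hdl _ _) _; first by lra.
  have -> : e' / 3 * d = e' / 15 * (5 * d) by field.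
  by apply: ler_wpM2l => //; apply: ltW.
have bm := @ball_midclosed p d.
have pp : md (p - p) <= d by rewrite subrr md0 ltW.
have sp : md (s - p) <= d by rewrite mdB.
have -> : e' * d ^+ 2 = d * (e' / 3 * d) + d * (e' / 3 * d) + d * (e' / 3 * d) by field.
rewrite tE; apply: le_trans (mdD _ _) _; apply: lerD; last exact: (md_edge _ bm).
by apply: le_trans (mdD _ _) _; apply: lerD; apply: (md_edge _ bm).
Qed.
End Goursat.

(** * Square contours *)

Section Cauchy.
Context {R : realType}.
Local Notation C := (Cplx R).
Implicit Types (h : C -> C) (P Q S z a c : C) (D : C -> Prop) (r s : R).

Let I : C := 'i%C.

Lemma I2 : I ^+ 2 = -1. Proof. exact: sqr_i. Qed.

Lemma mdI n : md (I ^+ n) = 1.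
Proof. by rewrite mdX /I md_i expr1n. Qed.

Lemma IN n : (- I) ^+ n * I ^+ n = 1.
Proof. by rewrite -exprMn mulNr -expr2 I2 opprK expr1n. Qed.

Lemma vanish_add (u v : nat -> C) :
  vanish u -> vanish v -> vanish (fun k => u k + v k).
Proof.
move=> hu hv e e0; have e2 : 0 < e / 2 by lra.
have [K1 h1] := hu _ e2; have [K2 h2] := hv _ e2.
exists (maxn K1 K2) => k; rewrite geq_max => /andP[k1 k2].
apply: le_trans (mdD _ _) _; have := h1 _ k1; have := h2 _ k2; lra.
Qed.

Lemma vanish_scale A (u : nat -> C) : vanish u -> vanish (fun k => A * u k).
Proof.
move=> hu e e0; have A0 := md_ge0 A.
have e2 : 0 < e / (md A + 1) by rewrite divr_gt0//; lra.
have [K h] := hu _ e2; exists K => k kK; rewrite mdM.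
apply: le_trans (ler_wpM2l A0 (h _ kK)) _.
rewrite mulrA ler_pdivrMr; nra.
Qed.

Lemma vanish_eq (u v : nat -> C) : (forall k, u k = v k) -> vanish u -> vanish v.
Proof. by move=> uv hu e /hu[K hK]; exists K => k; rewrite -uv; apply: hK. Qed.

Lemma cdiff_cst A c : cdiff (fun _ => A) c.
Proof.
exists 0 => e e0; exists 1 => // z _.
by rewrite subrr mul0r subr0 md0 mulr_ge0 ?md_ge0// ltW.
Qed.

Lemma cdiff_cont h c : cdiff h c -> forall e : R, 0 < e ->
  exists2 dl : R, 0 < dl & forall z, md (z - c) < dl -> md (h z - h c) <= e.
Proof.
move=> [A hA] e e0; have [dl dl0 hd] := hA 1 ltr01.
have A0 := md_ge0 A.
have q0 : 0 < e / (md A + 1) by rewrite divr_gt0//; lra.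
exists (Num.min dl (e / (md A + 1))); first by rewrite lt_min dl0.
move=> z; rewrite lt_min => /andP[z1 z2].
have -> : h z - h c = (h z - h c - A * (z - c)) + A * (z - c) by rewrite subrK.
apply: le_trans (mdD _ _) _; have := hd _ z1; rewrite mul1r mdM.
move: z2; rewrite ltr_pdivlMr; last lra.
have := md_ge0 (z - c); nra.
Qed.

Lemma cdiff_quotient h A a c : cdiff h c -> c != a ->
  cdiff (fun z => (h z - A) / (z - a)) c.
Proof.
move=> [B hB] ca; set v0 := c - a.
have v0n : v0 != 0 by rewrite subr_eq0.
have v0p : 0 < md v0 by rewrite md_gt0.
pose E := v0 * B - (h c - A).
exists (E / v0 ^+ 2) => e e0.
have e1 : 0 < e * md v0 / 4 by rewrite divr_gt0// mulr_gt0.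
have [dl dl0 hd] := hB _ e1.
have E0 := md_ge0 E.
pose d2 := e * md v0 ^+ 3 / (4 * (md E + 1)).
have d20 : 0 < d2 by rewrite divr_gt0 ?mulr_gt0 ?exprn_gt0//; lra.
exists (Num.min dl (Num.min (md v0 / 2) d2)).
  by rewrite !lt_min dl0 d20 divr_gt0.
move=> z; rewrite !lt_min => /and3P[z1 z2 z3].
set t := z - c in z1 z2 z3 *.
have zaE : z - a = v0 + t by rewrite /v0 /t; ring.
have vb : md v0 / 2 <= md (v0 + t) by have := md_lb v0 t; lra.
have vp : 0 < md (v0 + t) by apply: lt_le_trans vb; lra.
have vn : v0 + t != 0 by rewrite -md_gt0.
set err := h z - h c - B * t.
have hz : h z = h c + B * t + err by rewrite /err; ring.
have -> : (h z - A) / (z - a) - (h c - A) / (c - a) - E / v0 ^+ 2 * t =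
   err / (v0 + t) - E * t * t / ((v0 + t) * v0 ^+ 2).
  by rewrite zaE -/v0 hz /E; field; rewrite v0n vn.
apply: le_trans (md_dist _ _) _.
have -> : md (err / (v0 + t)) = md err / md (v0 + t) by rewrite mdM mdV.
have -> : md (E * t * t / ((v0 + t) * v0 ^+ 2)) =
    md E * md t * md t / (md (v0 + t) * md v0 ^+ 2) by rewrite !(mdM, mdV) -expr2.
have er : md err <= e * md v0 / 4 * md t by apply: hd.
have t0 := md_ge0 t.
have b1 : md err / md (v0 + t) <= e / 2 * md t.
  rewrite ler_pdivrMr//; apply: le_trans er _.
  have : 0 <= e * md t by rewrite mulr_ge0// ltW.
  nra.
have b2 : md E * md t * md t / (md (v0 + t) * md v0 ^+ 2) <= e / 2 * md t.
  rewrite ler_pdivrMr ?mulr_gt0 ?exprn_gt0//.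
  have k1 : md E * md t <= e * md v0 ^+ 3 / 4.
    apply: (@le_trans _ _ ((md E + 1) * d2)).
      by apply: ler_pM => //; [lra|exact: ltW].
    by rewrite /d2 le_eqVlt; apply/orP; left; apply/eqP; field; lra.
  apply: le_trans (ler_wpM2r t0 k1) _.
  have -> : e / 2 * md t * (md (v0 + t) * md v0 ^+ 2) =
     (e * md t / 2 * md v0 ^+ 2) * md (v0 + t) by ring.
  have -> : e * md v0 ^+ 3 / 4 * md t = (e * md t / 2 * md v0 ^+ 2) * (md v0 / 2) by field.
  apply: ler_wpM2l => //.
  by rewrite mulr_ge0 ?exprn_ge0 ?md_ge0// divr_ge0// mulr_ge0// ltW.
lra.
Qed.

(** The m-th corner of the square with centre c and half-side r, counted
    counterclockwise from the upper right one. *)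
Definition corner m c r : C := c + real_complex R r * (I ^+ m * (1 + I)).
Definition contour h k c r := \sum_(m < 4) edge h k (corner m c r) (corner m.+1 c r).

(** The m-th side of a square around a lies in the half plane at distance s
    from a in the direction i^(m+1). *)
Definition half_plane m a s z := s <= complex.Im ((- I) ^+ m * (z - a)).

Lemma ImD (x y : C) : complex.Im (x + y) = complex.Im x + complex.Im y.
Proof. by case: x y => a b [c d]. Qed.

Lemma ImZ (r : R) (x : C) : complex.Im (real_complex R r * x) = r * complex.Im x.
Proof. by case: x => a b /=; rewrite mul0r addr0. Qed.

Lemma ImHalf (x y : C) : complex.Im ((x + y) / 2) = (complex.Im x + complex.Im y) / 2.
Proof.
have -> : (x + y) / 2 = real_complex R 2^-1 * (x + y).
  by rewrite fmorphV rmorph_nat mulrC.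
by rewrite ImZ ImD mulrC.
Qed.

Lemma md_rot m z : md ((- I) ^+ m * z) = md z.
Proof. by rewrite mdM mdX mdN /I md_i expr1n mul1r. Qed.

Lemma half_plane_md m a s z : half_plane m a s z -> s <= md (z - a).
Proof.
move=> h; apply: le_trans h _; rewrite -(md_rot m).
by apply: le_trans (md_Im _); exact: ler_norm.
Qed.

Lemma half_plane_mid m a s : midclosed (half_plane m a s).
Proof.
move=> x y; rewrite /half_plane => hx hy.
have -> : (- I) ^+ m * (mid x y - a) = ((- I) ^+ m * (x - a) + (- I) ^+ m * (y - a)) / 2.
  by rewrite /mid; field.
by rewrite ImHalf; lra.
Qed.

Lemma half_plane_closed m a s c :
  (forall e : R, 0 < e -> exists2 z, half_plane m a s z & md (z - c) < e) -> half_plane m a s c.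
Proof.
move=> h; rewrite /half_plane leNgt; apply/negP => lt.
pose e := s - complex.Im ((- I) ^+ m * (c - a)).
have e0 : 0 < e by rewrite subr_gt0.
have [z hz zc] := h _ e0; move: hz; rewrite /half_plane.
have -> : (- I) ^+ m * (z - a) = (- I) ^+ m * (c - a) + (- I) ^+ m * (z - c) by ring.
rewrite ImD.
have : complex.Im ((- I) ^+ m * (z - c)) < e.
  apply: le_lt_trans zc; rewrite -(md_rot m (z - c)).
  by apply: le_trans (md_Im _); exact: ler_norm.
rewrite /e; lra.
Qed.

Lemma Im_lower (u : C) : - md u <= complex.Im u.
Proof. by have := md_Im u; rewrite ler_norml => /andP[]. Qed.

Lemma corner_half_plane m c a r : half_plane m a (r - md (c - a)) (corner m c r).
Proof.
rewrite /half_plane /corner.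
have -> : (- I) ^+ m * (c + real_complex R r * (I ^+ m * (1 + I)) - a) =
   (- I) ^+ m * (c - a) + real_complex R r * (((- I) ^+ m * I ^+ m) * (1 + I)) by ring.
rewrite IN mul1r ImD ImZ; have := Im_lower ((- I) ^+ m * (c - a)).
by rewrite md_rot /= add0r mulr1; lra.
Qed.

Lemma cornerS_half_plane m c a r : half_plane m a (r - md (c - a)) (corner m.+1 c r).
Proof.
rewrite /half_plane /corner exprS.
have -> : (- I) ^+ m * (c + real_complex R r * (I * I ^+ m * (1 + I)) - a) =
   (- I) ^+ m * (c - a) + real_complex R r * (((- I) ^+ m * I ^+ m) * (I + I ^+ 2)) by ring.
rewrite IN I2 mul1r ImD ImZ; have := Im_lower ((- I) ^+ m * (c - a)).
by rewrite md_rot /= oppr0 addr0 mulr1; lra.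
Qed.

Lemma corner_dist m c r : 0 <= r -> md (corner m c r - c) <= 2 * r.
Proof.
move=> r0; rewrite /corner addrC addKr !mdM md_realr mdI mul1r ger0_norm// mulrC.
apply: ler_wpM2r => //; apply: le_trans (mdD _ _) _.
by rewrite md1 /I md_i.
Qed.

Lemma corner_step m c r : 0 <= r -> md (corner m.+1 c r - corner m c r) <= 2 * r.
Proof.
move=> r0; have -> : corner m.+1 c r - corner m c r = real_complex R r * I ^+ m * (I ^+ 2 - 1).
  by rewrite /corner exprS; ring.
rewrite I2 !mdM md_realr mdI mulr1 ger0_norm// mulrC.
apply: ler_wpM2r => //; apply: le_trans (md_dist _ _) _.
by rewrite mdN md1.
Qed.

(** A set closed under midpoints that contains the m-th side and keeps away
    from the centre. *)
Definition side m c r z := half_plane m c r z /\ md (z - c) <= 2 * r.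

Lemma side_mid m c r : midclosed (side m c r).
Proof.
move=> x y [h1 h2] [h3 h4]; split; first exact: half_plane_mid.
exact: ball_midclosed h2 h4.
Qed.

Lemma corner_side m c r : 0 <= r -> side m c r (corner m c r) /\ side m c r (corner m.+1 c r).
Proof.
move=> r0; have := corner_half_plane m c c r; have := cornerS_half_plane m c c r.
rewrite subrr md0 subr0 => h1 h2.
by do 2!split => //; apply: corner_dist.
Qed.

Lemma side_md m c r z : side m c r z -> r <= md (z - c) <= 2 * r.
Proof. by move=> [/half_plane_md -> ->]. Qed.

Lemma contour_bound h k c r (M : R) : 0 <= r ->
  (forall z, r <= md (z - c) <= 2 * r -> md (h z) <= M) ->
  md (contour h k c r) <= 8 * (r * M).
Proof.
move=> r0 hM; rewrite /contour; apply: le_trans (md_sum _ _ _) _.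
apply: (@le_trans _ _ (\sum_(m < 4) 2 * r * M)).
  apply: ler_sum => m _; have [c1 c2] := corner_side m c r0.
  apply: (md_edge _ (@side_mid m c r)) => //; first exact: corner_step.
  by move=> z /side_md; apply: hM.
by rewrite sumr_const card_ord -mulr_natl; lra.
Qed.

Lemma contour_rate h k j c r (e : R) : 0 <= r ->
  (forall z z', r <= md (z - c) <= 2 * r -> r <= md (z' - c) <= 2 * r ->
     md (z' - z) <= 2 * r * 2^-1 ^+ k -> md (h z' - h z) <= e) ->
  md (contour h (k + j) c r - contour h k c r) <= 8 * (r * e).
Proof.
move=> r0 he; rewrite /contour -sumrB; apply: le_trans (md_sum _ _ _) _.
apply: (@le_trans _ _ (\sum_(m < 4) 2 * r * e)).
  apply: ler_sum => m _; have [c1 c2] := corner_side m c r0.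
  rewrite /edge -mulrBr mdM; apply: ler_pM; rewrite ?md_ge0//; first exact: corner_step.
  apply: (mean_rate _ (@side_mid m c r)) => // z z' /side_md az /side_md az' hz.
  apply: he => //; apply: le_trans hz _; apply: ler_wpM2r; last exact: corner_step.
  by rewrite exprn_ge0 ?invr_ge0.
by rewrite sumr_const card_ord -mulr_natl; lra.
Qed.

Lemma edge_add h1 h2 k P Q : edge (fun z => h1 z + h2 z) k P Q = edge h1 k P Q + edge h2 k P Q.
Proof. by rewrite /edge mean_add mulrDr. Qed.

Lemma edge_scale A h k P Q : edge (fun z => A * h z) k P Q = A * edge h k P Q.
Proof. by rewrite /edge mean_scale mulrCA. Qed.

Lemma edge_subst h k A B P Q :
  edge h k (A + B * P) (A + B * Q) = edge (fun z => B * h (A + B * z)) k P Q.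
Proof. by rewrite edge_scale /edge mean_subst; ring. Qed.

Lemma edge_eq h1 h2 k P Q : h1 =1 h2 -> edge h1 k P Q = edge h2 k P Q.
Proof. by move=> hh; rewrite /edge (@mean_ext R (fun _ => True) h1 h2). Qed.

Lemma contour_add h1 h2 k c r : contour (fun z => h1 z + h2 z) k c r = contour h1 k c r + contour h2 k c r.
Proof. by rewrite /contour -big_split; apply: eq_bigr => m _; exact: edge_add. Qed.

Lemma contour_scale A h k c r : contour (fun z => A * h z) k c r = A * contour h k c r.
Proof. by rewrite /contour mulr_sumr; apply: eq_bigr => m _; exact: edge_scale. Qed.

Lemma contour_eq h1 h2 k c r : h1 =1 h2 -> contour h1 k c r = contour h2 k c r.
Proof. by move=> hh; apply: eq_bigr => m _; apply: edge_eq. Qed.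

(** The region between the two squares is cut into eight triangles, two for
    each side. Each of them lies in a half plane that misses a, so Goursat's
    theorem applies to all of them, and the inner edges cancel. *)
Lemma contour_move h a c r s : 0 < s -> s + md (c - a) <= r ->
  (forall z, z != a -> cdiff h z) ->
  vanish (fun k => contour h k c r - contour h k a s).
Proof.
move=> s0 sr hd.
pose Y m := corner m a s; pose Z m := corner m c r.
have T m P Q S : half_plane m a s P -> half_plane m a s Q -> half_plane m a s S ->
    vanish (fun k => tri h k P Q S).
  apply: goursat (@half_plane_mid m a s) (@half_plane_closed m a s) _.
  move=> z hz; apply: hd; rewrite -subr_eq0 -md_gt0.
  by apply: lt_le_trans s0 _; apply: half_plane_md hz.
have wk m z : half_plane m a (r - md (c - a)) z -> half_plane m a s z.
  by rewrite /half_plane; apply: le_trans; lra.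
have Z1 m : half_plane m a s (Z m) by apply: wk; apply: corner_half_plane.
have Z2 m : half_plane m a s (Z m.+1) by apply: wk; apply: cornerS_half_plane.
have Y1 m : half_plane m a s (Y m) by have := corner_half_plane m a a s; rewrite subrr md0 subr0.
have Y2 m : half_plane m a s (Y m.+1) by have := cornerS_half_plane m a a s; rewrite subrr md0 subr0.
have V m : vanish (fun k => tri h k (Y m) (Z m) (Z m.+1) + tri h k (Y m) (Z m.+1) (Y m.+1)).
  by apply: vanish_add; apply: (T m).
have Z4 : Z 4 = Z 0%N by rewrite /Z /corner (exprM I 2 2) I2 sqrrN expr1n.
have Y4 : Y 4 = Y 0%N by rewrite /Y /corner (exprM I 2 2) I2 sqrrN expr1n.
apply: vanish_eq (vanish_add (vanish_add (V 0%N) (V 1%N)) (vanish_add (V 2) (V 3))) => k.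
rewrite /contour !big_ord_recr !big_ord0 /= -/(Z _) -/(Y _) -!/(Z _) -!/(Y _) /tri.
rewrite Z4 Y4 !(edge_opp h k (Y _) (Z _)).
rewrite (edge_opp h k (Y 0%N) (Y 1%N)) (edge_opp h k (Y 1%N) (Y 2)).
by rewrite (edge_opp h k (Y 2) (Y 3)) (edge_opp h k (Y 3) (Y 0%N)); ring.
Qed.
End Cauchy.

(** * Cauchy's formula *)

Section CauchyFormula.
Context {R : realType}.
Local Notation C := (Cplx R).
Implicit Types (h : C -> C) (P Q S z a c : C) (D : C -> Prop) (r s : R).

Let I : C := 'i%C.

(** The midpoint approximation of 2 pi i. Only its independence of the square
    and a lower bound for its modulus are used. *)
Definition kappa k : C := contour (fun z => z^-1) k 0 1.

Lemma contour_kappa k a r : 0 < r -> contour (fun z => (z - a)^-1) k a r = kappa k.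
Proof.
move=> r0; rewrite /kappa /contour; apply: eq_bigr => m _.
have e n : corner n a r = a + real_complex R r * corner n 0 1.
  by rewrite /corner rmorph1 mul1r add0r.
rewrite !e edge_subst; apply: edge_eq => z.
rewrite addrC addKr invfM mulrA divff ?mul1r//.
by rewrite fmorph_eq0 gt_eqF.
Qed.

Lemma mean_Im D h k P Q (m : R) : midclosed D -> D P -> D Q ->
  (forall z, D z -> m <= complex.Im (h z)) -> m <= complex.Im (mean h k P Q).
Proof.
move=> Dm; elim: k P Q => [|k IH] P Q DP DQ hh /=; first by apply: hh; apply: Dm.
have DM := Dm _ _ DP DQ.
by rewrite ImHalf; have := IH _ _ DP DM hh; have := IH _ _ DM DQ hh; lra.
Qed.

Lemma kappa_ge4 k : 4 <= md (kappa k).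
Proof.
pose e0 := edge (fun z => z^-1) k (1 + I) (I * (1 + I)).
have hI m : I ^+ m != 0 by rewrite -md_gt0 mdI ltr01.
have -> : kappa k = 4 * e0.
  rewrite /kappa /contour (eq_bigr (fun _ => e0)) ?sumr_const ?card_ord ?mulr_natl// => m _.
  have -> : corner m 0 1 = 0 + I ^+ m * (1 + I) by rewrite /corner rmorph1 mul1r.
  have -> : corner m.+1 0 1 = 0 + I ^+ m * (I * (1 + I)).
    by rewrite /corner rmorph1 mul1r exprSr mulrA.
  rewrite edge_subst; apply: edge_eq => z.
  by rewrite add0r invfM mulrA divff// mul1r.
rewrite mdM md_nat; suff : 1 <= md e0 by lra.
apply: le_trans (le_trans (ler_norm _) (md_Im _)).
rewrite /e0 /edge -mean_scale.
have dE : I * (1 + I) - (1 + I) = real_complex R (- 2).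
  have -> : I * (1 + I) - (1 + I) = I ^+ 2 - 1 by ring.
  by rewrite I2 rmorphN rmorph_nat; ring.
rewrite dE.
pose D z := complex.Im z = 1 /\ -1 <= complex.Re z <= 1.
have Dm : midclosed D.
  move=> x y; rewrite /D => -[x1 x2] [y1 y2].
  have -> : mid x y = real_complex R 2^-1 * (x + y).
    by rewrite /mid fmorphV rmorph_nat mulrC.
  case: x y x1 x2 y1 y2 => a b [c d] /= -> /andP[? ?] -> /andP[? ?].
  by split; [|apply/andP; split]; lra.
apply: (mean_Im _ Dm).
- by rewrite /D /=; split; [|apply/andP; split]; lra.
- have -> : I * (1 + I) = -1 + I by rewrite mulrDr mulr1 -expr2 I2 addrC.
  by rewrite /D /=; split; [|apply/andP; split]; lra.
move=> z [z1 z2]; rewrite ImZ; case: z z1 z2 => x y /= -> /andP[x1 x2].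
by rewrite expr1n mulNr mulrN opprK mulrA mulr1 ler_pdivlMr; nra.
Qed.

(** The difference quotient of f at a is holomorphic off a and bounded near a,
    so moving its contour to a tiny square around a shows that its contour
    sums vanish in the limit. *)
Lemma cauchy_point f a r : (forall c, cdiff f c) -> md a < r ->
  vanish (fun k => contour (fun z => f z / (z - a)) k 0 r -
                   f a * contour (fun z => z^-1) k 0 r).
Proof.
move=> hf ar.
have ar' : md (0 - a) < r by rewrite sub0r mdN.
have v1 : vanish (fun k => contour (fun z => (f z - f a) / (z - a)) k 0 r).
  move=> e e0; have [A hA] := hf a; have [dl dl0 hd] := hA 1 ltr01.
  have A0 := md_ge0 A.
  pose t := e / (16 * (md A + 1)).
  have t0 : 0 < t by rewrite divr_gt0// mulr_gt0//; lra.
  pose s := Num.min (r - md (0 - a)) (Num.min (dl / 4) t).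
  have s0 : 0 < s by rewrite !lt_min t0 divr_gt0//= andbT; lra.
  have s1 : s <= r - md (0 - a) by rewrite ge_min lexx.
  have s2 : s <= dl / 4 by rewrite !ge_min lexx orbT.
  have s3 : s <= t by rewrite !ge_min lexx !orbT.
  have sr : s + md (0 - a) <= r by lra.
  have e2 : 0 < e / 2 by lra.
  have hq z : z != a -> cdiff (fun z => (f z - f a) / (z - a)) z.
    by move=> za; apply: cdiff_quotient.
  have [K hK] := contour_move s0 sr hq e2.
  exists K => k kK; have hk := hK _ kK.
  set X := contour _ k 0 r in hk *; set Y := contour _ k a s in hk.
  have -> : X = (X - Y) + Y by rewrite subrK.
  apply: le_trans (mdD _ _) _.
  have hY : md Y <= 8 * (s * (md A + 1)).
    apply: contour_bound; first exact: ltW.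
    move=> z /andP[z1 z2].
    have zp : 0 < md (z - a) by apply: lt_le_trans z1.
    rewrite mdM mdV ler_pdivrMr//.
    have -> : f z - f a = (f z - f a - A * (z - a)) + A * (z - a) by rewrite subrK.
    apply: le_trans (mdD _ _) _; rewrite mdM mulrDl mul1r addrC lerD2l.
    by rewrite -[leRHS]mul1r; apply: hd; lra.
  have : 8 * (s * (md A + 1)) <= e / 2.
    apply: (@le_trans _ _ (8 * (t * (md A + 1)))).
      by apply: ler_wpM2l => //; apply: ler_wpM2r => //; lra.
    by rewrite /t le_eqVlt; apply/orP; left; apply/eqP; field; lra.
  lra.
have v2 : vanish (fun k => contour (fun z => (z - a)^-1) k 0 r -
                           contour (fun z => z^-1) k 0 r).
  have s0 : 0 < r - md (0 - a) by lra.
  have sr : r - md (0 - a) + md (0 - a) <= r by lra.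
  have hq z : z != a -> cdiff (fun z => (z - a)^-1) z.
    move=> za; have := @cdiff_quotient R (fun _ => 1) 0 a z (cdiff_cst 1 z) za.
    rewrite (_ : (fun z => (1 - 0) / (z - a)) = (fun z => (z - a)^-1))//.
    by apply/funext => y; rewrite subr0 mul1r.
  apply: vanish_eq (contour_move s0 sr hq) => k; congr (_ - _).
  rewrite contour_kappa// -(contour_kappa k 0 (r := r)); last by have := md_ge0 a; lra.
  by apply: contour_eq => z; rewrite subr0.
apply: vanish_eq (vanish_add v1 (vanish_scale (f a) v2)) => k.
rewrite mulrBr addrA; congr (_ - _); rewrite -contour_scale -contour_add.
by apply: contour_eq => z; rewrite -mulrDl subrK.
Qed.

(** A Taylor polynomial of f at 0, with the coefficients given by Cauchy's
    integral replaced by midpoint sums. It is a polynomial in a and a finite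
    combination of values of f. *)
Definition taylor (f : C -> C) k r N (a : C) : C :=
  (kappa k)^-1 * \sum_(n < N) a ^+ n * contour (fun z => f z * z^-1 ^+ n.+1) k 0 r.

Lemma cauchy_kernel_dist (u u' x x' : C) (b M w eta : R) : 0 < b ->
  b <= md x -> b <= md x' -> md (u' - u) <= w -> md u <= M -> md (x' - x) <= eta ->
  md (u' / x' - u / x) <= w / b + M * (eta / (b * b)).
Proof.
move=> b0 hx hx' hu hM he.
have xp : 0 < md x by apply: lt_le_trans hx. 
have xp' : 0 < md x' by apply: lt_le_trans hx'. 
have x0 : x != 0 by rewrite -md_gt0.
have x0' : x' != 0 by rewrite -md_gt0.
have -> : u' / x' - u / x = (u' - u) / x' + u * ((x - x') / (x' * x)).
  by field; rewrite x0 x0'.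
apply: le_trans (mdD _ _) _; apply: lerD.
  rewrite mdM mdV; apply: ler_pM; rewrite ?md_ge0 ?invr_ge0 ?md_ge0//.
  by rewrite lef_pV2.
rewrite !mdM mdV; apply: ler_pM => //; rewrite ?md_ge0 ?mulr_ge0 ?invr_ge0 ?md_ge0//.
apply: ler_pM => //; rewrite ?md_ge0 ?invr_ge0 ?md_ge0//; first by rewrite mdB.
rewrite mdM lef_pV2 ?posrE ?mulr_gt0//.
by apply: ler_pM => //; apply: ltW.
Qed.

(** The limit of cauchy_point is only pointwise. The integrands are
    equicontinuous in the parameters a and w, so mean_rate turns it into a
    uniform one; the geometric series for 1/(z - a) is then cut off, with
    |a/z| <= 1/2 on the contour. *)
Lemma taylor_uniform (F : C -> C -> C) r (e : R) : jointly_continuous F ->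
  (forall w c, cdiff (F^~ w) c) -> 0 < r -> 0 < e ->
  exists k N, forall a w, md a <= r -> md w <= r ->
    md (F a w - taylor (F^~ w) k (2 * r) N a) <= e.
Proof.
move=> Fc Fd r0 e0.
have [M0 hM0] := jointly_continuous_bounded (4 * r) Fc.
pose M := Num.max M0 1.
have M1 : 1 <= M by rewrite le_max lexx orbT.
have hM z w : md z <= 4 * r -> md w <= r -> md (F z w) <= M.
  by move=> z4 wr; rewrite le_max hM0//; lra.
(* e1 is the oscillation of the integrand that costs e / 2 over a contour of
   length 16 r; eta is the mesh that guarantees it. *)
have [e1 e10 e1E] : exists2 e1 : R, 0 < e1 & 8 * (2 * r * e1) = e / 2.
  by exists (e / (32 * r)); [rewrite divr_gt0// mulr_gt0|field; lra].
have w0 : 0 < e1 * r / 2 by rewrite divr_gt0// mulr_gt0.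
have [dl dl0 hdl] := jointly_continuous_uniform (4 * r) Fc w0.
pose eta := Num.min (dl / 2) (e1 * (r * r) / (4 * M)).
have Mp : 0 < M by lra.
have eta0 : 0 < eta.
  rewrite lt_min; apply/andP; split; first by lra.
  by rewrite divr_gt0 ?mulr_gt0.
have [k hk] : exists k, 2 * (2 * r) * 2^-1 ^+ k <= eta.
  have q0 : 0 <= 2 * (2 * r) / eta by rewrite divr_ge0 ?mulr_ge0// ltW.
  exists (Num.bound (2 * (2 * r) / eta)).
  rewrite exprVn ler_pdivrMr ?exprn_gt0// -ler_pdivrMl// mulrC.
  apply: le_trans (ltW (archi_boundP q0)) _.
  by rewrite -natrX ler_nat ltnW// ltn_expl.
have [N hN] : exists N, 16 * M * 2^-1 ^+ N <= e.
  have q0 : 0 <= 16 * M / e by rewrite divr_ge0 ?mulr_ge0//; lra.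
  exists (Num.bound (16 * M / e)).
  rewrite exprVn ler_pdivrMr ?exprn_gt0// -ler_pdivrMl// mulrC.
  apply: le_trans (ltW (archi_boundP q0)) _.
  by rewrite -natrX ler_nat ltnW// ltn_expl.
exists k, N => a w ar wr.
pose g z := F z w / (z - a) - F a w * z^-1.
have sqg j : contour g j 0 (2 * r) = contour (fun z => F z w / (z - a)) j 0 (2 * r) -
    F a w * contour (fun z => z^-1) j 0 (2 * r).
  by rewrite -mulNr -contour_scale -contour_add; apply: contour_eq => z; rewrite mulNr.
have geo z : 2 * r <= md (z - 0) <= 2 * (2 * r) -> r <= md (z - a) /\ r <= md z /\ md z <= 4 * r.
  by rewrite subr0 => /andP[z1 z2]; have := md_lb z (- a); rewrite mdN; split; [|split]; lra.
have gk : md (contour g k 0 (2 * r)) <= e.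
  have [K hK] := @cauchy_point (F^~ w) a (2 * r) (Fd w) ltac:(lra) (e / 2) ltac:(lra).
  have := hK (k + K)%N (leq_addl _ _); rewrite -sqg => h1.
  have rate : md (contour g (k + K) 0 (2 * r) - contour g k 0 (2 * r)) <= 8 * (2 * r * e1).
    apply: contour_rate; first by rewrite mulr_ge0// ltW.
    move=> z z' /geo[z1 [z2 z3]] /geo[z1' [z2' z3']] hz.
    have hz2 : md (z' - z) <= eta by apply: le_trans hk.
    have hF : md (F z' w - F z w) <= e1 * r / 2.
      apply: hdl => //; rewrite ?subrr ?md0//; try lra.
      apply: le_lt_trans hz2 _; rewrite gt_min; apply/orP; left; lra.
    have t1 : md (F z' w / (z' - a) - F z w / (z - a)) <= e1 * r / 2 / r + M * (eta / (r * r)).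
      apply: cauchy_kernel_dist => //; first exact: hM.
      by rewrite opprB addrA subrK.
    have t2 : md (F a w / z' - F a w / z) <= 0 / r + M * (eta / (r * r)).
      apply: cauchy_kernel_dist => //; first by rewrite subrr md0.
      by apply: hM => //; lra.
    have t3 : M * (eta / (r * r)) <= e1 / 4.
      rewrite mulrA ler_pdivrMr ?mulr_gt0//.
      have eb : eta <= e1 * (r * r) / (4 * M) by rewrite ge_min lexx orbT.
      apply: le_trans (ler_wpM2l _ eb) _; first by lra.
      by rewrite le_eqVlt; apply/orP; left; apply/eqP; field; lra.
    have t4 : e1 * r / 2 / r = e1 / 2 by field; lra.
    have -> : g z' - g z = (F z' w / (z' - a) - F z w / (z - a)) - (F a w / z' - F a w / z).
      by rewrite /g; ring.
    apply: le_trans (md_dist _ _) _; rewrite t4 mul0r in t1 t2; lra.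
  have -> : contour g k 0 (2 * r) = contour g (k + K) 0 (2 * r) - (contour g (k + K) 0 (2 * r) - contour g k 0 (2 * r)).
    by rewrite opprB addrCA subrr addr0.
  apply: le_trans (md_dist _ _) _.
  lra.
pose tail z := F z w / (z - a) * (a / z) ^+ N.
have trunc : contour (fun z => F z w / (z - a)) k 0 (2 * r) =
   \sum_(n < N) a ^+ n * contour (fun z => F z w * z^-1 ^+ n.+1) k 0 (2 * r) +
   contour tail k 0 (2 * r).
  have geom z : z != 0 -> z - a != 0 ->
      F z w / (z - a) = \sum_(n < N) a ^+ n * (F z w * z^-1 ^+ n.+1) + tail z.
    move=> z0 za0; rewrite /tail.
    elim: N {hN tail} => [|N IH]; first by rewrite big_ord0 add0r expr0 mulr1.
    rewrite big_ord_recr /= -addrA {1}IH; congr (_ + _).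
    rewrite !expr_div_n exprS (exprS z) exprVn exprS.
    by field; rewrite z0 za0 expf_neq0.
  have sumE : \sum_(n < N) a ^+ n * contour (fun z => F z w * z^-1 ^+ n.+1) k 0 (2 * r) =
     contour (fun z => \sum_(n < N) a ^+ n * (F z w * z^-1 ^+ n.+1)) k 0 (2 * r).
    elim: N {hN tail geom} => [|N IH].
      rewrite big_ord0 -[LHS](mul0r (contour (fun=> 0) k 0 (2 * r))) -contour_scale; apply: contour_eq => z.
      by rewrite big_ord0 mul0r.
    rewrite big_ord_recr /= IH -contour_scale -contour_add; apply: contour_eq => z.
    by rewrite big_ord_recr.
  rewrite sumE -contour_add; apply: eq_bigr => m _; rewrite /edge; congr (_ * _).
  have [c1 c2] := @corner_side R m 0 (2 * r) ltac:(lra).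
  apply: (mean_ext _ (@side_mid R m 0 (2 * r))) => // z /side_md/geo[z1 [z2 _]].
  by apply: geom; rewrite -md_gt0; apply: lt_le_trans r0 _.
have tailb : md (contour tail k 0 (2 * r)) <= e.
  apply: le_trans hN.
  have -> : 16 * M * 2^-1 ^+ N = 8 * (2 * r * (M / r * 2^-1 ^+ N)) by field; lra.
  apply: contour_bound; first by rewrite mulr_ge0// ltW.
  move=> z hz; have [z1 [z2 z3]] := geo z hz.
  have zl : 2 * r <= md z by move: hz; rewrite subr0 => /andP[].
  have zp : 0 < md z by apply: lt_le_trans r0 _.
  have zap : 0 < md (z - a) by apply: lt_le_trans r0 _.
  rewrite /tail !mdM mdX mdM !mdV; apply: ler_pM.
  - by rewrite divr_ge0 ?md_ge0.
  - by rewrite exprn_ge0// divr_ge0 ?md_ge0.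
  - apply: ler_pM; rewrite ?md_ge0 ?invr_ge0 ?md_ge0//; first exact: hM.
    by rewrite lef_pV2.
  apply: lerXn2r; rewrite ?nnegrE ?divr_ge0 ?md_ge0//.
  by rewrite ler_pdivrMr//; lra.
have kp := kappa_ge4 k.
have kn : kappa k != 0 by rewrite -md_gt0; lra.
have kE : contour (fun z => z^-1) k 0 (2 * r) = kappa k.
  rewrite -(contour_kappa k 0 (r := 2 * r)); last by lra.
  by apply: contour_eq => z; rewrite subr0.
have -> : F a w - taylor (F^~ w) k (2 * r) N a =
   (contour tail k 0 (2 * r) - contour g k 0 (2 * r)) / kappa k.
  by rewrite sqg kE trunc /taylor; field.
rewrite mdM mdV ler_pdivrMr; last by lra.
by apply: le_trans (md_dist _ _) _; nra.
Qed.
End CauchyFormula.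

(** * Polynomial approximation and Liouville's theorem *)

Section Approximation.
Context {R : realType}.
Local Notation C := (Cplx R).
Implicit Types (r e : R).

Lemma entire_approx (g : C -> C) r e : (forall c, cdiff g c) -> 0 < r -> 0 < e ->
  exists p : {poly C}, forall z, md z <= r -> md (g z - p.[z]) <= e.
Proof.
move=> hg r0 e0.
have gc : jointly_continuous (fun z (_ : C) => g z).
  by move=> a b e' e'0; have [dl dl0 hd] := cdiff_cont (hg a) e'0; exists dl => // z w za _; apply: hd.
have [k [N hN]] := taylor_uniform gc (fun _ c => hg c) r0 e0.
exists ((kappa k)^-1 *: \sum_(n < N) contour (fun z => g z * z^-1 ^+ n.+1) k 0 (2 * r) *: 'X^n).
move=> z zr; have -> : ((kappa k)^-1 *: \sum_(n < N)
    contour (fun z => g z * z^-1 ^+ n.+1) k 0 (2 * r) *: 'X^n).[z] = taylor g k (2 * r) N z.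
  rewrite hornerZ horner_sum /taylor; congr (_ * _); apply: eq_bigr => n _.
  by rewrite hornerZ hornerXn mulrC.
by apply: (hN z 0) => //; rewrite md0 ltW.
Qed.

Definition poly_approximable r (G : C -> C -> C) := forall e : R, 0 < e ->
  exists P : {poly {poly C}}, forall z w, md z <= r -> md w <= r ->
    md (G z w - P.[z, w]) <= e.

Lemma poly_approximable_mulpoly r (Q : {poly {poly C}}) (B : R) (G : C -> C -> C) :
  (forall z w, md z <= r -> md w <= r -> md Q.[z, w] <= B) ->
  poly_approximable r G -> poly_approximable r (fun z w => Q.[z, w] * G z w).
Proof.
move=> QB hG e e0; pose B' := Num.max B 1.
have B1 : 1 <= B' by rewrite le_max lexx orbT.
have e1 : 0 < e / B' by rewrite divr_gt0//; lra.
have [P hP] := hG _ e1; exists (Q * P) => z w zr wr.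
rewrite !hornerM -mulrBr mdM.
apply: (@le_trans _ _ (B' * (e / B'))).
  apply: ler_pM; rewrite ?md_ge0//; last exact: hP.
  by rewrite le_max QB.
by rewrite mulrC divfK//; lra.
Qed.

Lemma poly_approximable_cst r (c : C) G : poly_approximable r G -> poly_approximable r (fun z w => c * G z w).
Proof.
move=> hG e e0; have [|P hP] := @poly_approximable_mulpoly r c%:P%:P (md c) G _ hG e e0.
  by move=> z w _ _; rewrite !hornerC.
by exists P => z w zr wr; have := hP z w zr wr; rewrite !hornerC.
Qed.

Lemma poly_approximable_Xn r n G : poly_approximable r G -> poly_approximable r (fun z w => z ^+ n * G z w).
Proof.
have hX (z w : C) : ('X^n : {poly {poly C}}).[z, w] = z ^+ n.
  by rewrite hornerXn -rmorphXn /= hornerC.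
move=> hG e e0; have [|P hP] := @poly_approximable_mulpoly r 'X^n (r ^+ n) G _ hG e e0.
  move=> z w zr _; rewrite hX mdX; apply: lerXn2r => //; rewrite nnegrE ?md_ge0//.
  exact: le_trans (md_ge0 z) zr.
by exists P => z w zr wr; have := hP z w zr wr; rewrite hX.
Qed.

Lemma poly_approximable_add r G1 G2 : poly_approximable r G1 -> poly_approximable r G2 ->
  poly_approximable r (fun z w => G1 z w + G2 z w).
Proof.
move=> h1 h2 e e0; have e2 : 0 < e / 2 by lra.
have [P1 p1] := h1 _ e2; have [P2 p2] := h2 _ e2.
exists (P1 + P2) => z w zr wr; rewrite !hornerD.
have -> : G1 z w + G2 z w - (P1.[z, w] + P2.[z, w]) =
  (G1 z w - P1.[z, w]) + (G2 z w - P2.[z, w]) by ring.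
by apply: le_trans (mdD _ _) _; have := p1 z w zr wr; have := p2 z w zr wr; lra.
Qed.

Lemma poly_approximable_sum r n (G : 'I_n -> C -> C -> C) : (forall i, poly_approximable r (G i)) ->
  poly_approximable r (fun z w => \sum_(i < n) G i z w).
Proof.
elim: n G => [|n IH] G hG e e0.
  by exists 0 => z w _ _; rewrite big_ord0 !horner0 subr0 md0 ltW.
have [P hP] := poly_approximable_add (hG ord0) (IH (fun i => G (lift ord0 i)) (fun i => hG _)) e0.
by exists P => z w zr wr; rewrite big_ord_recl; apply: hP.
Qed.

Lemma poly_approximable_edge r (H : C -> C -> C -> C) k P Q : (forall x, poly_approximable r (H x)) ->
  poly_approximable r (fun z w => edge (fun x => H x z w) k P Q).
Proof.
move=> hH; rewrite /edge; apply: poly_approximable_cst.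
elim: k P Q => [|k IH] P Q /=; first exact: hH.
have h := poly_approximable_cst 2^-1 (poly_approximable_add (IH P (mid P Q)) (IH (mid P Q) Q)).
by move=> e e0; have [p hp] := h e e0; exists p => z w zr wr; rewrite mulrC; apply: hp.
Qed.

Lemma poly_approximable_snd r (g : C -> C) : (forall c, cdiff g c) -> 0 < r ->
  poly_approximable r (fun _ w => g w).
Proof.
move=> hg r0 e e0; have [p hp] := entire_approx hg r0 e0.
by exists p%:P => z w _ wr; rewrite hornerC; apply: hp.
Qed.

(** A Taylor polynomial in z has as coefficients finite combinations of the
    entire functions F x of w, which are approximated in turn. *)
Theorem entire_approx2 (F : C -> C -> C) r : jointly_continuous F ->
  (forall w c, cdiff (F^~ w) c) -> (forall z c, cdiff (F z) c) -> 0 < r ->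
  poly_approximable r F.
Proof.
move=> Fc F1 F2 r0 e e0; have e2 : 0 < e / 2 by lra.
have [k [N hN]] := taylor_uniform Fc F1 r0 e2.
have hT : poly_approximable r (fun a w => taylor (F^~ w) k (2 * r) N a).
  apply: poly_approximable_cst; apply: poly_approximable_sum => n; apply: poly_approximable_Xn.
  apply: poly_approximable_sum => m; apply: (@poly_approximable_edge r (fun x _ w => F x w * x^-1 ^+ n.+1)) => x.
  have h := poly_approximable_cst (x^-1 ^+ n.+1) (poly_approximable_snd (F2 x) r0).
  by move=> e' e'0; have [P hP] := h e' e'0; exists P => z w zr wr; rewrite mulrC; apply: hP.
have [P hP] := hT _ e2; exists P => z w zr wr.
have -> : F z w - P.[z, w] = (F z w - taylor (F^~ w) k (2 * r) N z) +
   (taylor (F^~ w) k (2 * r) N z - P.[z, w]) by rewrite addrA subrK.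
by apply: le_trans (mdD _ _) _; have := hN z w zr wr; have := hP z w zr wr; lra.
Qed.

(** By Cauchy's estimate at radius r, the terms of degree i > N are at most K
    r^N (b/r)^i on the disc of radius b <= r/2. *)
Lemma poly_trunc (P : {poly C}) N (K r b : R) : 1 <= b -> 2 * b <= r ->
  (forall z, md z <= r -> md P.[z] <= K * r ^+ N) ->
  forall z, md z <= b -> md (P.[z] - (take_poly N.+1 P).[z]) <= 2 * (K * b ^+ N.+1 / r).
Proof.
move=> b1 br PK z zb.
have r0 : 0 < r by lra.
have K0 : 0 <= K.
  have := le_trans (md_ge0 _) (PK 0 _); rewrite md0 => /(_ (ltW r0)).
  by rewrite pmulr_lge0 // exprn_gt0.
rewrite -{1}[P](poly_take_drop N.+1) hornerD addrC addKr hornerM hornerXn horner_coef.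
rewrite mulr_suml; apply: le_trans (md_sum _ _ _) _.
apply: le_trans (geom_half_sum _ _); last first.
  by rewrite divr_ge0 ?mulr_ge0 ?exprn_ge0//; lra.
apply: ler_sum => i _; rewrite coef_drop_poly -mulrA -exprD mdM mdX.
have h : md P`_(i + N.+1) * r ^+ (i + N.+1) <= K * r ^+ N.
  by apply: poly_cauchy => //; exact: ltW.
have zi : md z ^+ (i + N.+1) <= b ^+ (i + N.+1).
  by apply: lerXn2r => //; rewrite nnegrE ?md_ge0//; lra.
apply: le_trans (ler_wpM2l (md_ge0 _) zi) _.
rewrite -(ler_pM2r (exprn_gt0 (i + N.+1) r0)) mulrAC.
apply: le_trans (ler_wpM2r _ h) _; first by rewrite exprn_ge0//; lra.
have -> : K * b ^+ N.+1 / r * 2^-1 ^+ i * r ^+ (i + N.+1) =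
   K * r ^+ N * b ^+ N.+1 * (2^-1 * r) ^+ i.
  by rewrite exprMn exprD [r ^+ N.+1]exprS; field; lra.
rewrite exprD [b ^+ i * _]mulrC !mulrA; apply: ler_wpM2l.
  by rewrite !mulr_ge0 ?exprn_ge0//; lra.
by apply: lerXn2r; rewrite ?nnegrE; lra.
Qed.

(** On large discs g is close to polynomials, whose terms of degree larger
    than N are negligible by poly_trunc. The Fourier coefficients of g
    therefore give its coefficients. *)
Lemma entire_poly_growth (g : C -> C) (K : R) N : (forall c, cdiff g c) ->
  (forall z, md (g z) <= K * Num.max 1 (md z) ^+ N) ->
  exists p : {poly C}, (size p <= N.+1)%N /\ forall z, g z = p.[z].
Proof.
move=> hg gK.
have [w pw] := @exists_prim_root R N; set n := (2 ^ N)%N in pw.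
have Nn : (N.+1 <= n)%N by exact: ltn_expl.
pose p := \poly_(i < N.+1) dft n w i g.
exists p; split; first exact: size_poly.
move=> a; apply/eqP; rewrite -subr_eq0 -md_eq0 eq_le md_ge0 andbT.
pose b := Num.max 1 (md a).
have b1 : 1 <= b by rewrite le_max lexx.
have ab : md a <= b by rewrite le_max lexx orbT.
pose S := 1 + \sum_(i < N.+1) b ^+ i.
have Sp : 0 < S.
  rewrite /S ltr_pwDl// sumr_ge0// => i _; rewrite exprn_ge0//; lra.
apply/ler_addgt0Pr => e e0; rewrite add0r.
have K0 : 0 <= K.
  by have := le_trans (md_ge0 _) (gK 0); rewrite md0 max_l ?ler01// expr1n mulr1; apply.
pose e1 := Num.min (e / (2 * S)) 1.
have e10 : 0 < e1.
  by rewrite lt_min ltr01 andbT divr_gt0// mulr_gt0.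
have e11 : e1 <= 1 by rewrite ge_min lexx orbT.
have e1S : 2 * e1 * S <= e.
  apply: (@le_trans _ _ (2 * (e / (2 * S)) * S)).
    by apply: ler_wpM2r; [exact: ltW|apply: ler_wpM2l => //; rewrite ge_min lexx].
  by rewrite le_eqVlt; apply/orP; left; apply/eqP; field; lra.
have [r rb re] : exists2 r, 2 * b <= r & 2 * ((K + 1) * b ^+ N.+1) / e1 <= r.
  exists (Num.max (2 * b) (2 * ((K + 1) * b ^+ N.+1) / e1)).
    by rewrite le_max lexx.
  by rewrite le_max lexx orbT.
have r1 : 1 <= r by lra.
have r0 : 0 < r by lra.
have [P hP] := entire_approx hg r0 e10.
pose L := take_poly N.+1 P.
have gL z : md z <= b -> md (g z - L.[z]) <= 2 * e1.
  move=> zb; have -> : g z - L.[z] = (g z - P.[z]) + (P.[z] - L.[z]) by rewrite addrA subrK.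
  apply: le_trans (mdD _ _) _; have h1 : md (g z - P.[z]) <= e1 by apply: hP; lra.
  have h2 : md (P.[z] - L.[z]) <= 2 * ((K + 1) * b ^+ N.+1 / r).
    apply: poly_trunc => // x xr.
    have -> : P.[x] = g x - (g x - P.[x]) by rewrite opprB addrCA subrr addr0.
    apply: le_trans (md_dist _ _) _; rewrite mulrDl mul1r; apply: lerD.
      apply: le_trans (gK x) _; apply: ler_wpM2l => //.
      apply: lerXn2r; rewrite ?nnegrE ?le_max ?ler01//; first lra.
      by rewrite ge_max r1.
    apply: le_trans (hP _ xr) _; apply: le_trans e11 _.
    by rewrite -(expr1n _ N) lerXn2r ?nnegrE//; lra.
  have h3 : 2 * ((K + 1) * b ^+ N.+1 / r) <= e1.
    by rewrite mulrA ler_pdivrMr// -ler_pdivrMl// mulrC.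
  lra.
have dL i : (i < N.+1)%N -> md (dft n w i g - L`_i) <= 2 * e1.
  move=> iN; have -> : L`_i = dft n w i (fun z => L.[z]).
    have := @dft_poly R n w i L 1 pw (leq_trans iN Nn) (leq_trans (size_take_poly _ _) Nn).
    rewrite expr1n mulr1 => <-; rewrite /dft; congr (_ * _).
    by apply: eq_bigr => j _; rewrite mul1r.
  have -> : dft n w i g - dft n w i (fun z => L.[z]) = dft n w i (fun z => g z - L.[z]).
    by rewrite /dft -mulrBr -sumrB; congr (_ * _); apply: eq_bigr => j _; rewrite -mulrBl.
  apply: (md_dft _ pw) => j; apply: gL.
  by rewrite mdX (md_prim_root pw) expr1n.
have -> : g a - p.[a] = (g a - L.[a]) - \sum_(i < N.+1) (dft n w i g - L`_i) * a ^+ i.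
  rewrite horner_poly (horner_coef_wide a (size_take_poly N.+1 P)).
  under [X in _ = _ - X]eq_bigr do rewrite mulrBl.
  by rewrite sumrB; ring.
apply: le_trans (md_dist _ _) _; apply: le_trans e1S.
rewrite /S mulrDr mulr1; apply: lerD; first exact: gL.
apply: le_trans (md_sum _ _ _) _; rewrite mulr_sumr; apply: ler_sum => i _.
rewrite mdM mdX; apply: ler_pM; rewrite ?exprn_ge0 ?md_ge0 ?dL//.
by apply: lerXn2r => //; rewrite nnegrE ?md_ge0//; lra.
Qed.
End Approximation.

(** * Fréchet holomorphic maps *)

Section Frechet.
Context {R : realType}.
Local Notation C := (Cplx R).
Context (F : C2 R -> C2 R).

Lemma ltc_real (a b : R) : (real_complex R a < real_complex R b :> C) = (a < b).
Proof. exact: ltcR. Qed.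

Lemma le_max_real (a b : R) : real_complex R (Num.max a b) =
   Num.max (real_complex R a) (real_complex R b) :> C.
Proof.
rewrite /Order.max ltc_real; by case: ifP.
Qed.

Lemma pair_norm (s t : C) : `|(s, t) : C2 R| = real_complex R (Num.max (md s) (md t)).
Proof. by rewrite le_max_real -!normE prod_normE. Qed.

(** L1 and L2 are the images of the two basis vectors under the differential. *)
Lemma diff_eps x : differentiable F x -> exists L1 L2 : C2 R,
  forall e : R, 0 < e -> exists2 dl : R, 0 < dl & forall s t : C,
    md s < dl -> md t < dl ->
    md ((F (x.1 + s, x.2 + t)).1 - (F x).1 - (L1.1 * s + L2.1 * t)) <= e * Num.max (md s) (md t) /\
    md ((F (x.1 + s, x.2 + t)).2 - (F x).2 - (L1.2 * s + L2.2 * t)) <= e * Num.max (md s) (md t).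
Proof.
move=> h; pose L := 'd F x.
have LE (s t : C) : L (s, t) = (s *: (L (1, 0)) + t *: L (0, 1)).
  rewrite -!linearZ -linearD; congr (L _).
  by congr pair; rewrite /= ?scaler0 ?addr0 ?add0r //; rewrite /GRing.scale /= mulr1.
pose L1 := L (1, 0); pose L2 := L (0, 1).
exists L1, L2 => e e0.
have := diff_locally h; move/eqaddoP => /(_ (real_complex R e)).
rewrite (_ : 0 < real_complex R e = true); last by rewrite -(rmorph0 (real_complex R)) ltc_real.
move=> /(_ isT) /nbhs_norm0P [dl /= dl0 hd].
have dlE : dl = real_complex R (complex.Re dl).
  by rewrite RRe_real// gtr0_real.
exists (complex.Re dl).
  by rewrite -ltc_real -dlE.
move=> s t sd td; have := hd (s, t).
rewrite /= pair_norm dlE ltc_real gt_max sd td => /(_ isT).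
have -> : (F \o +%R^~ x - (cst (F x) + L)) (s, t) =
    (((F (x.1 + s, x.2 + t)).1 - (F x).1 - (L1.1 * s + L2.1 * t)),
     ((F (x.1 + s, x.2 + t)).2 - (F x).2 - (L1.2 * s + L2.2 * t))).
  have -> : (F \o +%R^~ x - (cst (F x) + L)) (s, t) =
     F ((s, t) + x) - (F x + L (s, t)) by [].
  rewrite LE -/L1 -/L2 (_ : (s, t) + x = (x.1 + s, x.2 + t)); last first.
    by case: x {h L LE hd L1 L2} => x1 x2; congr pair; rewrite addrC.
  move: (F (x.1 + s, x.2 + t)) (F x) (L1) (L2) => [a1 a2] [b1 b2] [c1 c2] [d1 d2].
  transitivity (a1 - (b1 + (s * c1 + t * d1)), a2 - (b2 + (s * c2 + t * d2))); first by [].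
  by congr pair; rewrite /= opprD addrA ![s * _]mulrC ![t * _]mulrC.
rewrite pair_norm -rmorphM lecR ge_max => /andP[]; by split.
Qed.

Definition entire2 (f : C -> C -> C) :=
  [/\ jointly_continuous f, forall w c, cdiff (f^~ w) c & forall z c, cdiff (f z) c].

Lemma entire2_of_expansion (f : C -> C -> C) :
  (forall a b, exists A B : C, forall e : R, 0 < e -> exists2 dl : R, 0 < dl &
    forall s t, md s < dl -> md t < dl ->
    md (f (a + s) (b + t) - f a b - (A * s + B * t)) <= e * Num.max (md s) (md t)) ->
  entire2 f.
Proof.
move=> hf; split.
- move=> a b e e0; have [A [B hAB]] := hf a b.
  have [dl dl0 hd] := hAB 1 ltr01.
  have A0 := md_ge0 A; have B0 := md_ge0 B.
  have q0 : 0 < e / (1 + md A + md B) by rewrite divr_gt0//; lra.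
  exists (Num.min dl (e / (1 + md A + md B))); first by rewrite lt_min dl0.
  move=> z w; rewrite !lt_min => /andP[z1 z2] /andP[w1 w2].
  have := hd _ _ z1 w1; rewrite ![_ + (_ - _)]addrC !subrK mul1r => h.
  set M := Num.max _ _ in h.
  have Mz : md (z - a) <= M by rewrite le_max lexx.
  have Mw : md (w - b) <= M by rewrite le_max lexx orbT.
  have : M <= e / (1 + md A + md B) by rewrite ge_max !ltW.
  rewrite ler_pdivlMr; last lra.
  set u := f z w - f a b in h *.
  have -> : u = (u - (A * (z - a) + B * (w - b))) + (A * (z - a) + B * (w - b)) by rewrite subrK.
  move=> Me; apply: le_trans (mdD _ _) _.
  have h2 : md (A * (z - a) + B * (w - b)) <= (md A + md B) * M.
    apply: le_trans (mdD _ _) _; rewrite !mdM mulrDl.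
    by apply: lerD; apply: ler_wpM2l.
  nra.
- move=> w c; have [A [B hAB]] := hf c w; exists A => e e0.
  have [dl dl0 hd] := hAB _ e0; exists dl => // z zc.
  have := hd (z - c) 0 zc; rewrite md0 dl0 addr0 mulr0 addr0 [c + _]addrC subrK => /(_ isT).
  by rewrite max_l ?md_ge0.
- move=> w c; have [A [B hAB]] := hf w c; exists B => e e0.
  have [dl dl0 hd] := hAB _ e0; exists dl => // z zc.
  have := hd 0 (z - c); rewrite md0 dl0 addr0 mulr0 add0r [c + _]addrC subrK => /(_ isT zc).
  by rewrite max_r ?md_ge0.
Qed.

Lemma holomorphic_entire2 : holomorphic F ->
  entire2 (fun z w => (F (z, w)).1) /\ entire2 (fun z w => (F (z, w)).2).
Proof.
move=> hF; split; apply: entire2_of_expansion => a b;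
  have [L1 [L2 hL]] := diff_eps (hF (a, b)).
  exists L1.1, L2.1 => e /hL[dl dl0 hd]; exists dl => // s t sd td.
  by have [] := hd s t sd td.
exists L1.2, L2.2 => e /hL[dl dl0 hd]; exists dl => // s t sd td.
by have [] := hd s t sd td.
Qed.
End Frechet.

(** * Polynomial maps and the filtration of a Hénon map *)

Section PolyFun.
Context {R : realType}.
Local Notation C := (Cplx R).
Implicit Types (f g : C -> C -> C).

Definition poly_fun f := exists P : {poly {poly C}}, forall z w, f z w = P.[z, w].

Lemma poly_fun_eq f g : (forall z w, f z w = g z w) -> poly_fun g -> poly_fun f.
Proof. by move=> fg [P hP]; exists P => z w; rewrite fg. Qed.

Lemma poly_fun_cst c : poly_fun (fun _ _ => c).
Proof. by exists c%:P%:P => z w; rewrite !hornerC. Qed.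

Lemma poly_fun_add f g : poly_fun f -> poly_fun g -> poly_fun (fun z w => f z w + g z w).
Proof. by move=> [P hP] [Q hQ]; exists (P + Q) => z w; rewrite !hornerD hP hQ. Qed.

Lemma poly_fun_mul f g : poly_fun f -> poly_fun g -> poly_fun (fun z w => f z w * g z w).
Proof. by move=> [P hP] [Q hQ]; exists (P * Q) => z w; rewrite !hornerM hP hQ. Qed.

Lemma poly_fun_exp f n : poly_fun f -> poly_fun (fun z w => f z w ^+ n).
Proof. by move=> [P hP]; exists (P ^+ n) => z w; rewrite !horner_exp hP. Qed.

Lemma poly_fun_fst : poly_fun (fun z _ => z).
Proof. by exists 'X => z w; rewrite hornerX hornerC. Qed.

Lemma poly_fun_snd : poly_fun (fun _ w => w).
Proof. by exists ('X%:P) => z w; rewrite hornerC hornerX. Qed.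

Lemma poly_fun_sum n (f : 'I_n -> C -> C -> C) : (forall i, poly_fun (f i)) ->
  poly_fun (fun z w => \sum_(i < n) f i z w).
Proof.
elim: n f => [|n IH] f hf.
  by apply: poly_fun_eq (poly_fun_cst 0) => z w; rewrite big_ord0.
apply: poly_fun_eq (poly_fun_add (hf ord0) (IH (fun i => f (lift ord0 i)) (fun i => hf _))).
by move=> z w; rewrite big_ord_recl.
Qed.

Lemma poly_fun_horner (p : {poly C}) g : poly_fun g -> poly_fun (fun z w => p.[g z w]).
Proof.
move=> hg; apply: (@poly_fun_eq _ (fun z w => \sum_(i < size p) p`_i * g z w ^+ i)).
  by move=> z w; rewrite horner_coef.
by apply: poly_fun_sum => i; apply: poly_fun_mul; [apply: poly_fun_cst|apply: poly_fun_exp].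
Qed.

Lemma poly_fun_comp f g1 g2 : poly_fun f -> poly_fun g1 -> poly_fun g2 ->
  poly_fun (fun z w => f (g1 z w) (g2 z w)).
Proof.
move=> [P hP] h1 h2.
apply: (@poly_fun_eq _ (fun z w => \sum_(i < size P) (P`_i).[g2 z w] * g1 z w ^+ i)).
  move=> z w; rewrite hP (horner_coef P) horner_sum; apply: eq_bigr => i _.
  by rewrite hornerM horner_exp hornerC.
by apply: poly_fun_sum => i; apply: poly_fun_mul;
  [apply: poly_fun_horner|apply: poly_fun_exp].
Qed.

Lemma polynomial_mapP (F : C2 R -> C2 R) : polynomial_map F <->
  poly_fun (fun z w => (F (z, w)).1) /\ poly_fun (fun z w => (F (z, w)).2).
Proof.
split=> [[P [Q h]]|[[P hP] [Q hQ]]].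
  by split; [exists P|exists Q] => z w; rewrite h.
by exists P, Q => z w; rewrite -hP -hQ; case: (F _).
Qed.

Lemma polynomial_map_comp (F G : C2 R -> C2 R) :
  polynomial_map F -> polynomial_map G -> polynomial_map (F \o G).
Proof.
move=> /polynomial_mapP[f1 f2] /polynomial_mapP[g1 g2]; apply/polynomial_mapP; split.
  apply: poly_fun_eq (poly_fun_comp f1 g1 g2) => z w /=; by rewrite -surjective_pairing.
apply: poly_fun_eq (poly_fun_comp f2 g1 g2) => z w /=; by rewrite -surjective_pairing.
Qed.

Lemma polynomial_map_iter n (F : C2 R -> C2 R) :
  polynomial_map F -> polynomial_map (iter n F).
Proof.
move=> hF; elim: n => [|n IH]; last exact: (polynomial_map_comp hF IH).
by apply/polynomial_mapP; split; [exact: poly_fun_fst|exact: poly_fun_snd].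
Qed.

(** A polynomial of bounded size in z has coefficients that are combinations
    of its values at fixed points, and these values are polynomials in w. *)
Lemma separately_poly f N :
  (forall w, exists p : {poly C}, (size p <= N.+1)%N /\ forall z, f z w = p.[z]) ->
  (forall z, exists p : {poly C}, forall w, f z w = p.[w]) ->
  poly_fun f.
Proof.
move=> h1 h2; have [u pu] := @exists_prim_root R N; set n := (2 ^ N)%N in pu.
have Nn : (N.+1 <= n)%N by exact: ltn_expl.
apply: (@poly_fun_eq _ (fun z w => \sum_(i < N.+1) dft n u i (f^~ w) * z ^+ i)).
  move=> z w; have [p [sp hp]] := h1 w.
  rewrite hp (horner_coef_wide z sp); apply: eq_bigr => i _; congr (_ * _).
  have := @dft_poly R n u i p 1 pu (leq_trans (ltn_ord i) Nn) (leq_trans sp Nn).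
  rewrite expr1n mulr1 => <-; rewrite /dft; congr (_ * _).
  by apply: eq_bigr => j _; rewrite mul1r hp.
apply: poly_fun_sum => i; apply: poly_fun_mul; last by apply/poly_fun_exp/poly_fun_fst.
rewrite /dft; apply: poly_fun_mul; first exact: poly_fun_cst.
apply: poly_fun_sum => j; apply: poly_fun_mul; last exact: poly_fun_cst.
have [p hp] := h2 (u ^+ j).
by apply: poly_fun_eq (poly_fun_horner p poly_fun_snd) => z w; rewrite hp.
Qed.

End PolyFun.

Section Expanding.
Context {R : realType}.
Local Notation C := (Cplx R).
Implicit Types (x : C2 R) (c K : R) (H G : C2 R -> C2 R).

(** The lower bound 1 makes powers of this norm increase with the exponent. *)
Definition supnorm x : R := Num.max 1 (Num.max (md x.1) (md x.2)).
Definition swap x : C2 R := (x.2, x.1).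

Lemma swapK : involutive swap. Proof. by case. Qed.

Lemma supnorm_ge1 x : 1 <= supnorm x. Proof. by rewrite le_max lexx. Qed.
Lemma supnorm_fst x : md x.1 <= supnorm x. Proof. by rewrite !le_max lexx !orbT. Qed.
Lemma supnorm_snd x : md x.2 <= supnorm x. Proof. by rewrite !le_max lexx !orbT. Qed.
Lemma supnorm_swap x : supnorm (swap x) = supnorm x.
Proof. by rewrite /supnorm /= [Num.max (md x.2) _]maxC. Qed.
Lemma supnorm_le x (B : R) : 1 <= B -> md x.1 <= B -> md x.2 <= B -> supnorm x <= B.
Proof. by move=> h1 h2 h3; rewrite !ge_max h1 h2. Qed.

(** Upper and lower growth estimates of degree D, the second one on the cone
    |x.2| >= max (|x.1|, R0). Keeping the constants inside the power makes the
    estimates stable under composition, with the same constants. *)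
Definition expanding (R0 : R) c K D H :=
  (forall x, K * supnorm (H x) <= (K * supnorm x) ^+ D) /\
  (forall x, R0 <= md x.2 -> md x.1 <= md x.2 ->
     2 * md (H x).1 <= md (H x).2 /\ (c * md x.2) ^+ D <= c * md (H x).2).

Lemma expanding_weaken R0 R0' c c' K K' D H : (0 < D)%N ->
  R0 <= R0' -> 0 < c' <= c -> 1 <= K <= K' ->
  expanding R0 c K D H -> expanding R0' c' K' D H.
Proof.
move=> D0 hR /andP[c0 cc] /andP[K1 KK] [hu hl]; split=> x.
  have -> : K' * supnorm (H x) = (K' / K) * (K * supnorm (H x)) by field; lra.
  have -> : K' * supnorm x = (K' / K) * (K * supnorm x) by field; lra.
  have q1 : 1 <= K' / K by rewrite ler_pdivlMr; lra.
  rewrite exprMn; apply: ler_pM => //.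
  - by rewrite divr_ge0; lra.
  - by rewrite mulr_ge0 ?(le_trans ler01 (supnorm_ge1 _))//; lra.
  by rewrite -[leLHS]expr1 ler_weXn2l.
move=> x2 x12; have [h1 h2] := hl x (le_trans hR x2) x12; split=> //.
have -> : c' * md x.2 = (c' / c) * (c * md x.2) by field; lra.
have -> : c' * md (H x).2 = (c' / c) * (c * md (H x).2) by field; lra.
have q0 : 0 <= c' / c by rewrite divr_ge0; lra.
have q1 : c' / c <= 1 by rewrite ler_pdivrMr; lra.
rewrite exprMn; apply: ler_pM => //; rewrite ?exprn_ge0//.
  by rewrite mulr_ge0 ?md_ge0//; lra.
by rewrite -[leRHS]expr1 ler_wiXn2l// q0.
Qed.

Lemma expanding_step R0 c K D H x : (0 < D)%N -> 0 < c -> 1 <= c * R0 ->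
  expanding R0 c K D H -> R0 <= md x.2 -> md x.1 <= md x.2 ->
  md x.2 <= md (H x).2 /\ md (H x).1 <= md (H x).2.
Proof.
move=> D0 c0 cR [_ hl] x2 x12; have [h1 h2] := hl x x2 x12; split; last first.
  by have := md_ge0 (H x).1; lra.
rewrite -(ler_pM2l c0); apply: le_trans h2.
rewrite -[leLHS]expr1 ler_weXn2l//; apply: le_trans cR _.
by rewrite ler_pM2l.
Qed.

Lemma expanding_comp R0 c K D D' H G : (0 < D')%N -> 0 < c -> 1 <= c * R0 -> 0 <= K ->
  expanding R0 c K D H -> expanding R0 c K D' G ->
  expanding R0 c K (D' * D) (H \o G).
Proof.
move=> D0 c0 cR K0 hH hG; split=> x /=.
  rewrite exprM; apply: le_trans (hH.1 _) _.
  apply: lerXn2r; rewrite ?nnegrE ?exprn_ge0 ?mulr_ge0 ?(le_trans ler01 (supnorm_ge1 _))//.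
  exact: hG.1.
move=> x2 x12; have [s1 s2] := expanding_step D0 c0 cR hG x2 x12.
have [h1 h2] := hH.2 _ (le_trans x2 s1) s2; split=> //.
rewrite exprM; apply: le_trans h2; apply: lerXn2r.
- by rewrite nnegrE exprn_ge0// mulr_ge0 ?md_ge0// ltW.
- by rewrite nnegrE mulr_ge0 ?md_ge0// ltW.
by have [] := hG.2 _ x2 x12.
Qed.

Lemma expanding_iter R0 c K D H m : (0 < D)%N -> 0 < c -> 1 <= c * R0 -> 0 <= K ->
  expanding R0 c K D H -> expanding R0 c K (D ^ m.+1) (iter m.+1 H).
Proof.
move=> D0 c0 cR K0 hH; elim: m => [|m IH]; first by rewrite expn1.
rewrite expnSr; apply: (@expanding_comp R0 c K D (D ^ m.+1) H (iter m.+1 H)) => //.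
by rewrite expn_gt0 D0.
Qed.

Lemma poly_lower (p : {poly C}) : (1 < size p)%N -> exists R0 : R, 1 <= R0 /\
  forall w, R0 <= md w -> md (lead_coef p) / 2 * md w ^+ (size p).-1 <= md p.[w].
Proof.
move=> sp; set d := (size p).-1; have d0 : (0 < d)%N by rewrite /d; lia.
have sE : size p = d.+1 by rewrite /d; lia.
have lp : 0 < md (lead_coef p).
  by rewrite md_gt0 lead_coef_eq0 -size_poly_gt0; lia.
pose A := \sum_(i < d) md p`_i.
have A0 : 0 <= A by apply: sumr_ge0 => i _; exact: md_ge0.
exists (1 + 2 * A / md (lead_coef p)); split.
  by rewrite lerDl divr_ge0 ?mulr_ge0// ltW.
move=> w hw; have w1 : 1 <= md w.
  by apply: le_trans hw; rewrite lerDl divr_ge0 ?mulr_ge0// ltW.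
have w0 : 0 <= md w by lra.
have -> : p.[w] = lead_coef p * w ^+ d + \sum_(i < d) p`_i * w ^+ i.
  by rewrite horner_coef sE big_ord_recr /= addrC lead_coefE.
apply: le_trans (md_lb _ _); rewrite mdM mdX.
have hs : md (\sum_(i < d) p`_i * w ^+ i) <= A * md w ^+ d.-1.
  apply: le_trans (md_sum _ _ _) _; rewrite /A mulr_suml; apply: ler_sum => i _.
  rewrite mdM mdX; apply: ler_wpM2l; first exact: md_ge0.
  by apply: ler_weXn2l => //; have := ltn_ord i; lia.
have hA : 2 * A <= md (lead_coef p) * md w.
  rewrite -ler_pdivrMl// mulrC.
  by apply: le_trans hw; rewrite lerDr.
have ed : md w ^+ d = md w * md w ^+ d.-1 by rewrite -exprS prednK.
have := ler_wpM2r (exprn_ge0 d.-1 w0) hA.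
rewrite ed; nra.
Qed.

Lemma elementary_expanding (p : {poly C}) (b : C) : (2 < size p)%N ->
  exists R0 c K, [/\ 0 < c <= 1, 1 <= K &
    expanding R0 c K (size p).-1 (fun x => (x.2, p.[x.2] - b * x.1))].
Proof.
move=> sp; have [R1 [R11 hp]] := @poly_lower p (ltnW sp).
set d := (size p).-1 in hp *; have d2 : (2 <= d)%N by rewrite /d; lia.
have sE : size p = d.+1 by rewrite /d; lia.
set l := md (lead_coef p) in hp.
have l0 : 0 < l by rewrite md_gt0 lead_coef_eq0 -size_poly_gt0; lia.
have b0 := md_ge0 b.
pose c := Num.min 1 (l / 4).
have c0 : 0 < c by rewrite lt_min ltr01 divr_gt0.
have c1 : c <= 1 by rewrite ge_min lexx.
have cl : c <= l / 4 by rewrite ge_min lexx orbT.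
pose A := \sum_(i < size p) md p`_i.
have A0 : 0 <= A by apply: sumr_ge0 => i _; exact: md_ge0.
pose K := 1 + A + md b.
pose R0 := R1 + 4 * md b / l + 2 / c.
have q1 : 0 <= 4 * md b / l by rewrite divr_ge0 ?mulr_ge0// ltW.
have q2 : 0 <= 2 / c by rewrite divr_ge0// ltW.
exists R0, c, K; split; [by rewrite c0|by rewrite /K; lra|split=> x /=].
  have n1 := supnorm_ge1 x; have K1 : 1 <= K by rewrite /K; lra.
  have nd : supnorm x <= supnorm x ^+ d by rewrite -[leLHS]expr1 ler_weXn2l//; lia.
  have n0 : 0 <= supnorm x ^+ d by lra.
  have hN : supnorm (x.2, p.[x.2] - b * x.1) <= K * supnorm x ^+ d.
    have An : 0 <= A * supnorm x ^+ d by rewrite mulr_ge0.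
    have bn : 0 <= md b * supnorm x ^+ d by rewrite mulr_ge0.
    have bn2 : md b * md x.1 <= md b * supnorm x ^+ d.
      by apply: ler_wpM2l => //; apply: le_trans (supnorm_fst x) nd.
    apply: supnorm_le => /=; rewrite /K.
    - by nra.
    - by have := supnorm_snd x; nra.
    apply: le_trans (md_dist _ _) _; rewrite mdM.
    have : md p.[x.2] <= A * supnorm x ^+ d.
      apply: le_trans (md_horner _ (supnorm_snd x)) _; rewrite /A mulr_suml.
      apply: ler_sum => i _; apply: ler_wpM2l; first exact: md_ge0.
      by apply: ler_weXn2l => //; rewrite -ltnS -sE.
    by nra.
  rewrite exprMn; apply: (@le_trans _ _ (K * (K * supnorm x ^+ d))).
    by apply: ler_wpM2l => //; lra.
  rewrite mulrA; apply: ler_wpM2r => //.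
  by rewrite -expr2 ler_weXn2l.
move=> x2 x12.
have x2R : R1 <= md x.2 by apply: le_trans x2; rewrite /R0; lra.
have x21 : 1 <= md x.2 by lra.
have hb : md b * md x.1 <= l / 4 * md x.2 ^+ d.
  apply: (@le_trans _ _ (md b * md x.2)); first exact: ler_wpM2l.
  have h4 : md b <= l / 4 * md x.2.
    have : 4 * md b / l <= md x.2 by apply: le_trans x2; rewrite /R0; lra.
    by rewrite ler_pdivrMr//; lra.
  apply: (@le_trans _ _ (l / 4 * md x.2 * md x.2)); first by apply: ler_wpM2r; rewrite ?md_ge0.
  rewrite -mulrA -expr2; apply: ler_wpM2l; first by rewrite divr_ge0// ltW.
  by apply: ler_weXn2l.
have hlow : l / 4 * md x.2 ^+ d <= md (p.[x.2] - b * x.1).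
  have := hp _ x2R; have := md_lb p.[x.2] (- (b * x.1)).
  rewrite mdN mdM; lra.
have xd : md x.2 ^+ 2 <= md x.2 ^+ d by apply: ler_weXn2l.
split.
  apply: le_trans hlow.
  apply: (@le_trans _ _ (c * md x.2 ^+ 2)); last first.
    by apply: ler_pM => //; [exact: ltW|rewrite exprn_ge0 ?md_ge0].
  rewrite expr2 mulrA; apply: ler_wpM2r; first exact: md_ge0.
  by rewrite mulrC -ler_pdivrMr//; apply: le_trans x2; rewrite /R0; lra.
rewrite exprMn; apply: (@le_trans _ _ (c ^+ 2 * md x.2 ^+ d)).
  apply: ler_wpM2r; first by rewrite exprn_ge0 ?md_ge0.
  by apply: ler_wiXn2l => //; exact: ltW.
rewrite expr2 -mulrA; apply: ler_wpM2l; first exact: ltW.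
apply: le_trans hlow; apply: ler_wpM2r => //.
by rewrite exprn_ge0 ?md_ge0.
Qed.

(** The inverse of a Hénon map expands the opposite cone, so it is conjugated
    by the exchange of the coordinates. *)
Definition henon_like H D Hi R0 c K :=
  [/\ cancel H Hi, cancel Hi H, polynomial_map H, polynomial_map Hi &
      expanding R0 c K D H /\ expanding R0 c K D (swap \o Hi \o swap)].

Lemma henon_like_weaken H D Hi R0 R0' c c' K K' : (0 < D)%N ->
  R0 <= R0' -> 0 < c' <= c -> 1 <= K <= K' ->
  henon_like H D Hi R0 c K -> henon_like H D Hi R0' c' K'.
Proof.
move=> D0 hR hc hK [h1 h2 h3 h4 [h5 h6]]; split=> //.
by split; apply: expanding_weaken; eauto.
Qed.

Lemma henon_compositions_like H : henon_compositions H ->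
  exists D Hi R0 c K, [/\ (1 < D)%N, 0 < c <= 1, 1 <= K & henon_like H D Hi R0 c K].
Proof.
elim=> {H} [H [p [a [pm sp a0 ->]]]|H G _ IH1 _ IH2].
  have [R1 [c1 [K1 [hc1 hK1 e1]]]] := elementary_expanding a sp.
  have sp' : (2 < size (a^-1 *: p)%R)%N by rewrite size_scale ?invr_eq0.
  have [R2 [c2 [K2 [hc2 hK2 e2]]]] := elementary_expanding a^-1 sp'.
  have D2 : (1 < (size p).-1)%N by lia.
  exists (size p).-1, (fun x => ((p.[x.1] - x.2) / a, x.1)).
  exists (Num.max R1 R2), (Num.min c1 c2), (Num.max K1 K2); split => //.
  - by move: hc1 hc2 => /andP[? ?] /andP[? ?]; rewrite lt_min ge_min; apply/andP; split; [apply/andP|apply/orP; left].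
  - by rewrite le_max hK1.
  split.
  - by case=> z w; rewrite /henon /=; congr pair; field.
  - by case=> z w; rewrite /henon /=; congr pair; field.
  - apply/polynomial_mapP; split => /=; first exact: poly_fun_snd.
    apply: poly_fun_eq (poly_fun_add (poly_fun_horner p poly_fun_snd)
      (poly_fun_mul (poly_fun_cst (- a)) poly_fun_fst)) => z w.
    by rewrite mulNr.
  - apply/polynomial_mapP; split => /=; last exact: poly_fun_fst.
    apply: poly_fun_eq (poly_fun_mul (poly_fun_cst a^-1) (poly_fun_add
      (poly_fun_horner p poly_fun_fst) (poly_fun_mul (poly_fun_cst (-1)) poly_fun_snd))) => z w.
    by rewrite mulN1r mulrC.
  move: hc1 hc2 => /andP[? ?] /andP[? ?].
  split.
    apply: (expanding_weaken _ _ _ _ e1); first by lia.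
    - by rewrite le_max lexx.
    - by rewrite lt_min ge_min lexx; apply/andP; split; [apply/andP|].
    - by rewrite hK1 le_max lexx.
  have -> : swap \o (fun x => ((p.[x.1] - x.2) / a, x.1)) \o swap =
    (fun x => (x.2, (a^-1 *: p).[x.2] - a^-1 * x.1)).
    by apply/funext => -[z w]; rewrite /swap /= hornerZ mulrBl mulrC [z / a]mulrC.
  rewrite size_scale ?invr_eq0// in e2.
  apply: (expanding_weaken _ _ _ _ e2); first exact: ltnW D2.
  - by rewrite le_max lexx orbT.
  - by rewrite lt_min ge_min lexx orbT; apply/andP; split; [apply/andP|].
  - by rewrite hK2 le_max lexx orbT.
move: IH1 => [D1 [H1 [R1 [c1 [K1 [hD1 /andP[c10 c11] hK1 e1]]]]]].
move: IH2 => [D2 [G1 [R2 [c2 [K2 [hD2 /andP[c20 c21] hK2 e2]]]]]].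
pose c := Num.min c1 c2; pose K := Num.max K1 K2.
have c0 : 0 < c by rewrite lt_min c10.
pose R0 := Num.max c^-1 (Num.max R1 R2).
have cR : 1 <= c * R0 by rewrite -ler_pdivrMl// mulr1 le_max lexx.
have K0 : 0 <= K by rewrite le_max; apply/orP; left; lra.
have [a1 a2 a3 a4 [a5 a6]] : henon_like H D1 H1 R0 c K.
  apply: henon_like_weaken e1; first by lia.
  - by rewrite !le_max lexx !orbT.
  - by rewrite c0 ge_min lexx.
  - by rewrite hK1 le_max lexx.
have [b1 b2 b3 b4 [b5 b6]] : henon_like G D2 G1 R0 c K.
  apply: henon_like_weaken e2; first by lia.
  - by rewrite !le_max lexx !orbT.
  - by rewrite c0 ge_min lexx orbT.
  - by rewrite hK2 le_max lexx orbT.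
exists (D2 * D1)%N, (G1 \o H1), R0, c, K; split.
- by nia.
- by rewrite c0 ge_min c11.
- by rewrite le_max hK1.
split; [exact: can_comp|exact: can_comp|exact: polynomial_map_comp|exact: polynomial_map_comp|].
split; first by apply: expanding_comp => //; lia.
have -> : swap \o (G1 \o H1) \o swap = (swap \o G1 \o swap) \o (swap \o H1 \o swap).
  by apply/funext => x; rewrite /= swapK.
by rewrite mulnC; apply: expanding_comp => //; lia.
Qed.

End Expanding.

(** * Maps commuting with a Hénon map are polynomial *)

Section LeadingCoefficient.
Context {R : realType}.
Local Notation C := (Cplx R).

Lemma poly_zero (p : {poly C}) : (forall z, p.[z] = 0) -> p = 0.
Proof.
move=> h; apply/polyP => i; rewrite coef0; apply/eqP; rewrite -md_eq0.
rewrite eq_le md_ge0 andbT -[leLHS]mulr1 -(expr1n _ i).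
by apply: poly_cauchy => // z _; rewrite h md0.
Qed.

(** The upper estimate bounds the degree in z by N and makes the coefficient
    of z^N a bounded polynomial in w, that is a constant; the lower one shows
    that it is not zero. *)
Lemma leading_coef_constant (q : {poly {poly C}}) N (R0 c K : R) :
  (0 < N)%N -> 0 < c -> 1 <= K ->
  (forall z w, R0 <= md z -> md w <= md z -> (c * md z) ^+ N <= c * md q.[z, w]) ->
  (forall z w, K * md q.[z, w] <= (K * supnorm (z, w)) ^+ N) ->
  size q = N.+1 /\ exists2 l, l != 0 & lead_coef q = l%:P.
Proof.
move=> N0 c0 K1 hl hu.
have Kp : 0 < K by lra.
have hq z w : md q.[z, w] <= K ^+ N.-1 * supnorm (z, w) ^+ N.
  rewrite -(ler_pM2l Kp) mulrA -exprS prednK// -exprMn; exact: hu.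
have ub z w : md (map_poly (horner_eval w) q).[z] <=
    K ^+ N.-1 * Num.max 1 (md w) ^+ N * Num.max 1 (md z) ^+ N.
  rewrite slice_horner -mulrA -exprMn; apply: le_trans (hq z w) _.
  apply: ler_wpM2l; first by rewrite exprn_ge0// ltW.
  have w1 : 1 <= Num.max 1 (md w) by rewrite le_max lexx.
  have w2 : md w <= Num.max 1 (md w) by rewrite le_max lexx orbT.
  have z1 : 1 <= Num.max 1 (md z) by rewrite le_max lexx.
  have z2 : md z <= Num.max 1 (md z) by rewrite le_max lexx orbT.
  apply: lerXn2r; rewrite ?nnegrE.
  - by apply: le_trans (supnorm_ge1 _).
  - by rewrite mulr_ge0//; lra.
  by apply: supnorm_le => /=; nra.
have sw w : (size (map_poly (horner_eval w) q) <= N.+1)%N.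
  exact: poly_growth_size (ub^~ w).
have sq : (size q <= N.+1)%N.
  apply/leq_sizeP => j Nj; apply: poly_zero => w.
  have := leq_sizeP _ _ (sw w) j Nj; by rewrite coef_map.
have qN : (size (q`_N)%R <= 1)%N.
  apply: (@poly_growth_size R _ (K ^+ N.-1) 0) => w.
  pose r := Num.max 1 (md w); have r1 : 1 <= r by rewrite le_max lexx.
  have rw : md w <= r by rewrite le_max lexx orbT.
  have r0 : 0 < r by lra.
  have -> : (q`_N).[w] = (map_poly (horner_eval w) q)`_N by rewrite coef_map.
  rewrite expr0 mulr1 -(ler_pM2r (exprn_gt0 N r0)).
  apply: poly_cauchy; first exact: ltW.
  move=> z zr; rewrite slice_horner; apply: le_trans (hq z w) _.
  apply: ler_wpM2l; first by rewrite exprn_ge0// ltW.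
  apply: lerXn2r; rewrite ?nnegrE; [exact: le_trans (supnorm_ge1 _)|exact: ltW|exact: supnorm_le].
have [qN0|qN0] := eqVneq q`_N 0.
  exfalso; pose p := map_poly (horner_eval 0) q.
  have sp : (size p <= N)%N.
    apply/leq_sizeP => j; rewrite leq_eqVlt => /orP[/eqP <-|Nj].
      by rewrite coef_map qN0 /= horner_evalE horner0.
    exact: (leq_sizeP _ _ (sw 0)).
  pose A := \sum_(i < size p) md p`_i.
  have A0 : 0 <= A by apply: sumr_ge0 => i _; exact: md_ge0.
  pose t : R := Num.max 1 R0 + A / c ^+ N.-1 + 1.
  have q0 : 0 <= A / c ^+ N.-1 by rewrite divr_ge0// exprn_ge0// ltW.
  have t1 : 1 <= t.
    have : 1 <= Num.max 1 R0 by rewrite le_max lexx.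
    by rewrite /t; lra.
  have tR : R0 <= t.
    have : R0 <= Num.max 1 R0 by rewrite le_max lexx orbT.
    by rewrite /t; lra.
  have tA : A / c ^+ N.-1 < t.
    have : 1 <= Num.max 1 R0 by rewrite le_max lexx.
    by rewrite /t; lra.
  have mt : md (real_complex R t : C) = t by rewrite md_realr ger0_norm//; lra.
  have t0 : 0 <= t by lra.
  have := hl (real_complex R t) 0; rewrite mt md0 => /(_ tR t0).
  have -> : (c * t) ^+ N = c * (c ^+ N.-1 * (t * t ^+ N.-1)).
    by rewrite exprMn -exprS prednK// mulrA -exprS prednK.
  rewrite ler_pM2l// -slice_horner -/p.
  have : md p.[real_complex R t] <= A * t ^+ N.-1.
    apply: le_trans (md_horner _ (lexx _)) _; rewrite mt /A mulr_suml.
    apply: ler_sum => i _; apply: ler_wpM2l; first exact: md_ge0.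
    apply: ler_weXn2l => //; have := leq_trans (ltn_ord i) sp; lia.
  move=> h1 h2; have := le_trans h2 h1; rewrite mulrA ler_pM2r; last first.
    by rewrite exprn_gt0//; lra.
  by move: tA; rewrite ltr_pdivrMr ?exprn_gt0// mulrC; lra.
have sN : size q = N.+1.
  apply/eqP; rewrite eqn_leq sq ltnNge; apply/negP => /leq_sizeP/(_ _ (leqnn N)) h.
  by rewrite h eqxx in qN0.
split => //; exists (q`_N)`_0.
  by apply: contraNneq qN0 => h; rewrite (size1_polyC qN) h.
by rewrite lead_coefE sN /= -size1_polyC.
Qed.
End LeadingCoefficient.

Section Growth.
Context {R : realType}.
Local Notation C := (Cplx R).

Lemma iter_conj (G : C2 R -> C2 R) m x :
  iter m (swap \o G \o swap) x = swap (iter m G (swap x)).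
Proof. by elim: m => [|m IH] /=; [rewrite swapK|rewrite IH swapK]. Qed.

Lemma iter_cancel (T : Type) (f g : T -> T) m : cancel f g -> cancel (iter m f) (iter m g).
Proof. by move=> fg; elim: m => [|m IH] x //; rewrite iterSr iterS fg IH. Qed.

Lemma iter_comm (T : Type) (f g : T -> T) m x :
  (forall x, f (g x) = g (f x)) -> f (iter m g x) = iter m g (f x).
Proof. by move=> fg; elim: m => [|m IH] //=; rewrite fg IH. Qed.

Lemma bounded_on_bidisc (F : C2 R -> C2 R) (r : R) : holomorphic F ->
  exists M : R, 1 <= M /\ forall z w, md z <= r -> md w <= r -> supnorm (F (z, w)) <= M.
Proof.
move=> /holomorphic_entire2[[c1 _ _] [c2 _ _]].
have [M1 h1] := jointly_continuous_bounded r c1; have [M2 h2] := jointly_continuous_bounded r c2.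
exists (Num.max 1 (Num.max M1 M2)); split; first by rewrite le_max lexx.
move=> z w zr wr; apply: supnorm_le; first by rewrite le_max lexx.
  by apply: le_trans (h1 _ _ zr wr) _; rewrite !le_max lexx !orbT.
by apply: le_trans (h2 _ _ zr wr) _; rewrite !le_max lexx !orbT.
Qed.

Context (H Hi : C2 R -> C2 R) (D : nat) (R0 c K : R).

(** The cone must start far enough out for the bidisc of radius R0 to contain
    the thin sets of the hull estimate. The bound on R0 gives R0 >= 4, and (c
    R0)^(D^m) >= rho^2 for rho = (2 K)^(D^m). *)
Record regime : Prop := Regime {
  regime_degree : (1 < D)%N;
  regime_c : 0 < c <= 1;
  regime_K : 1 <= K;
  regime_R : 4 * K ^+ 2 <= c * R0;
  regime_henon : henon_like H D Hi R0 c K }.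

Lemma regime_facts : regime -> [/\ (0 < D)%N, 0 <= K, 1 <= c * R0, 4 <= R0 & 0 < c <= 1].
Proof.
move=> [D1 /andP[c0 c1] K1 cR _].
have K2 : 1 <= K ^+ 2 by rewrite exprn_ege1.
have cR1 : 4 <= c * R0 by lra.
have R00 : 0 < R0 by rewrite -(pmulr_rgt0 _ c0); lra.
have cRR : c * R0 <= R0 by rewrite ger_pMl //; lra.
by split; [exact: ltnW|lra|lra|lra|rewrite c0].
Qed.

Lemma regime_forward m : regime -> expanding R0 c K (D ^ m.+1) (iter m.+1 H).
Proof.
move=> reg; have [D0 K0 cR1 R04 /andP[c0 _]] := regime_facts reg.
by apply: expanding_iter => //; case: (regime_henon reg) => _ _ _ _ [].
Qed.

Lemma regime_backward m : regime ->
  expanding R0 c K (D ^ m.+1) (swap \o iter m.+1 Hi \o swap).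
Proof.
move=> reg; have [D0 K0 cR1 R04 /andP[c0 _]] := regime_facts reg.
have -> : swap \o iter m.+1 Hi \o swap = iter m.+1 (swap \o Hi \o swap).
  by apply/funext => x; rewrite iter_conj.
by apply: expanding_iter => //; case: (regime_henon reg) => _ _ _ _ [].
Qed.

Lemma supnorm_iter m x : regime -> supnorm (iter m.+1 H x) <= (K * supnorm x) ^+ (D ^ m.+1).
Proof.
move=> reg; have K1 := regime_K reg.
apply: le_trans ((regime_forward m reg).1 x); rewrite ler_peMl//.
by apply: le_trans (supnorm_ge1 _).
Qed.

Lemma supnorm_iter_inv m x : regime -> supnorm (iter m.+1 Hi x) <= (K * supnorm x) ^+ (D ^ m.+1).
Proof.
move=> reg; have K1 := regime_K reg.
have := (regime_backward m reg).1 (swap x); rewrite /= swapK !supnorm_swap.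
by apply: le_trans; rewrite ler_peMl// (le_trans _ (supnorm_ge1 _)).
Qed.

Lemma supnorm_bidisc x : regime -> md x.1 <= R0 -> md x.2 <= R0 -> supnorm x <= R0.
Proof. move=> /regime_facts[_ _ _ R04 _].
by move=> h1 h2; apply: supnorm_le => //; lra. Qed.

Let rho m : R := (2 * K) ^+ (D ^ m).

Let rho_lt m : regime -> rho m ^+ 2 <= (c * R0) ^+ (D ^ m).
Proof.
move=> reg; have [D0 K0 cR1 R04 _] := regime_facts reg; have cR := regime_R reg.
rewrite /rho -exprM mulnC exprM.
have -> : (2 * K) ^+ 2 = 4 * K ^+ 2 by ring.
by apply: lerXn2r; rewrite ?nnegrE//; [rewrite mulr_ge0// exprn_ge0|lra].
Qed.

(** Outside the bidisc the point would be in the cone expanded by the inverse,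
    and the first coordinate of its image would exceed rho^2. *)
Lemma thin_forward m x : regime -> md x.2 <= 4 -> md (iter m.+1 Hi x).1 <= rho m.+1 ^+ 2 ->
  md x.1 <= R0.
Proof.
move=> reg; have [D0 K0 cR1 R04 c01] := regime_facts reg; have /andP[c0 c1] := c01.
move=> x2 hq; rewrite leNgt; apply/negP => x1.
have [|| _] := (regime_backward m reg).2 (swap x) => /=; first exact: ltW.
  by lra.
rewrite swapK => h.
have : (c * R0) ^+ (D ^ m.+1) < (c * md x.1) ^+ (D ^ m.+1).
  by rewrite ltr_pXn2r ?ltr_pM2l ?nnegrE ?mulr_ge0 ?md_ge0 ?expn_gt0 ?D0//; lra.
move: h hq; have := rho_lt m.+1 reg; have := md_ge0 (iter m.+1 Hi x).1.
rewrite /=; set a := md _; set u := _ ^+ _; set v := _ ^+ _; set s := _ ^+ _ => a0 h1 h2 h3 h4.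
have : c * a <= a by rewrite -[leRHS]mul1r ler_wpM2r.
lra.
Qed.

Lemma thin_backward m y : regime -> md y.1 <= 4 -> md (iter m.+1 H y).2 <= rho m.+1 ^+ 2 ->
  md y.2 <= R0.
Proof.
move=> reg; have [D0 K0 cR1 R04 c01] := regime_facts reg; have /andP[c0 c1] := c01.
move=> y1 hq; rewrite leNgt; apply/negP => y2.
have [|| _] := (regime_forward m reg).2 y => /=; first exact: ltW.
  by lra.
move=> h.
have : (c * R0) ^+ (D ^ m.+1) < (c * md y.2) ^+ (D ^ m.+1).
  by rewrite ltr_pXn2r ?ltr_pM2l ?nnegrE ?mulr_ge0 ?md_ge0 ?expn_gt0 ?D0//; lra.
move: h hq; have := rho_lt m.+1 reg; have := md_ge0 (iter m.+1 H y).2.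
rewrite /=; set a := md _; set u := _ ^+ _; set v := _ ^+ _; set s := _ ^+ _ => a0 h1 h2 h3 h4.
have : c * a <= a by rewrite -[leRHS]mul1r ler_wpM2r.
lra.
Qed.

Context (F : C2 R -> C2 R).

Lemma commutes_inv x : regime -> (forall x, F (H x) = H (F x)) -> F (Hi x) = Hi (F x).
Proof. by move=> [_ _ _ _ [k1 k2 _ _ _]] FH; rewrite -{2}[x]k2 FH k1. Qed.

(** The hull estimate is applied to f o H^-k with q the first coordinate of
    H^-2k, at the point H^k x0. On the set where w is small the point itself
    is in the bidisc of radius R0, and F o H^-k = H^-k o F; on the set where q
    is small the point is the image under H^2k of a point y of this bidisc,
    and F o H^-k takes there the value H^k (F y). *)
Lemma coordinate_growth (f : C -> C -> C) (M0 : R) k x0 : regime ->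
  (forall x, F (H x) = H (F x)) -> entire2 f -> 1 <= M0 ->
  (forall z w, md (f z w) <= supnorm (F (z, w))) ->
  (forall z w, md z <= R0 -> md w <= R0 -> supnorm (F (z, w)) <= M0) ->
  supnorm x0 <= 2 ^+ (D ^ k.+1) ->
  md (f x0.1 x0.2) <= 8 * ((D ^ (k.+1 + k.+1))%:R * ((K * M0) ^+ (D ^ k.+1) + 1)) + 1.
Proof.
move=> reg FH [fc f1 f2] M01 fF hM hx0.
have [D0 K0 cR1 R04 c01] := regime_facts reg; have /andP[c0 c1] := c01.
have K1 := regime_K reg; have cR := regime_R reg.
have FHi x := commutes_inv x reg FH.
set k1 := k.+1; set N := (D ^ (k1 + k1))%N; set M := (K * M0) ^+ (D ^ k1).
have [kk1 kk2 pH pHi _] := regime_henon reg.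
have kE : (k1 + k1 = (k + k1).+1)%N by [].
pose r := Num.max ((K * R0) ^+ (D ^ k1)) (supnorm x0).
have r0 : 0 < r by rewrite lt_max (lt_le_trans ltr01 (supnorm_ge1 x0)) orbT.
have [P hP] := entire_approx2 fc f1 f2 r0 ltr01.
have /polynomial_mapP[[q hq] _] := polynomial_map_iter (k1 + k1) pHi.
have /polynomial_mapP[p1 p2] := polynomial_map_iter k1 pHi.
have [G hG] : poly_fun (fun z w => P.[(iter k1 Hi (z, w)).1, (iter k1 Hi (z, w)).2]).
  by apply: (@poly_fun_comp R (fun a b => P.[a, b])) => //; exists P.
have N0 : (0 < N)%N by rewrite expn_gt0 D0.
have Hk m : cancel (iter m H) (iter m Hi) by exact: iter_cancel.
have Hik m : cancel (iter m Hi) (iter m H) by exact: iter_cancel.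
have [||sq [l l0 lq]] := @leading_coef_constant R q N R0 c K N0 c0 K1.
- move=> z w hz hw; have [|| _] := (regime_backward (k + k1) reg).2 (w, z) => //=.
  by rewrite -kE -hq.
- move=> z w; have := (regime_backward (k + k1) reg).1 (w, z); rewrite /= -/(iter (k + k1).+1 Hi _) supnorm_swap.
  rewrite -(supnorm_swap (w, z)) -kE => h; apply: le_trans h; apply: ler_wpM2l => //.
  by rewrite -hq; exact: supnorm_fst.
have sq' : size q = N.-1.+2 by rewrite sq prednK.
have rho0 : 0 < rho (k1 + k1) by rewrite exprn_gt0// mulr_gt0//; lra.
have B1 x : md x.1 <= R0 -> md x.2 <= R0 -> md P.[(iter k1 Hi x).1, (iter k1 Hi x).2] <= M + 1.
  move=> x1 x2; have NB := supnorm_bidisc reg x1 x2.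
  have hr : supnorm (iter k1 Hi x) <= r.
    apply: le_trans (supnorm_iter_inv _ _ reg) _; rewrite le_max; apply/orP; left.
    apply: lerXn2r; rewrite ?nnegrE ?mulr_ge0 ?(le_trans ler01 (supnorm_ge1 _))//; first by lra.
    exact: ler_wpM2l.
  set y := iter k1 Hi x in hr *.
  have fb : md (f y.1 y.2) <= M.
    apply: le_trans (fF _ _) _; rewrite -surjective_pairing /y (iter_comm _ _ FHi).
    apply: le_trans (supnorm_iter_inv _ _ reg) _.
    apply: lerXn2r; rewrite ?nnegrE ?mulr_ge0 ?(le_trans ler01 (supnorm_ge1 _))//; first by lra.
    apply: ler_wpM2l => //; case: x x1 x2 {NB y hr} => a b; exact: hM.
  have := hP y.1 y.2 (le_trans (supnorm_fst y) hr) (le_trans (supnorm_snd y) hr).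
  have := md_lb P.[y.1, y.2] (- f y.1 y.2); rewrite mdN mdB; lra.
have B2 y : md y.1 <= R0 -> md y.2 <= R0 -> md P.[(iter k1 H y).1, (iter k1 H y).2] <= M + 1.
  move=> x1 x2; have NB := supnorm_bidisc reg x1 x2.
  have hr : supnorm (iter k1 H y) <= r.
    apply: le_trans (supnorm_iter _ _ reg) _; rewrite le_max; apply/orP; left.
    apply: lerXn2r; rewrite ?nnegrE ?mulr_ge0 ?(le_trans ler01 (supnorm_ge1 _))//; first by lra.
    exact: ler_wpM2l.
  set x := iter k1 H y in hr *.
  have fb : md (f x.1 x.2) <= M.
    apply: le_trans (fF _ _) _; rewrite -surjective_pairing /x (iter_comm _ _ FH).
    apply: le_trans (supnorm_iter _ _ reg) _.
    apply: lerXn2r; rewrite ?nnegrE ?mulr_ge0 ?(le_trans ler01 (supnorm_ge1 _))//; first by lra.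
    apply: ler_wpM2l => //; case: y x1 x2 {NB x hr} => a b; exact: hM.
  have := hP x.1 x.2 (le_trans (supnorm_fst x) hr) (le_trans (supnorm_snd x) hr).
  have := md_lb P.[x.1, x.2] (- f x.1 x.2); rewrite mdN mdB; lra.
have hull := @polynomial_hull R N.-1 q G l (rho (k1 + k1)) (M + 1) sq' lq l0 rho0.
have {}hull : forall z w, md w <= rho (k1 + k1) -> md q.[z, w] <= rho (k1 + k1) ->
    md G.[z, w] <= 8 * (N.-1.+1%:R * (M + 1)).
  apply: hull => z w hw hqz.
    rewrite -hG -hq in hqz *.
    set y := iter (k1 + k1) Hi (z, w) in hqz.
    have yE : iter k1 Hi (z, w) = iter k1 H y by rewrite /y iterD Hik.
    rewrite yE; apply: B2; first by lra.
    by apply: (@thin_backward (k + k1) _ reg) => //; rewrite -kE /y Hik.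
  rewrite -hG -hq in hqz *; apply: B1 => /=; last by lra.
  exact: (@thin_forward (k + k1) (z, w) reg).
pose x := iter k1 H x0.
have xb : (K * supnorm x0) ^+ (D ^ k1) <= rho (k1 + k1).
  rewrite /rho expnD exprM; apply: lerXn2r; rewrite ?nnegrE ?exprn_ge0 ?mulr_ge0 ?(le_trans ler01 (supnorm_ge1 _))//.
  rewrite exprMn mulrC; apply: ler_pM => //.
  - by apply: le_trans (supnorm_ge1 _).
  by rewrite -[leLHS]expr1 ler_weXn2l// expn_gt0 D0.
have := hull x.1 x.2; rewrite -hG -hq -surjective_pairing /x Hk.
rewrite iterD Hk prednK// => hfin.
have h1 : md (iter k1 H x0).2 <= rho (k1 + k1).
  by apply: le_trans (supnorm_snd _) (le_trans (supnorm_iter _ _ reg) xb).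
have h2 : md (iter k1 Hi x0).1 <= rho (k1 + k1).
  by apply: le_trans (supnorm_fst _) (le_trans (supnorm_iter_inv _ _ reg) xb).
have h3 := hfin h1 h2.
have x0r : supnorm x0 <= r by rewrite le_max lexx orbT.
have := hP x0.1 x0.2 (le_trans (supnorm_fst x0) x0r) (le_trans (supnorm_snd x0) x0r).
have := md_lb (f x0.1 x0.2) (- P.[x0.1, x0.2]); rewrite mdN.
lra.
Qed.

(** The estimate at scale k bounds F by A^(D^k) on the ball of radius 2^(D^k);
    the least k that suits x gives a bound by a fixed power of the norm of x. *)
Lemma commuting_growth : regime -> holomorphic F -> (forall x, F (H x) = H (F x)) ->
  exists (L : R) (E : nat), 1 <= L /\
  forall x, supnorm (F x) <= L * supnorm x ^+ E.
Proof.
move=> reg Fh FH; have [D0 K0 cR1 R04 c01] := regime_facts reg; have /andP[c0 c1] := c01.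
have K1 := regime_K reg; have D1 := regime_degree reg.
have [M0 [M01 hM]] := bounded_on_bidisc R0 Fh.
have [e1 e2] := holomorphic_entire2 Fh.
pose A := 68 * (K * M0).
have KM : 1 <= K * M0 by nra.
have A1 : 1 <= A by rewrite /A; lra.
have key k x0 : supnorm x0 <= 2 ^+ (D ^ k.+1) -> supnorm (F x0) <= A ^+ (D ^ k.+1).
  move=> hx0; set d := (D ^ k.+1)%N in hx0 *.
  have d0 : (0 < d)%N by rewrite expn_gt0 D0.
  have bd : 8 * ((D ^ (k.+1 + k.+1))%:R * ((K * M0) ^+ d + 1)) + 1 <= A ^+ d.
    have M1 : 1 <= (K * M0) ^+ d by rewrite exprn_ege1.
    have dd : (D ^ (k.+1 + k.+1))%:R <= 4 ^+ d :> R.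
      rewrite expnD -/d natrM (_ : 4 = 2 * 2 :> R); last by ring.
      have : d%:R <= 2 ^+ d :> R by rewrite -natrX ler_nat ltnW// ltn_expl.
      by rewrite exprMn => h; apply: ler_pM.
    have d17 : 17 <= 17 ^+ d :> R by rewrite -[leLHS]expr1 ler_weXn2l//; lra.
    have d4 : 1 <= 4 ^+ d :> R by rewrite exprn_ege1//; lra.
    rewrite /A (_ : 68 = 17 * 4 :> R); last by ring.
    have -> : (17 * 4 * (K * M0)) ^+ d = 17 ^+ d * (4 ^+ d * (K * M0) ^+ d).
      by rewrite !exprMn; ring.
    apply: (@le_trans _ _ (17 * (4 ^+ d * (K * M0) ^+ d))); last first.
      apply: ler_wpM2r => //.
      by rewrite mulr_ge0//; lra.
    set a := (K * M0) ^+ d in M1 *; set b := 4 ^+ d in dd d4 *; set n := _%:R in dd *.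
    have : n * (a + 1) <= b * (2 * a).
      apply: ler_pM => //; rewrite ?ler0n//; lra.
    have : 1 <= b * a by nra.
    lra.
  apply: supnorm_le; first by rewrite exprn_ege1.
    case: x0 hx0 => z w hx0; apply: le_trans bd.
    exact: (@coordinate_growth _ M0 k (z, w) reg FH e1 M01 (fun z w => supnorm_fst _) hM hx0).
  case: x0 hx0 => z w hx0; apply: le_trans bd.
  exact: (@coordinate_growth _ M0 k (z, w) reg FH e2 M01 (fun z w => supnorm_snd _) hM hx0).
have [E0 hE0] : exists E0, A <= 2 ^+ E0.
  exists (Num.bound A); have := archi_boundP (le_trans ler01 A1).
  by move=> /ltW/le_trans; apply; rewrite -natrX ler_nat ltnW// ltn_expl.
exists (A ^+ D), (E0 * D)%N; split; first by rewrite exprn_ege1.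
move=> x; have x1 := supnorm_ge1 x.
have ex : exists k, supnorm x <= 2 ^+ (D ^ k.+1).
  exists (Num.bound (supnorm x)); have := archi_boundP (le_trans ler01 x1).
  move=> /ltW/le_trans; apply; rewrite -natrX ler_nat.
  set b := Num.bound _; apply: (@leq_trans (2 ^ b)); first by rewrite ltnW// ltn_expl.
  rewrite leq_exp2l//; exact: leq_trans (leqnSn _) (ltnW (ltn_expl b.+1 D1)).
have AD : 1 <= A ^+ D by rewrite exprn_ege1.
case: (ex_minnP ex) => -[|k] hk kmin.
  apply: le_trans (key 0%N x hk) _; rewrite expn1 ler_peMr ?exprn_ege1//; lra.
apply: le_trans (key _ x hk) _.
have xk : 2 ^+ (D ^ k.+1) <= supnorm x.
  rewrite leNgt; apply/negP => /ltW/kmin; by rewrite ltnn.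
apply: (@le_trans _ _ (supnorm x ^+ (E0 * D))); last by rewrite ler_peMl// exprn_ge0//; lra.
apply: (@le_trans _ _ ((2 ^+ E0) ^+ (D ^ k.+2))).
  by apply: lerXn2r => //; rewrite nnegrE ?exprn_ge0//; lra.
rewrite -exprM expnSr mulnA [(E0 * _)%N]mulnC -mulnA exprM.
apply: lerXn2r => //; rewrite nnegrE ?exprn_ge0//; lra.
Qed.

Theorem commuting_polynomial : regime -> holomorphic F -> (forall x, F (H x) = H (F x)) ->
  polynomial_map F.
Proof.
move=> reg Fh FH; have [L [E [L1 hL]]] := commuting_growth reg Fh FH.
have Lb (f : C -> C -> C) : entire2 f -> (forall z w, md (f z w) <= supnorm (F (z, w))) -> poly_fun f.
  move=> [_ f1 f2] fF.
  have hN (z w : C) : supnorm (z, w) <= Num.max 1 (md z) * Num.max 1 (md w).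
    have w1 : 1 <= Num.max 1 (md w) by rewrite le_max lexx.
    have w2 : md w <= Num.max 1 (md w) by rewrite le_max lexx orbT.
    have z1 : 1 <= Num.max 1 (md z) by rewrite le_max lexx.
    have z2 : md z <= Num.max 1 (md z) by rewrite le_max lexx orbT.
    by apply: supnorm_le => /=; nra.
  have fb z w : md (f z w) <= L * (Num.max 1 (md z) ^+ E * Num.max 1 (md w) ^+ E).
    apply: le_trans (fF z w) _; apply: le_trans (hL _) _.
    apply: ler_wpM2l; first by lra.
    rewrite -exprMn; apply: lerXn2r; rewrite ?nnegrE//.
      exact: le_trans (supnorm_ge1 _).
    by rewrite mulr_ge0// le_max ler01.
  apply: (@separately_poly R f E) => [w|z].
    apply: (@entire_poly_growth R _ (L * Num.max 1 (md w) ^+ E)) => // z.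
    by rewrite -mulrA [_ ^+ E * _]mulrC.
  have [//|z'|p [_ hp]] := @entire_poly_growth R (f z) (L * Num.max 1 (md z) ^+ E) E.
    by rewrite -mulrA.
  by exists p.
have [e1 e2] := holomorphic_entire2 Fh.
by apply/polynomial_mapP; split; apply: Lb => // z w; [exact: supnorm_fst|exact: supnorm_snd].
Qed.

End Growth.

(** * The order of a root *)

Section ZeroFree.
Context {R : realType}.
Local Notation C := (Cplx R).

Lemma poly_lipschitz (r : {poly C}) t0 : exists B : R, 0 <= B /\
  forall t, md (t - t0) <= 1 -> md (r.[t] - r.[t0]) <= B * md (t - t0).
Proof.
have /factor_theorem[h hE] : root (r - r.[t0]%:P) t0.
  by rewrite /root hornerD hornerN hornerC subrr.
exists (\sum_(i < size h) md h`_i * (md t0 + 1) ^+ i); split.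
  by apply: sumr_ge0 => i _; rewrite mulr_ge0 ?exprn_ge0 ?addr_ge0 ?md_ge0.
move=> t ht; have -> : r.[t] - r.[t0] = h.[t] * (t - t0).
  by rewrite -(hornerC r.[t0] t) -hornerN -hornerD hE hornerM hornerXsubC.
rewrite mdM; apply: ler_wpM2r; first exact: md_ge0.
apply: md_horner; rewrite -[t](subrK t0); apply: le_trans (mdD _ _) _; lra.
Qed.

Lemma nonroot_near (l : {poly C}) t0 (d : R) : l != 0 -> 0 < d ->
  exists t, md (t - t0) <= d /\ l.[t] != 0.
Proof.
move=> l0 d0; apply: contrapT => hn.
have lz : l \Po ('X + t0%:P) = 0.
  apply/polyP => i; rewrite coef0; apply/eqP; rewrite -md_eq0.
  have h : md (l \Po ('X + t0%:P))`_i * d ^+ i <= 0.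
    apply: poly_cauchy; first exact: ltW.
    move=> z zd; rewrite horner_comp hornerD hornerX hornerC.
    have [->|hz] := eqVneq l.[z + t0] 0; first by rewrite md0.
    by exfalso; apply: hn; exists (z + t0); rewrite addrK.
  by rewrite eq_le md_ge0 andbT -(ler_pM2r (exprn_gt0 i d0)) mul0r.
have : size (l \Po ('X + t0%:P)) = size l by rewrite size_comp_poly2// size_XaddC.
by rewrite lz size_poly0 => /esym/eqP; rewrite size_poly_eq0 (negbTE l0).
Qed.

(** At points near t0 that are not roots of l, both sides of the inequality
    tend to their values at t0. *)
Lemma dominated_root (r l : {poly C}) t0 (B : R) : l != 0 -> l.[t0] = 0 -> 0 <= B ->
  (forall t, md (t - t0) <= 1 -> l.[t] != 0 -> md r.[t] <= B * md l.[t]) ->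
  r.[t0] = 0.
Proof.
move=> l0 lt0 B0 hB.
have [B1 [B10 h1]] := poly_lipschitz r t0; have [B2 [B20 h2]] := poly_lipschitz l t0.
apply/eqP; rewrite -md_eq0 eq_le md_ge0 andbT; apply/ler_addgt0Pr => e e0; rewrite add0r.
pose A := B1 + B * B2 + 1.
have BB : 0 <= B * B2 by rewrite mulr_ge0.
have A0 : 0 < A by rewrite /A; lra.
have d0 : 0 < Num.min 1 (e / A) by rewrite lt_min ltr01 divr_gt0.
have [t [td lt]] := nonroot_near t0 l0 d0.
have t1 : md (t - t0) <= 1 by apply: le_trans td _; rewrite ge_min lexx.
have te : md (t - t0) <= e / A by apply: le_trans td _; rewrite ge_min lexx orbT.
have g1 := h1 _ t1; have g2 := h2 _ t1; have g3 := hB _ t1 lt.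
rewrite lt0 subr0 in g2.
have := md_lb r.[t0] (r.[t] - r.[t0]); rewrite (_ : r.[t0] + (r.[t] - r.[t0]) = r.[t]) => [g4|]; last by ring.
have g5 := ler_wpM2l B0 g2.
have tp := md_ge0 (t - t0).
move: te; rewrite ler_pdivlMr// /A => te.
nra.
Qed.

Lemma prod_md_bounds (s : seq C) (z : C) (a b : R) : 0 <= a ->
  (forall y, y \in s -> a <= md (z - y) <= b) ->
  a ^+ size s <= md (\prod_(y <- s) ('X - y%:P)).[z] <= b ^+ size s.
Proof.
move=> a0; elim: s => [|y s IH] h; first by rewrite big_nil hornerC md1 !expr0 !lexx.
have /andP[h1 h2] := h y (mem_head _ _).
have /andP[h3 h4] : a ^+ size s <= md (\prod_(y <- s) ('X - y%:P)).[z] <= b ^+ size s.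
  by apply: IH => x xs; apply: h; rewrite inE xs orbT.
rewrite big_cons hornerM hornerXsubC mdM /= !exprS; apply/andP; split.
  by apply: ler_pM => //; rewrite exprn_ge0.
by apply: ler_pM; rewrite ?md_ge0.
Qed.

(** The roots y of q(., t) have modulus at most max (R1, |t|), so q(s, t) is
    the leading coefficient l(t) times a locally bounded product of factors s
    - y. Near a zero of l this would make q(s, .) vanish at that zero for
    every s; so l has no zeros and is constant. For s large the factors s - y
    are comparable to s. *)
Lemma zero_free_growth (q : {poly {poly C}}) (R1 : R) : 0 < R1 ->
  (forall s t, R1 <= md s -> md t <= md s -> q.[s, t] != 0) ->
  exists E (a b : R), [/\ 0 < a, 0 <= b & forall s t, 2 * R1 <= md s -> 2 * md t <= md s ->
    a * md s ^+ E <= md q.[s, t] <= b * md s ^+ E].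
Proof.
move=> R10 hq.
pose p t := map_poly (horner_eval t) q.
pose l := lead_coef q.
have q0 : q != 0.
  apply/eqP => qz; have := hq (real_complex R R1) 0; rewrite qz !horner0 eqxx md0 md_realr.
  by rewrite ger0_norm ?(ltW R10)// lexx => /(_ isT isT).
have l0 : l != 0 by rewrite lead_coef_eq0.
set E := (size q).-1.
have sE : size q = E.+1 by rewrite /E prednK// size_poly_gt0.
have fac t : l.[t] != 0 -> exists rs, [/\ p t = l.[t] *: \prod_(y <- rs) ('X - y%:P),
    size rs = E & forall y, y \in rs -> md y <= Num.max R1 (md t)].
  move=> lt; have sp : size (p t) = E.+1 by rewrite size_map_poly_id0 ?sE.
  have lp : lead_coef (p t) = l.[t] by rewrite lead_coef_map_eq.
  have [rs rE] := closed_field_poly_normal (p t).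
  have srs : size rs = E.
    by move: sp; rewrite rE size_scale ?lp// size_prod_XsubC => -[].
  exists rs; split => //; first by rewrite -lp.
  move=> y yrs; rewrite leNgt; apply/negP; rewrite gt_max => /andP[y1 y2].
  have := hq y t (ltW y1) (ltW y2); rewrite -slice_horner -/(p t) rE hornerZ.
  by rewrite [X in _ * X](_ : _ = 0) ?mulr0 ?eqxx//; apply/rootP; rewrite root_prod_XsubC.
have lnz t : l.[t] != 0.
  apply/negP => /eqP lt0.
  pose s : C := real_complex R (Num.max R1 (md t)).
  have sm : md s = Num.max R1 (md t).
    by rewrite md_realr ger0_norm// le_max (ltW R10).
  have : q.[s, t] != 0 by apply: hq; rewrite sm le_max lexx ?orbT.
  apply/negP; rewrite negbK; apply/eqP.
  pose B := (md s + (R1 + (md t + 1))) ^+ E.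
  have B0 : 0 <= B.
    by rewrite exprn_ge0// !addr_ge0 ?md_ge0// ltW.
  apply: (dominated_root l0 lt0 B0) => t' tt' lt'.
  have [rs [rE srs hrs]] := fac _ lt'.
  have -> : (q.[s%:P]).[t'] = (p t').[s] by rewrite slice_horner.
  rewrite rE hornerZ mdM mulrC; apply: ler_wpM2r; first exact: md_ge0.
  rewrite /B -srs.
  have := @prod_md_bounds rs s 0 (md s + (R1 + (md t + 1))) (lexx _).
  case/(_ _)/andP => // y yrs; rewrite md_ge0 /=.
  apply: le_trans (md_dist _ _) _; rewrite lerD2l; apply: le_trans (hrs _ yrs) _.
  have t'b : md t' <= md t + 1.
    by rewrite -[t'](subrK t); apply: le_trans (mdD _ _) _; lra.
  by rewrite ge_max; apply/andP; split; have := md_ge0 t; lra.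
have sl : size l = 1%N.
  apply/eqP; apply: contraT => /closed_rootP[x /rootP rx].
  by move: (lnz x); rewrite rx eqxx.
have /size_poly1P[c c0 lc] : size l == 1%N by rewrite sl.
have cp : 0 < md c by rewrite md_gt0.
exists E, (md c * 2^-1 ^+ E), (md c * 2 ^+ E); split.
- by rewrite mulr_gt0// exprn_gt0.
- by rewrite mulr_ge0 ?md_ge0// exprn_ge0.
move=> s t hs ht; have [rs [rE srs hrs]] := fac t (lnz t).
rewrite -slice_horner -/(p t) rE hornerZ mdM lc hornerC -!mulrA -!exprMn.
rewrite !ler_pM2l// -srs; apply: prod_md_bounds.
  by rewrite mulr_ge0 ?md_ge0.
move=> y /hrs; have : Num.max R1 (md t) <= md s / 2 by rewrite ge_max; apply/andP; split; lra.
move=> h1 h2; have := md_dist s y; have := md_lb s (- y); rewrite mdN => h3 h4.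
by apply/andP; split; lra.
Qed.

Lemma power_compare (a b T0 : R) p q : 0 < a ->
  (forall T, T0 <= T -> a * T ^+ p <= b * T ^+ q) -> (p <= q)%N.
Proof.
move=> a0 h; rewrite leqNgt; apply/negP => qp.
pose T := Num.max T0 1 + `|b| / a.
have nb : 0 <= `|b| / a by rewrite divr_ge0// ltW.
have T1 : 1 <= T.
  by have : 1 <= Num.max T0 1 by [rewrite le_max lexx orbT]; rewrite /T; lra.
have TT : T0 <= T.
  by have : T0 <= Num.max T0 1 by [rewrite le_max lexx]; rewrite /T; lra.
have Tb : `|b| + a <= a * T.
  rewrite /T mulrDr mulrCA divff ?gt_eqF// mulr1 addrC lerD2r.
  by rewrite ler_peMr ?(ltW a0)// le_max lexx orbT.
have := h T TT; have Tq : 0 < T ^+ q by rewrite exprn_gt0//; lra.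
have Tp : T ^+ q.+1 <= T ^+ p by rewrite ler_weXn2l.
have h2 := ler_wpM2l (ltW a0) Tp; move=> h3; have := le_trans h2 h3.
rewrite exprS mulrA ler_pM2r//; have := ler_norm b; lra.
Qed.

End ZeroFree.

(** The exponent (k n + 1) is prime to n, so n divides the multiplicity in D
    of every prime. *)
Lemma root_order_bound (n E D k : nat) : (0 < n)%N -> (1 < D)%N ->
  (E ^ n = D ^ (k * n).+1)%N -> (n < D)%N.
Proof.
move=> n0 D1 hE; set p := pdiv D.
have lp : (0 < logn p D)%N by rewrite logn_gt0 mem_primes pdiv_prime// pdiv_dvd ltnW.
have /(congr1 (logn p)) := hE; rewrite !lognX => e.
have : (n %| (k * n).+1 * logn p D)%N by rewrite -e dvdn_mulr.
rewrite Gauss_dvdr; last by rewrite -addn1 /coprime gcdnMDl gcdn1.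
move=> /dvdn_leq -/(_ lp)/leq_ltn_trans; apply.
by apply: ltn_logl; exact: ltnW.
Qed.

Section Finiteness.
Context {R : realType}.
Local Notation C := (Cplx R).
Context (H Hi F Fi : C2 R -> C2 R) (D : nat) (R0 c K : R).

Lemma supnorm_cone x : 1 <= md x.2 -> md x.1 <= md x.2 -> supnorm x = md (x : C2 R).2.
Proof. by move=> h1 h2; apply/eqP; rewrite eq_le supnorm_snd supnorm_le. Qed.

(** Write m for k + 1, and put y = F (H^m x) and d = D^m. If y were not in the
    cone, it would be expanded by H^-m, and |H^-m y| = |F x| <= L |x|^e would
    bound |y|^d by a multiple of |x|^e. But H^m x = F^-1 y gives |x|^d at most
    a multiple of |y|^e; together |x|^(d^2) would be at most a multiple of
    |x|^(e^2), with e < d. *)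
Lemma cone_invariance : regime H Hi D R0 c K -> cancel F Fi -> cancel Fi F ->
  (forall x, F (H x) = H (F x)) -> holomorphic F -> holomorphic Fi ->
  exists k (R1 : R), 1 <= R1 /\ forall x, R1 <= md x.2 -> md x.1 <= md x.2 ->
    let y := F (iter k.+1 H x) in
    [/\ R0 <= md y.2, md y.1 <= md y.2 & md x.2 <= md y.2].
Proof.
move=> reg FFi FiF FH Fh Fih.
have FiH x : Fi (H x) = H (Fi x) by rewrite -{1}[x]FiF -FH FFi.
have [D0 K0 cR1 R04 /andP[c0 c1]] := regime_facts reg.
have D1 := regime_degree reg.
have [L1 [e1 [L11 h1]]] := commuting_growth reg Fh FH.
have [L2 [e2 [L21 h2]]] := commuting_growth reg Fih FiH.
pose e := (maxn e1 e2).+1; pose L := Num.max L1 L2.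
have LL : 1 <= L by rewrite le_max L11.
have hF x : supnorm (F x) <= L * supnorm x ^+ e.
  apply: le_trans (h1 x) _; apply: ler_pM; rewrite ?exprn_ge0 ?(le_trans ler01 (supnorm_ge1 _))//.
  - by lra.
  - by rewrite le_max lexx.
  by apply: ler_weXn2l; [exact: supnorm_ge1|rewrite /e leqW// leq_maxl].
have hFi x : supnorm (Fi x) <= L * supnorm x ^+ e.
  apply: le_trans (h2 x) _; apply: ler_pM; rewrite ?exprn_ge0 ?(le_trans ler01 (supnorm_ge1 _))//.
  - by lra.
  - by rewrite le_max lexx orbT.
  by apply: ler_weXn2l; [exact: supnorm_ge1|rewrite /e leqW// leq_maxr].
pose d := (D ^ e.+1)%N.
have de : (e < d)%N by apply: ltn_trans (ltn_expl e.+1 D1).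
have cd0 : 0 < c ^+ d by rewrite exprn_gt0.
have cde0 : 0 < c ^+ (d * e) by rewrite exprn_gt0.
have cdd0 : 0 < c ^+ (d * d) by rewrite exprn_gt0.
pose A1 := L * R0 ^+ e / c ^+ d.
pose A2 := L ^+ (d + e) / (c ^+ (d * e) * c ^+ (d * d)).
pose A3 := L / c ^+ d.
have A10 : 0 <= A1 by rewrite divr_ge0 ?mulr_ge0 ?exprn_ge0//; lra.
have A20 : 0 <= A2 by rewrite divr_ge0 ?mulr_ge0 ?exprn_ge0//; lra.
have A30 : 0 <= A3 by rewrite divr_ge0 ?exprn_ge0//; lra.
exists e, (R0 + A1 + A2 + A3); split; first by lra.
move=> x x2 x12; set t := md x.2 in x2 x12 *; set u := iter e.+1 H x; set y := F u.
have t1 : 1 <= t by lra.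
have Nx : supnorm x = t by apply: supnorm_cone.
have [u1 u2] : 2 * md u.1 <= md u.2 /\ (c * t) ^+ d <= c * md u.2.
  by apply: (regime_forward e reg).2; rewrite -/t //; lra.
have Nu : (c * t) ^+ d <= supnorm u.
  apply: le_trans u2 _; apply: le_trans (supnorm_snd u).
  by rewrite -[leRHS]mul1r ler_wpM2r ?md_ge0.
have uy : u = Fi y by rewrite /y FFi.
have k1 : (c * t) ^+ d <= L * supnorm y ^+ e by apply: le_trans Nu _; rewrite uy.
have y1 := supnorm_ge1 y.
have big a m : (e < m)%N -> c ^+ d * t ^+ m <= a * t ^+ e -> t <= a / c ^+ d.
  move=> em; rewrite -(subnK (ltnW em)) exprD mulrA ler_pM2r ?exprn_gt0//; last by lra.
  move=> hh; rewrite ler_pdivlMr// mulrC; apply: le_trans hh; apply: ler_wpM2l; first exact: ltW.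
  by rewrite -[leLHS]expr1 ler_weXn2l// subn_gt0.
have small : ~ supnorm y <= R0.
  move=> yR; have : c ^+ d * t ^+ d <= L * R0 ^+ e.
    rewrite -exprMn; apply: le_trans k1 _; apply: ler_wpM2l; first by lra.
    by apply: lerXn2r; rewrite ?nnegrE//; lra.
  have : c ^+ d * t <= c ^+ d * t ^+ d.
    apply: ler_wpM2l; first exact: ltW.
    by rewrite -[leLHS]expr1 ler_weXn2l// (leq_ltn_trans _ de).
  move=> h3 h4; have := le_trans h3 h4; rewrite mulrC -ler_pdivlMr// -/A1; lra.
have y12 : md y.1 <= md y.2.
  rewrite leNgt; apply/negP => yy.
  have [yR|yR] := lerP R0 (md y.1); last first.
    by apply: small; apply: supnorm_le; lra.
  have Ny : supnorm y = md y.1 by rewrite -supnorm_swap supnorm_cone//=; lra.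
  pose b := iter e.+1 Hi y.
  have hb : (c * md y.1) ^+ d <= c * md b.1.
    by have [_] := (regime_backward e reg).2 (swap y) yR (ltW yy); rewrite /= swapK.
  have bE : b = F x.
    have yE : y = iter e.+1 H (F x) by exact: iter_comm.
    rewrite /b yE.
    have hc : cancel H Hi by case: (regime_henon reg).
    exact: (iter_cancel e.+1 hc).
  have k2 : (c * supnorm y) ^+ d <= L * t ^+ e.
    rewrite Ny; apply: le_trans hb _; rewrite bE -Nx; apply: le_trans (hF x).
    apply: le_trans (supnorm_fst _); rewrite -[leRHS]mul1r ler_wpM2r ?md_ge0//.
  have k3 : (c * t) ^+ (d * d) <= (L * supnorm y ^+ e) ^+ d.
    rewrite exprM; apply: lerXn2r => //; rewrite nnegrE.
      by rewrite exprn_ge0// mulr_ge0//; lra.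
    by rewrite mulr_ge0 ?exprn_ge0//; lra.
  have k4 : (c * supnorm y) ^+ (d * e) <= (L * t ^+ e) ^+ e.
    rewrite exprM; apply: lerXn2r => //; rewrite nnegrE.
      by rewrite exprn_ge0// mulr_ge0//; lra.
    by rewrite mulr_ge0 ?exprn_ge0//; lra.
  have k5 : c ^+ (d * e) * (c ^+ (d * d) * t ^+ (d * d)) <= L ^+ (d + e) * t ^+ (e * e).
    rewrite -exprMn; apply: le_trans (ler_wpM2l (ltW cde0) k3) _.
    have -> : c ^+ (d * e) * (L * supnorm y ^+ e) ^+ d = L ^+ d * (c * supnorm y) ^+ (d * e).
      by rewrite !exprMn -exprM [(e * d)%N]mulnC; ring.
    have -> : L ^+ (d + e) * t ^+ (e * e) = L ^+ d * (L * t ^+ e) ^+ e.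
      by rewrite exprMn -exprM exprD mulrA.
    by apply: ler_wpM2l => //; rewrite exprn_ge0//; lra.
  have : t <= A2.
    have k6 : (e * e < d * d)%N by apply: ltn_mul.
    rewrite /A2 ler_pdivlMr ?mulr_gt0// mulrC -mulrA.
    have te : 0 < t ^+ (e * e) by rewrite exprn_gt0//; lra.
    rewrite -(ler_pM2r te); apply: le_trans k5; rewrite -!mulrA -exprS.
    do 2!(apply: ler_wpM2l; first exact: ltW).
    by apply: ler_weXn2l.
  lra.
have yR : R0 <= md y.2.
  by rewrite leNgt; apply/negP => yy; apply: small; apply: supnorm_le; lra.
split=> //; rewrite leNgt; apply/negP => yt.
have Ny : supnorm y = md y.2 by apply: supnorm_cone => //; lra.
have : t <= A3.
  apply: (big L d) => //; rewrite -exprMn; apply: le_trans k1 _.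
  apply: ler_wpM2l; first by lra.
  by rewrite Ny; apply: lerXn2r; rewrite ?nnegrE ?md_ge0//; exact: ltW.
lra.
Qed.

Lemma cone_power (Phi : C2 R -> C2 R) E (a b S : R) j : 0 <= S -> 0 < a -> 0 <= b ->
  (forall x, S <= md x.2 -> 2 * md x.1 <= md x.2 ->
     [/\ 2 * md (Phi x).1 <= md (Phi x).2, md x.2 <= md (Phi x).2 &
         a * md x.2 ^+ E <= md (Phi x).2 <= b * md x.2 ^+ E]) ->
  exists a' b' : R, 0 < a' /\ forall x, S <= md x.2 -> 2 * md x.1 <= md x.2 ->
    [/\ 2 * md (iter j Phi x).1 <= md (iter j Phi x).2,
        S <= md (iter j Phi x).2 &
        a' * md x.2 ^+ (E ^ j) <= md (iter j Phi x).2 <= b' * md x.2 ^+ (E ^ j)].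
Proof.
move=> S0 a0 b0 hP; elim: j => [|j [a' [b' [a'0 IH]]]].
  by exists 1, 1; split=> // x h1 h2; rewrite expn0 expr1 mul1r lexx.
exists (a * a' ^+ E), (b * b' ^+ E); split; first by rewrite mulr_gt0// exprn_gt0.
move=> x h1 h2; have [g1 g2 /andP[g3 g4]] := IH x h1 h2.
have [k1 k2 /andP[k3 k4]] := hP _ g2 g1; split => //=; first exact: le_trans k2.
have x0 := md_ge0 x.2.
rewrite -!mulrA expnSr ![_ ^+ (_ * E)]exprM -!exprMn; apply/andP; split.
  apply: le_trans k3; apply: ler_wpM2l; first exact: ltW.
  apply: lerXn2r => //; rewrite nnegrE ?md_ge0//.
  by rewrite mulr_ge0 ?exprn_ge0// ltW.
apply: le_trans k4 _.
apply: ler_wpM2l => //; apply: lerXn2r => //; rewrite nnegrE ?md_ge0//.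
exact: le_trans (md_ge0 _) g4.
Qed.

(** The map Phi = H F H^(k+1) preserves a cone on which its second coordinate
    is comparable to the E-th power, hence its n-th iterate to the power E^n.
    This iterate is H^m with m = (k + 2) n + 1, whose second coordinate is
    comparable to the power D^m. *)
Theorem root_order_lt n : regime H Hi D R0 c K -> cancel F Fi -> cancel Fi F ->
  holomorphic F -> holomorphic Fi -> (0 < n)%N -> iter n F = H -> (n < D)%N.
Proof.
move=> reg FFi FiF Fh Fih n0 FnH.
have FH x : F (H x) = H (F x) by rewrite -FnH -iterS iterSr.
have [D0 K0 cR1 R04 /andP[c0 c1]] := regime_facts reg.
have D1 := regime_degree reg; have K1 := regime_K reg.
have [k [R1 [R11 cone]]] := cone_invariance reg FFi FiF FH Fh Fih.
have pF := commuting_polynomial reg Fh FH.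
have pH : polynomial_map H by case: (regime_henon reg).
have H1 := regime_forward 0 reg; rewrite expn1 /= in H1.
pose Phi x := H (F (iter k.+1 H x)).
have conePhi x : R1 <= md x.2 -> md x.1 <= md x.2 ->
    2 * md (Phi x).1 <= md (Phi x).2 /\ md x.2 <= md (Phi x).2.
  move=> x2 x12; have [y2 y12 xy] := cone x x2 x12.
  have [s1 _] := expanding_step D0 c0 cR1 H1 y2 y12.
  have [s2 _] := H1.2 _ y2 y12; split => //; exact: le_trans s1.
have pPhi : polynomial_map Phi.
  exact: (polynomial_map_comp pH (polynomial_map_comp pF (polynomial_map_iter k.+1 pH))).
have /polynomial_mapP[_ [P hP]] := pPhi.
have nz s t : R1 <= md s -> md t <= md s -> (swapXY P).[s, t] != 0.
  move=> hs hts; rewrite horner2_swapXY -hP -md_gt0.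
  by have [_ /= h] := conePhi (t, s) hs hts; apply: lt_le_trans h; lra.
have R1p : 0 < R1 by lra.
have [E [a [b [a0 b0 hE]]]] := zero_free_growth R1p nz.
pose S := 2 * R1.
have S0 : 0 <= S by rewrite mulr_ge0// ltW.
have step x : S <= md x.2 -> 2 * md x.1 <= md x.2 ->
     [/\ 2 * md (Phi x).1 <= md (Phi x).2, md x.2 <= md (Phi x).2 &
         a * md x.2 ^+ E <= md (Phi x).2 <= b * md x.2 ^+ E].
  rewrite /S => x2 x12; have x10 := md_ge0 x.1.
  have [||q1 q2] := conePhi x; [lra|lra|split => //].
  by have := hE x.2 x.1 x2 x12; rewrite horner2_swapXY -hP -surjective_pairing.
have [a' [b' [a'0 grow]]] := cone_power n S0 a0 b0 step.
(* As F^n = H, the n-th iterate of Phi is itself an iterate of H. *)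
have PhiE j x : iter j Phi x = iter (k.+2 * j) H (iter j F x).
  elim: j => [|j IH]; first by rewrite muln0.
  rewrite iterS IH /Phi -iterD.
  by rewrite (iter_comm _ _ FH) -!iterS mulnS addSn.
have Phin x : iter n Phi x = iter (k.+2 * n).+1 H x by rewrite PhiE FnH -iterSr.
set m := (k.+2 * n)%N in Phin.
have S1 : 1 <= S by rewrite /S; lra.
pose pt (T : R) : C2 R := (0, real_complex R T).
have pt1 T : md (pt T).1 = 0 by rewrite md0.
have pt2 T : 0 <= T -> md (pt T).2 = T by move=> T0; rewrite md_realr ger0_norm.
have growPt T : S <= T ->
    a' * T ^+ (E ^ n) <= md (iter m.+1 H (pt T)).2 <= b' * T ^+ (E ^ n).
  move=> ST; have T0 : 0 <= T by lra.
  have h1 : S <= md (pt T).2 by rewrite pt2.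
  have h2 : 2 * md (pt T).1 <= md (pt T).2 by rewrite pt1 pt2// mulr0.
  by have [_ _] := grow _ h1 h2; rewrite Phin pt2.
have le1 : (E ^ n <= D ^ m.+1)%N.
  apply: (@power_compare R a' (K ^+ (D ^ m.+1)) S _ _ a'0) => T ST.
  have T0 : 0 <= T by lra.
  have /andP[g _] := growPt T ST; apply: le_trans g _.
  apply: le_trans (supnorm_snd _) _; apply: le_trans (supnorm_iter _ _ reg) _.
  by rewrite supnorm_cone pt2// ?pt1 ?exprMn//; lra.
have le2 : (D ^ m.+1 <= E ^ n)%N.
  have cm : 0 < c ^+ (D ^ m.+1) by rewrite exprn_gt0.
  apply: (@power_compare R (c ^+ (D ^ m.+1)) b' (Num.max S R0) _ _ cm) => T.
  rewrite ge_max => /andP[ST RT]; have T0 : 0 <= T by lra.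
  have /andP[_ g] := growPt T ST; apply: le_trans _ g.
  have h1 : R0 <= md (pt T).2 by rewrite pt2.
  have h2 : md (pt T).1 <= md (pt T).2 by rewrite pt1 pt2.
  have [_] := (regime_forward m reg).2 _ h1 h2; rewrite pt2// exprMn => h.
  apply: le_trans h _; by rewrite -[leRHS]mul1r ler_wpM2r ?md_ge0.
apply: (@root_order_bound n E D k.+2) => //.
by apply/eqP; rewrite eqn_leq le1 le2.
Qed.

End Finiteness.

Theorem mainTheorem2 (R : realType) (H : C2 R -> C2 R) :
  henon_compositions H ->
  (forall (n : nat) (F : C2 R -> C2 R),
      compositional_root n F H -> polynomial_map F) /\
  finite_set [set n : nat | exists F : C2 R -> C2 R, compositional_root n F H].
Proof.
move=> hH.
have [D [Hi [R0 [c [K [hD hc hK hl]]]]]] := henon_compositions_like hH.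
have [c0 c1] := andP hc.
pose R1 := Num.max R0 (4 * K ^+ 2 / c).
have reg : regime H Hi D R1 c K.
  split=> //; first by rewrite -ler_pdivrMl// mulrC le_max lexx orbT.
  apply: henon_like_weaken hl; first exact: ltnW.
  - by rewrite le_max lexx.
  - by rewrite c0 lexx.
  - by rewrite hK lexx.
split=> [n F [_ [Fh _] FnH]|].
  apply: (commuting_polynomial reg Fh) => x.
  by rewrite -FnH -iterS iterSr.
apply: (sub_finite_set _ (finite_II D)) => n [F [n0 [Fh [G [Gh FG GF]]] FnH]].
exact: root_order_lt reg FG GF Fh Gh n0 FnH.
Qed.
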